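(* Let $G$ be a signed eulerian graph and let $\Phi(G)$ denote its flow number. Then: (a) $G$ has no nowhere-zero integer flow if and only if $G$ is unbalanced and $G-e$ is balanced for some edge $e$; (b) $\Phi(G)=2$ if and only if $G$ has an even number of negative edges; (c) $\Phi(G)=3$ if and only if $G$ can be decomposed into three edge-disjoint eulerian subgraphs, each with an odd number of negative edges, that share a common vertex; (d) $\Phi(G)=4$ in all remaining cases (i.e. whenever $G$ has a nowhere-zero integer flow and neither (b) nor (c) applies).
   Context: Graphs are finite and may have loops and multiple edges. A signed graph is a graph $G$ with a signature $\sigma:E(G)\to\{+1,-1\}$; edges with sign $-1$ are negative, others positive. The sign of a set of edges or subgraph is the product of the signs of its edges. A circuit is a connected 2-regular graph; it is balanced if its sign is $+1$ and unbalanced otherwise. A signed graph is balanced if it contains no unbalanced circuit. A graph is eulerian if it is connected and every vertex has even valency. Each edge consists of two half-edges, one at each end. An orientation of a signed graph directs each half-edge toward or away from its end-vertex so that for each positive edge exactly one half-edge points toward its end, while for each negative edge either both half-edges point away from their ends (extroverted) or both point toward them (introverted). For an abelian group $A$, an $A$-flow is a map $\xi:E(G)\to A$ such that at every vertex $v$ the sum of $\xi(e)$ over half-edges at $v$ directed out of $v$ minus the sum of $\xi(e)$ over half-edges at $v$ directed into $v$ equals $0$ (a loop contributes through both of its half-edges). Reversing both half-edges of an edge and negating its value preserves flows, so existence of flows does not depend on the chosen orientation. A flow is nowhere-zero if no edge gets value $0$. A nowhere-zero $k$-flow is a $\mathbb{Z}$-flow with values in $\{\pm1,\dots,\pm(k-1)\}$.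 The flow number $\Phi(G)$ is the least $k$ such that $G$ has a nowhere-zero $k$-flow. *)

(* Defs.v *)
From mathcomp Require Import all_boot all_order all_algebra.

Set Implicit Arguments.
Unset Strict Implicit.
Unset Printing Implicit Defensive.

Import GRing.Theory Num.Theory.
Local Open Scope ring_scope.

(* The two half-edges of an edge [e] are the pairs [(e, false)] and            *)
(* [(e, true)]; a loop is an edge whose half-edges have the same end.          *)
(* [negative e] means that the signature takes the value -1 on [e].            *)
Record signed_graph := SignedGraph {
  vertex : finType;
  edge : finType;
  half_end : edge * bool -> vertex;
  negative : pred edge }.

Arguments half_end {s} h.
Arguments negative {s} e.

Record subgraph (G : signed_graph) := Subgraph {
  vset : {set vertex G};
  eset : {set edge G};
  ends_in_vset : forall h : edge G * bool, h.1 \in eset -> half_end h \in vset }.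

Definition sub_of (G : signed_graph) (H K : subgraph G) : bool :=
  (vset H \subset vset K) && (eset H \subset eset K).

Definition whole (G : signed_graph) : subgraph G :=
  @Subgraph G [set: vertex G] [set: edge G] (fun h _ => in_setT (half_end h)).

Definition del_edge (G : signed_graph) (e : edge G) : subgraph G :=
  @Subgraph G [set: vertex G] [set~ e] (fun h _ => in_setT (half_end h)).

Section Subgraphs.
Variables (G : signed_graph) (H : subgraph G).

(* Valency counts half-edges, so a loop contributes 2. *)
Definition valency (v : vertex G) : nat :=
  #|[set h : edge G * bool | (h.1 \in eset H) && (half_end h == v)]|.

Definition adjacent : rel (vertex G) := fun x y =>
  [exists e in eset H, exists b : bool,
     (half_end (e, b) == x) && (half_end (e, ~~ b) == y)].

(* [adjacent] only relates vertices of [H], so walks starting in [H] stay      *)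
(* in [H].                                                                     *)
Definition connected : Prop :=
  vset H != set0 /\ {in vset H &, forall x y, connect adjacent x y}.

Definition circuit : Prop :=
  connected /\ {in vset H, forall v, valency v = 2%N}.

Definition eulerian : Prop :=
  connected /\ {in vset H, forall v, ~~ odd (valency v)}.

Definition num_negative : nat := #|[set e in eset H | negative e]|.

Definition sign : int := \prod_(e in eset H) (-1) ^+ negative e.

End Subgraphs.

Definition balanced (G : signed_graph) (H : subgraph G) : Prop :=
  forall C : subgraph G, sub_of C H -> circuit C -> sign C = 1.

(* [o h] holds when the half-edge [h] points toward its end: both or neither   *)
(* half-edge of a negative edge do, exactly one half-edge of a positive one.   *)
Definition orientation (G : signed_graph) (o : pred (edge G * bool)) : Prop :=
  forall e : edge G, (o (e, false) == o (e, true)) = negative e.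

Definition is_flow (G : signed_graph) (o : pred (edge G * bool))
    (A : zmodType) (xi : edge G -> A) : Prop :=
  forall v : vertex G,
    \sum_(h : edge G * bool | (half_end h == v) && ~~ o h) xi h.1
    - \sum_(h : edge G * bool | (half_end h == v) && o h) xi h.1 = 0.

(* Which orientation is used does not matter: reversing both half-edges of an  *)
(* edge and negating its value preserves flows.                                *)
Definition has_nz_flow (G : signed_graph) (A : zmodType) : Prop :=
  exists (o : pred (edge G * bool)) (xi : edge G -> A),
    [/\ orientation o, is_flow o xi & forall e, xi e != 0].

Definition has_nz_kflow (G : signed_graph) (k : nat) : Prop :=
  exists (o : pred (edge G * bool)) (xi : edge G -> int),
    [/\ orientation o, is_flow o xi & forall e, 0 < `|xi e| < k%:Z].

(* [flow_number G k] is "the flow number of [G] exists and equals [k]".        *)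
(* Nowhere-zero k-flows are considered for k >= 2, as usual; this matters only *)
(* for edgeless graphs, whose flow number is thereby 2.                        *)
Definition flow_number (G : signed_graph) (k : nat) : Prop :=
  [/\ (2 <= k)%N, has_nz_kflow G k
    & forall j, (2 <= j)%N -> has_nz_kflow G j -> (k <= j)%N].

Definition odd_triple_decomposition (G : signed_graph) : Prop :=
  exists H : 'I_3 -> subgraph G,
    [/\ forall i, eulerian (H i),
        forall i, odd (num_negative (H i)),
        forall i j, i != j -> [disjoint eset (H i) & eset (H j)],
        \bigcup_(i < 3) eset (H i) = [set: edge G]
      & exists v : vertex G, forall i, v \in vset (H i)].

(* Main.v *)
Require Import Defs.
From Stdlib Require Import Classical.
From mathcomp Require Import all_boot all_order all_algebra zify ring.

(* A closed Euler trail carries the values 1 and -1 so that the balance at each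
   vertex vanishes, except that an odd trail leaves 2 at its base vertex; this
   gives (b), and the values 1, 1, -2 on three odd closed trails through a
   common vertex give a 3-flow.

   4-flows.  In an odd Euler trail, two visits of one vertex cut out an arc on
   which a flow with values 1 and -1 lives: the segment between the visits if
   it is even, and its complement otherwise.  If the arcs cover the trail, then
   in a minimal cover every edge lies in at most two arcs, and twice the flow of
   one arc plus the coherently oriented flows of the others is a nowhere-zero
   4-flow.  If an edge is in no arc, then the signature can be switched so that
   this edge is the only negative one; there is then no nowhere-zero flow, and
   deleting the edge leaves a balanced graph.

   3-flows.  A nowhere-zero 3-flow is read modulo 3 as an orientation with zero
   balance in 'F_3.  To find three odd closed trails through a common vertex,
   take a smallest counterexample.  Splicing an incoming half-edge with an
   outgoing one makes it smaller, hence every vertex is a source or a sink and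
   all valencies are multiples of 6; a 2-edge cut can be replaced by an edge.  If
   there is no 4-edge cut either, the graph is 6-edge-connected, and Lovasz's
   splitting-off theorem shows that without the three trails the signature can
   be switched to have a single negative edge, which excludes a flow.  A minimal
   side of a 4-edge cut is handled in the same way and contracted, unless it is
   a single vertex with a negative loop; two disjoint such sides exist in that
   case, and their loops are two of the three trails. *)


Set Implicit Arguments.
Unset Strict Implicit.
Unset Printing Implicit Defensive.

(** * Signed multigraphs and trails *)

(* [(x, y, s)] is an edge between [x] and [y], negative (or odd) when [s] holds. *)
Notation ed V := ((V * V * bool)%type).

Section Lists.
Variable V : finType.
Implicit Types (l m r : seq (ed V)) (e : ed V) (X Y S T : {set V}) (v w : V).

Definition hits v e : nat := (e.1.1 == v) + (e.1.2 == v).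
Definition deg v l := \sum_(e <- l) hits v e.
Definition cross X e : bool := (e.1.1 \in X) (+) (e.1.2 \in X).
Definition cut X l := count (cross X) l.
Definition par l := odd (count snd l).
Definition inside X e : bool := (e.1.1 \in X) && (e.1.2 \in X).
Definition ev l := forall v, ~~ odd (deg v l).
Definition supp X l : bool := all (inside X) l.
Definition conn k T l := forall X x y,
  x \in T -> y \in T -> x \in X -> y \notin X -> k <= cut X l.
Definition tint (c : V -> bool) e : bool := e.2 (+) c e.1.1 (+) c e.1.2.

(* [red S l m]: the edges of [m] are the end-vertex and sign data of the parts of a
   decomposition of [l] into trails whose inner vertices are in [S]. *)
Inductive red S : seq (ed V) -> seq (ed V) -> Prop :=
| red_perm l m of perm_eq l m : red S l m
| red_flip x y s l : red S ((x, y, s) :: l) ((y, x, s) :: l)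
| red_splice a w b s t l of w \in S :
    red S ((a, w, s) :: (w, b, t) :: l) ((a, b, s (+) t) :: l)
| red_trans m l r of red S l m & red S m r : red S l r.

Definition triple l := exists x m,
  [/\ red setT l m, supp [set x] m & 3 <= count snd m].

Lemma red_refl S l : red S l l.
Proof. exact: red_perm. Qed.

Lemma red_cat S l m r : red S l m -> red S (l ++ r) (m ++ r).
Proof.
elim=> {l m} [l m plm|x y s l|a w b s t l wS|m l k _ IH1 _ IH2].
- by apply: red_perm; rewrite perm_cat2r.
- exact: red_flip.
- exact: red_splice.
- exact: red_trans IH1 IH2.
Qed.

Lemma red_catl S l m r : red S l m -> red S (r ++ l) (r ++ m).
Proof.
move=> lm; apply: (@red_trans _ (l ++ r)); first by apply: red_perm; rewrite perm_catC.
apply: (@red_trans _ (m ++ r)); first exact: red_cat.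
by apply: red_perm; rewrite perm_catC.
Qed.

Lemma red_cons S e l m : red S l m -> red S (e :: l) (e :: m).
Proof. exact: (@red_catl S l m [:: e]). Qed.

Lemma red_sub S T l m : S \subset T -> red S l m -> red T l m.
Proof.
move=> /subsetP ST; elim=> {l m} [l m plm|x y s l|a w b s t l wS|m l k _ IH1 _ IH2].
- exact: red_perm.
- exact: red_flip.
- exact: red_splice (ST _ wS).
- exact: red_trans IH1 IH2.
Qed.

Lemma triple_red S l m : red S l m -> triple m -> triple l.
Proof.
move=> lm [x [r [mr xr cr]]]; exists x, r; split=> //.
exact: red_trans (red_sub (subsetT _) lm) mr.
Qed.

Lemma red_par S l m : red S l m -> par m = par l.
Proof.
elim=> {l m} [l m plm|x y s l|a w b s t l wS|m l k _ IH1 _ IH2] //; rewrite /par /=.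
- by rewrite (permP plm).
- by rewrite !oddD !oddb addbA.
- by rewrite -/(par k) IH2.
Qed.

Lemma red_odd_deg S l m v : red S l m -> odd (deg v m) = odd (deg v l).
Proof.
elim=> {l m} [l m plm|x y s l|a w b s t l wS|m l k _ IH1 _ IH2] //; rewrite /deg.
- by rewrite (perm_big _ plm).
- by rewrite !big_cons /hits /= [(y == v) + _]addnC.
- rewrite !big_cons /hits /= !oddD.
  by rewrite !oddb; case: (a == v); case: (w == v); case: (b == v); rewrite /= ?negbK.
- by rewrite -/(deg v k) IH2.
Qed.

Lemma red_ev S l m : red S l m -> ev l -> ev m.
Proof. by move=> lm el v; rewrite (red_odd_deg v lm). Qed.

Lemma red_deg S l m v : red S l m -> v \notin S -> deg v m = deg v l.
Proof.
move=> lm vS; elim: lm => {l m} [l m plm|x y s l|a w b s t l wS|m l k _ IH1 _ IH2] //.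
- by rewrite /deg (perm_big _ plm).
- by rewrite /deg !big_cons /hits /= [(y == v) + _]addnC.
- rewrite /deg !big_cons /hits /=.
  have -> : (w == v) = false by apply: contraNF vS => /eqP<-.
  by lia.
- by rewrite IH2.
Qed.

Lemma red_cut S l m X : red S l m -> cut X m <= cut X l.
Proof.
elim=> {l m} [l m plm|x y s l|a w b s t l wS|m l k _ IH1 _ IH2] //; rewrite /cut /=.
- by rewrite (permP plm).
- by rewrite /cross /= addbC.
- by rewrite /cross /=; case: (a \in X); case: (w \in X); case: (b \in X) => /=; lia.
- exact: leq_trans IH2 IH1.
Qed.

Lemma cutC X l : cut (~: X) l = cut X l.
Proof. by apply: eq_count => e; rewrite /cross !inE; do 2!case: (_ \in _). Qed.

Lemma cut_cat X l m : cut X (l ++ m) = cut X l + cut X m.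
Proof. exact: count_cat. Qed.

Lemma deg_cat v l m : deg v (l ++ m) = deg v l + deg v m.
Proof. exact: big_cat. Qed.

Lemma perm_cut X l m : perm_eq l m -> cut X l = cut X m.
Proof. by move/permP; exact. Qed.

Lemma perm_deg v l m : perm_eq l m -> deg v l = deg v m.
Proof. exact: perm_big. Qed.

Lemma perm_par l m : perm_eq l m -> par l = par m.
Proof. by move/permP=> p; rewrite /par p. Qed.

Lemma perm_ev l m : perm_eq l m -> ev l -> ev m.
Proof. by move=> p el v; rewrite -(perm_deg v p). Qed.

Lemma conn_le k j T l m :
  (forall X, cut X l <= cut X m) -> j <= k -> conn k T l -> conn j T m.
Proof.
move=> lm jk C X x y xT yT xX yX.
exact: leq_trans (leq_trans jk (C X x y xT yT xX yX)) (lm X).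
Qed.

Lemma conn_sub k T T' l : T' \subset T -> conn k T l -> conn k T' l.
Proof. by move=> /subsetP TT C X x y /TT xT /TT yT; exact: C. Qed.

Lemma conn_perm k T l m : perm_eq l m -> conn k T l -> conn k T m.
Proof. by move=> lm; apply: conn_le => // X; rewrite (perm_cut X lm). Qed.

Lemma odd_cut X l : odd (cut X l) = odd (\sum_(v in X) deg v l).
Proof.
rewrite /deg exchange_big /= /cut.
elim: l => [|e l IH]; first by rewrite big_nil.
rewrite big_cons /= !oddD IH; congr (_ (+) _).
rewrite /hits big_split /= oddD /cross.
have H u : \sum_(v in X) (u == v) = (u \in X).
  have [uX|uX] := boolP (u \in X).
    by rewrite (bigD1 u) //= eqxx big1 ?addn0 // => v /andP[_ /negPf]; rewrite eq_sym => ->.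
  by rewrite big1 // => v vX; case: eqP => // uv; rewrite uv vX in uX.
by rewrite !H; do 2!case: (_ \in _).
Qed.

Lemma even_cut X l : ev l -> ~~ odd (cut X l).
Proof.
move=> el; rewrite odd_cut; elim/big_rec: _ => // v n _ nn.
by rewrite oddD (negPf (el v)).
Qed.

Lemma red_supp S X l m : red S l m -> supp X l -> supp X m.
Proof.
elim=> {l m} [l m plm|x y s l|a w b s t l wS|m l k _ IH1 _ IH2] //=.
- by rewrite /supp (perm_all _ plm).
- by rewrite /inside /= => /andP[/andP[-> ->] ->].
- by rewrite /inside /= => /and3P[/andP[-> _] /andP[_ ->] ->].
- by move/IH1/IH2.
Qed.

Lemma supp_sub X Y l : X \subset Y -> supp X l -> supp Y l.
Proof.
move=> /subsetP XY; apply: sub_all => e /andP[/XY e1 /XY e2]; exact/andP.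
Qed.

Lemma perm_supp X l m : perm_eq l m -> supp X l = supp X m.
Proof. exact: perm_all. Qed.

Lemma cut_restrict D X l : supp D l -> cut (X :&: D) l = cut X l.
Proof.
move=> /allP Dl; apply: eq_in_count => e /Dl /andP[e1 e2].
by rewrite /cross !inE e1 e2 !andbT.
Qed.

Lemma exists_cross X l : 0 < cut X l ->
  exists a b s m, [/\ red set0 l ((a, b, s) :: m), a \in X, b \notin X &
    perm_eq l ((a, b, s) :: m) \/ perm_eq l ((b, a, s) :: m)].
Proof.
rewrite -has_count => /hasP[[[a b] s] abl].
rewrite /cross /=; case: (boolP (a \in X)) => aX /= bX.
  exists a, b, s, (rem (a, b, s) l); split=> //.
    by apply: red_perm; exact: perm_to_rem.
  by left; exact: perm_to_rem.
exists b, a, s, (rem (a, b, s) l); split=> //.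
  apply: red_trans (red_flip _ _ _ _ _); apply: red_perm; exact: perm_to_rem.
by right; exact: perm_to_rem.
Qed.

End Lists.

(** * Splitting off at a vertex *)
Section Splitting.
Variable V : finType.
Implicit Types (l m r : seq (ed V)) (e : ed V) (X Y S T : {set V}) (v w : V).

Lemma red0_sym l m : red set0 l m -> red set0 m l.
Proof.
elim=> {l m} [l m plm|x y s l|a w b s t l|m l k _ IH1 _ IH2].
- by apply: red_perm; rewrite perm_sym.
- exact: red_flip.
- by rewrite inE.
- exact: red_trans IH2 IH1.
Qed.

Lemma red0_cut X l m : red set0 l m -> cut X m = cut X l.
Proof.
move=> lm; apply/eqP; rewrite eqn_leq (red_cut X lm) /=.
exact: red_cut (red0_sym lm).
Qed.

Lemma red0_deg v l m : red set0 l m -> deg v m = deg v l.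
Proof. by move/red_deg; apply; rewrite inE. Qed.

Lemma red0_conn k T l m : red set0 l m -> conn k T l -> conn k T m.
Proof. by move=> lm; apply: conn_le => // X; rewrite (red0_cut X lm). Qed.

Lemma red0_all (p : pred (ed V)) l m :
  (forall x y s, p (x, y, s) = p (y, x, s)) -> red set0 l m -> all p l = all p m.
Proof.
move=> pC; elim=> {l m} [l m plm|x y s l|a w b s t l|m l k _ -> _ ->] //.
- exact: perm_all.
- by rewrite /= pC.
- by rewrite inE.
Qed.

Lemma red0_count (p : pred (ed V)) l m :
  (forall x y s, p (x, y, s) = p (y, x, s)) -> red set0 l m -> count p l = count p m.
Proof.
move=> pC; elim=> {l m} [l m plm|x y s l|a w b s t l|m l k _ -> _ ->] //.
- by rewrite (permP plm).
- by rewrite /= pC.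
- by rewrite inE.
Qed.

Lemma red0_sub S l m : red set0 l m -> red S l m.
Proof. exact/red_sub/sub0set. Qed.

Lemma cutUI X Y l : cut (X :|: Y) l + cut (X :&: Y) l <= cut X l + cut Y l.
Proof.
elim: l => //= e l IH; rewrite /cut /= -!/(cut _ _) /cross !inE.
by case: (e.1.1 \in X); case: (e.1.2 \in X); case: (e.1.1 \in Y); case: (e.1.2 \in Y) => /=; lia.
Qed.

Lemma cutDD X Y a w l :
  has (fun e => ((e.1.1 == a) && (e.1.2 == w))) l ->
  a \in X -> a \in Y -> w \notin X -> w \notin Y ->
  cut (X :\: Y) l + cut (Y :\: X) l + 2 <= cut X l + cut Y l.
Proof.
have H m : cut (X :\: Y) m + cut (Y :\: X) m <= cut X m + cut Y m.
  elim: m => //= e m IH; rewrite /cut /= -!/(cut _ _) /cross !inE.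
  by case: (e.1.1 \in X); case: (e.1.2 \in X); case: (e.1.1 \in Y); case: (e.1.2 \in Y) => /=; lia.
move=> + aX aY wX wY; elim: l => //= e l IH /orP[/andP[/eqP e1 /eqP e2]|/IH {}IH].
  rewrite /cut /= -!/(cut _ _) /cross !inE e1 e2 aX aY (negPf wX) (negPf wY) /=.
  have := H l; lia.
rewrite /cut /= -!/(cut _ _) /cross !inE.
by case: (e.1.1 \in X); case: (e.1.2 \in X); case: (e.1.1 \in Y); case: (e.1.2 \in Y) => /=; lia.
Qed.

Lemma exists_hit w l : 0 < deg w l -> exists b t m, red set0 l ((w, b, t) :: m).
Proof.
move=> d0; have : has (fun e => 0 < hits w e) l.
  rewrite has_count lt0n; apply: contraTneq d0 => c0; rewrite -leqNgt leqn0 /deg.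
  rewrite big_seq_cond big1 // => e; rewrite andbT => el.
  apply/eqP; rewrite -leqn0 leqNgt; apply/negP => h.
  have : 0 < count (fun e => 0 < hits w e) l by rewrite -has_count; apply/hasP; exists e.
  by rewrite c0.
move=> /hasP[[[a b] s] el]; rewrite /hits /=.
have pl := perm_to_rem el.
case: (eqVneq a w) => [aw _|_]; last case: (eqVneq b w) => // bw _.
  by subst a; exists b, s, (rem (w, b, s) l); exact: red_perm.
subst b; exists a, s, (rem (a, w, s) l).
exact: red_trans (red_perm _ pl) (red_flip _ _ _ _ _).
Qed.

Definition unglue w (p : (V * bool) * (V * bool)) : seq (ed V) :=
  [:: (p.1.1, w, p.1.2); (w, p.2.1, p.2.2)].
Definition glue (p : (V * bool) * (V * bool)) : ed V :=
  (p.1.1, p.2.1, p.1.2 (+) p.2.2).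
Definition unglues w ps := flatten (map (unglue w) ps).

Lemma red_glues S w ps r : w \in S -> red S (unglues w ps ++ r) (map glue ps ++ r).
Proof.
move=> wS; elim: ps => [|[[a s] [b t]] ps IH]; first exact: red_refl.
apply: red_trans (red_splice _ _ _ _ _ wS) _; exact: red_cons.
Qed.

Section Step.
Variables (k : nat) (T : {set V}) (w a : V) (s : bool) (qs l1 : seq (ed V)).
Let L := qs ++ (a, w, s) :: l1.
Hypotheses (ko : ~~ odd k) (wT : w \notin T) (eL : ev L) (cL : conn k T L).
Hypothesis lw : all (fun e => hits w e <= 1) l1.
Hypothesis qw : all (fun e => hits w e == 0) qs.
Hypothesis aw : a != w.

Let sep X := [exists x in T, exists y in T, (x \in X) && (y \notin X)].
Let tight X := [&& a \in X, w \notin X, sep X & cut X L <= k].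

Lemma sepP X : reflect (exists x y, [/\ x \in T, y \in T, x \in X & y \notin X]) (sep X).
Proof.
apply: (iffP existsP) => [[x /andP[xT /existsP[y /and3P[yT xX yX]]]]|[x [y [xT yT xX yX]]]].
  by exists x, y.
exists x; rewrite xT; apply/existsP; exists y; by rewrite yT xX.
Qed.

Lemma sep_cut X : sep X -> k <= cut X L.
Proof. by move/sepP=> [x [y [xT yT xX yX]]]; exact: cL xX yX. Qed.

Lemma tightU X Y : tight X -> tight Y -> tight (X :|: Y).
Proof.
move=> /and4P[aX wX sX cX] /and4P[aY wY sY cY].
have aL : has (fun e => (e.1.1 == a) && (e.1.2 == w)) L.
  by apply/hasP; exists (a, w, s); rewrite ?mem_cat ?inE ?eqxx ?orbT.
have DD := cutDD aL aX aY wX wY.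
have UI := cutUI X Y L.
have [x [x' [xT xT' xX xX']]] := sepP _ sX.
have [y [y' [yT yT' yY yY']]] := sepP _ sY.
have noD : ~ (sep (X :\: Y) /\ sep (Y :\: X)).
  case=> /sep_cut c1 /sep_cut c2.
  have F i j c d : k <= i -> k <= j -> c <= k -> d <= k -> i + j + 2 <= c + d -> False by clear; lia.
  exact: F c1 c2 cX cY DD.
have [/existsP[z /and3P[zT zX zY]]|nI] := boolP [exists z in T, (z \in X) && (z \in Y)]; last first.
  case: noD; split; apply/sepP.
  - exists x, y; rewrite !inE xX yY; split=> //; rewrite andbT; apply/negP => xY.
    by case/existsP: nI; exists x; rewrite xT xX xY.
  - exists y, x; rewrite !inE xX yY; split=> //; rewrite andbT; apply/negP => yX.
    by case/existsP: nI; exists y; rewrite yT yX yY.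
have [/existsP[u /and3P[uT uX uY]]|nU] := boolP [exists z in T, (z \notin X) && (z \notin Y)]; last first.
  have H u : u \in T -> u \notin X -> u \in Y.
    move=> uT uX; apply/negPn/negP => uY.
    by case/existsP: nU; exists u; rewrite uT uX.
  have H' u : u \in T -> u \notin Y -> u \in X.
    by move=> uT; apply: contraNT => /(H _ uT).
  case: noD; split; apply/sepP.
  - by exists y', x'; rewrite !inE (negPf yY') (H' _ yT' yY') (H _ xT' xX').
  - by exists x', y'; rewrite !inE (negPf xX') (H' _ yT' yY') (H _ xT' xX').
have sU : sep (X :|: Y).
  by apply/sepP; exists z, u; rewrite !inE zX (negPf uX).
have sI : sep (X :&: Y).
  by apply/sepP; exists z, u; rewrite !inE zX zY (negPf uX).
rewrite /tight sU !inE aX (negPf wX) (negPf wY) /=.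
have F i j c d : i + j <= c + d -> k <= j -> c <= k -> d <= k -> i <= k by clear; lia.
exact: F UI (sep_cut sI) cX cY.
Qed.

Lemma exists_partner : exists b t l2,
  red set0 l1 ((w, b, t) :: l2) /\ forall X, tight X -> b \notin X.
Proof.
have dw : 0 < deg w l1.
  have := eL w; rewrite deg_cat.
  have -> : deg w qs = 0.
    rewrite /deg big_seq big1 // => e /(allP qw) /eqP; exact.
  rewrite add0n /deg big_cons /hits /= (negPf aw) eqxx -/(deg w l1).
  by case: (deg w l1).
have [X0 tX0|noT] := pickP tight; last first.
  have [b [t [l2 H]]] := exists_hit dw.
  by exists b, t, l2; split=> // X tX; rewrite noT in tX.
have [Z tZ maxZ] := arg_maxnP (fun X : {set V} => #|X|) tX0.
have subZ X : tight X -> X \subset Z.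
  move=> tX; have /eqP -> : Z == X :|: Z; last exact: subsetUl.
  rewrite eqEcard subsetUr; exact: maxZ (tightU tX tZ).
have [/hasP[[[u v] t] el /orP[]]|noh] := boolP (has (fun e => ((e.1.1 == w) && (e.1.2 \notin Z))
   || ((e.1.2 == w) && (e.1.1 \notin Z))) l1).
- move=> /= /andP[/eqP uw vZ]; subst u; exists v, t, (rem (w, v, t) l1).
  split=> [|X tX]; first by apply: red_perm; exact: perm_to_rem.
  by apply: contra vZ => vX; exact: subsetP (subZ _ tX) _ vX.
- move=> /= /andP[/eqP vw uZ]; subst v; exists u, t, (rem (u, w, t) l1).
  split=> [|X tX].
    apply: red_trans (red_flip _ _ _ _ _); apply: red_perm; exact: perm_to_rem.
  by apply: contra uZ => uX; exact: subsetP (subZ _ tX) _ uX.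
exfalso.
have /and4P[aZ wZ sZ cZ] := tZ.
have sU : sep (w |: Z).
  have [x [y [xT yT xZ yZ]]] := sepP _ sZ.
  apply/sepP; exists x, y; rewrite !inE xZ orbT (negPf yZ) orbF; split=> //.
  by apply: contraNneq wT => <-.
have cU := sep_cut sU.
have dL : 0 < deg w L.
  apply: leq_trans dw _; rewrite deg_cat {3}/deg big_cons -/(deg w l1) addnA.
  exact: leq_addl.
suff cw : cut (w |: Z) L + deg w L <= cut Z L.
  have F i j d : k <= i -> j <= k -> 0 < d -> i + d <= j -> False by clear; lia.
  exact: F cU cZ dL cw.
have He e : hits w e <= 1 -> ~~ ((e.1.1 == w) && (e.1.2 \notin Z) || (e.1.2 == w) && (e.1.1 \notin Z)) ->
  cross (w |: Z) e + hits w e <= cross Z e.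
  rewrite /hits /cross !inE.
  case: (eqVneq e.1.1 w) => [->|_]; case: (eqVneq e.1.2 w) => [->|_];
    rewrite ?(negPf wZ) ?eqxx //=; by case: (e.1.1 \in Z); case: (e.1.2 \in Z).
have Hs m : (forall e, e \in m -> cross (w |: Z) e + hits w e <= cross Z e) ->
  cut (w |: Z) m + deg w m <= cut Z m.
  elim: m => [|e m IH] H; first by rewrite /deg big_nil.
  have {}IH : cut (w |: Z) m + deg w m <= cut Z m.
    by apply: IH => e' me'; apply: H; rewrite inE me' orbT.
  have := H e (mem_head _ _); rewrite /cut /deg big_cons /= -/(deg w m) -!/(cut _ _).
  by rewrite addnACA => h; exact: leq_add.
apply: Hs => e; rewrite mem_cat inE => /orP[eq|/orP[/eqP->|el]].
- have /eqP hw := allP qw e eq; apply: He; first by rewrite hw.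
  by move: hw; rewrite /hits; do 2!case: (_ == w).
- by rewrite /cross /hits /= !inE eqxx aZ (negPf wZ) (negPf aw) orbT.
- apply: He; first exact: (allP lw).
  by apply: contraNN noh => h; apply/hasP; exists e.
Qed.

Lemma exists_splice : exists b t l2,
  red set0 l1 ((w, b, t) :: l2) /\ conn k T (qs ++ (a, b, s (+) t) :: l2).
Proof.
have [b [t [l2 [red2 nb]]]] := exists_partner.
exists b, t, l2; split=> // X x y xT yT xX yX.
have cE := red0_cut X red2.
have cX := cL xT yT xX yX.
have oX := even_cut X eL.
have sX : sep X by apply/sepP; exists x, y.
have sC : sep (~: X) by apply/sepP; exists y, x; rewrite !inE negbK.
have big Y : cut Y L = cut X L -> a \in Y -> w \notin Y -> b \in Y -> sep Y -> k.+2 <= cut X L.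
  move=> cY aY wY bY sY; have kY : k < cut X L.
    rewrite ltnNge; apply/negP => kX; have tY : tight Y by rewrite /tight aY wY sY cY kX.
    by have := nb Y tY; rewrite bY.
  rewrite ltn_neqAle kY andbT; apply: contraNneq oX => <-.
  by rewrite /= ko.
have := big (~: X) (cutC _ _); have := big X erefl; rewrite !inE sX sC negbK.
have cLE : cut X L = cut X qs + (cross X (a, w, s) + (cross X (w, b, t) + cut X l2)).
  by rewrite cut_cat {2}/cut /= -/(cut X l1) -cE.
rewrite cut_cat {3}/cut /= -/(cut X l2); move: cX; rewrite cLE /cross /=.
have F i j : k.+2 <= i + (1 + (1 + j)) -> k <= i + (0 + j) by clear; lia.
case: (a \in X); case: (w \in X); case: (b \in X) => //=.
- by move=> _ /(_ isT isT isT isT) /F.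
- by move=> _ _ /(_ isT isT isT isT) /F.
Qed.

End Step.
End Splitting.

Section SplitAll.
Variable V : finType.
Implicit Types (l m r : seq (ed V)) (e : ed V) (X Y S T D : {set V}) (v w : V).

Lemma split_vertex_acc k T w n qs l : ~~ odd k -> w \notin T -> deg w l <= n ->
  ev (qs ++ l) -> conn k T (qs ++ l) ->
  all (fun e => hits w e <= 1) l -> all (fun e => hits w e == 0) qs ->
  exists ps r, [/\ red set0 l (unglues w ps ++ r),
    all (fun p => (p.1.1 != w) && (p.2.1 != w)) ps,
    all (fun e => hits w e == 0) r & conn k T (qs ++ map (@glue V) ps ++ r)].
Proof.
move=> ko wT; elim: n qs l => [|n IH] qs l dl eL cL lw qw; last first.
  have [d0|d0] := posnP (deg w l); first by apply: IH; rewrite ?d0.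
  have [a [s [l1 red1]]] := exists_hit d0.
  have {}red1 : red set0 l ((a, w, s) :: l1) := red_trans red1 (red_flip _ _ _ _ _).
  have := lw; rewrite (red0_all _ red1) /=; last by move=> x y u; rewrite /hits /= addnC.
  rewrite /hits /= eqxx => /andP[aw lw1].
  have {}aw : a != w by case: eqP aw.
  have red1q := red_catl qs red1.
  have [b [t [l2 [red2 c2]]]] := exists_splice ko wT (red_ev red1q eL)
    (red0_conn red1q cL) lw1 qw aw.
  have := lw1; rewrite (red0_all _ red2) /=; last by move=> x y u; rewrite /= addnC.
  rewrite eqxx => /andP[bw lw2].
  have {}bw : b != w by case: eqP bw.
  have red12 : red set0 l ((a, w, s) :: (w, b, t) :: l2).
    exact: red_trans red1 (red_cons _ red2).
  have p12 : perm_eq (qs ++ (a, b, s (+) t) :: l2) (((a, b, s (+) t) :: qs) ++ l2).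
    by rewrite -cat1s perm_catCA.
  have e2 : ev (qs ++ (a, b, s (+) t) :: l2).
    apply: red_ev eL; apply: red_catl (red_trans (red0_sub [set w] red12) _).
    by apply: red_splice; rewrite inE.
  have [|||||ps [r [red3 pw rw c3]]] := IH ((a, b, s (+) t) :: qs) l2.
  - have := red0_deg w red12; rewrite {1}/deg !big_cons /hits /= (negPf aw) (negPf bw) eqxx.
    by rewrite -/(deg w l2) !add0n add1n addn0 => dE; move: dl; rewrite -dE => /ltnW.
  - exact: perm_ev p12 _.
  - exact: conn_perm p12 _.
  - exact: lw2.
  - by rewrite /= qw /hits /= (negPf aw) (negPf bw).
  exists ((a, s, (b, t)) :: ps), r; split=> //=.
  - apply: red_trans red12 _; do 2!apply: red_cons; exact: red3.
  - by rewrite aw bw.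
  - apply: conn_perm c3; rewrite -[X in perm_eq _ (_ ++ X)]cat1s perm_sym perm_catCA.
    by [].
exists [::], l; split=> //; first exact: red_refl.
apply/allP => e el; rewrite -leqn0; apply: leq_trans dl.
by rewrite /deg (big_rem e) //= leq_addr.
Qed.

Lemma split_vertex k T w l : ~~ odd k -> w \notin T -> ev l -> conn k T l ->
  all (fun e => hits w e <= 1) l ->
  exists ps r, [/\ red set0 l (unglues w ps ++ r),
    all (fun p => (p.1.1 != w) && (p.2.1 != w)) ps,
    all (fun e => hits w e == 0) r & conn k T (map (@glue V) ps ++ r)].
Proof.
move=> ko wT el cl lw.
by have := @split_vertex_acc k T w _ [::] l ko wT (leqnn _) el cl lw isT.
Qed.

Definition loop w e : bool := (e.1.1 == w) && (e.1.2 == w).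

Lemma red_absorb S w s b t l : w \in S ->
  red S ((w, w, s) :: (w, b, t) :: l) ((w, b, s (+) t) :: l).
Proof. exact: red_splice. Qed.

Lemma absorb_loops S w b t m l : w \in S -> all (loop w) m ->
  red S (m ++ (w, b, t) :: l) ((w, b, par m (+) t) :: l).
Proof.
move=> wS; elim: m t => [|[[x y] s] m IH] t /=; first by move=> _; exact: red_refl.
rewrite /loop /= => /andP[/andP[/eqP-> /eqP->] mw].
apply: red_trans (red_cons _ (IH t mw)) _.
apply: red_trans (red_absorb _ _ _ _ wS) _.
by rewrite /par /= oddD oddb addbA; exact: red_refl.
Qed.

Lemma perm_filterC (p : pred (ed V)) l : perm_eq l (filter p l ++ filter (predC p) l).
Proof. by rewrite perm_sym perm_filterC. Qed.

Lemma cut_loops X w m : all (loop w) m -> cut X m = 0.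
Proof.
move=> /allP mw; apply/eqP; rewrite -leqn0 leqNgt -has_count; apply/hasPn => e /mw.
by rewrite /loop /cross => /andP[/eqP-> /eqP->]; rewrite addbb.
Qed.

(* The loops at [w] are absorbed by another edge at [w]. *)
Lemma remove_loops S w l : w \in S -> 0 < cut [set w] l ->
  exists m, [/\ red S l m, all (fun e => ~~ loop w e) m & forall X, cut X m = cut X l].
Proof.
move=> wS c0; pose lo := filter (loop w) l; pose r := filter (predC (loop w)) l.
have pl : perm_eq l (lo ++ r) := perm_filterC _ _.
have low : all (loop w) lo by exact: filter_all.
have cr X : cut X r = cut X l by rewrite (perm_cut X pl) cut_cat (cut_loops X low).
have := c0; rewrite -cr => /exists_cross[a [b [s [m [rm]]]]].
rewrite !inE => /eqP aw bw _; subst a.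
exists ((w, b, par lo (+) s) :: m); split.
- apply: red_trans (red_perm _ pl) _.
  apply: red_trans (red_catl _ (red0_sub _ rm)) _.
  exact: absorb_loops.
- have : all (fun e => ~~ loop w e) r by exact: filter_all.
  rewrite (red0_all _ rm) //= => x y t; by rewrite /loop /= andbC.
- by move=> X; rewrite -cr -(red0_cut X rm).
Qed.

Lemma drop_even_loops S w l : w \in S -> 0 < cut [set w] l ->
  all (fun e => loop w e ==> ~~ e.2) l -> red S l (filter (predC (loop w)) l).
Proof.
move=> wS c0 le; have pl := perm_filterC (loop w) l; move: pl c0.
set lo := filter (loop w) l; set r := filter _ l => pl.
have low : all (loop w) lo by exact: filter_all.
have plo : par lo = false.
  rewrite /par (@eq_in_count _ _ pred0) ?count_pred0 // => e.
  by rewrite mem_filter => /andP[ie /(allP le)]; rewrite ie => /negPf.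
rewrite (perm_cut _ pl) cut_cat (cut_loops _ low) add0n => /exists_cross[a [b [s [m [rm aw _ _]]]]].
move: aw; rewrite inE => /eqP aw; subst a.
apply: red_trans (red_perm _ pl) _; apply: red_trans (red_catl _ (red0_sub _ rm)) _.
apply: red_trans (absorb_loops _ _ _ wS low) _; rewrite plo.
exact: red0_sub (red0_sym rm).
Qed.

Lemma glues_supp D w ps r : supp D (map (@glue V) ps ++ r) ->
  all (fun p => (p.1.1 != w) && (p.2.1 != w)) ps -> all (fun e => hits w e == 0) r ->
  supp (D :\ w) (map (@glue V) ps ++ r).
Proof.
rewrite /supp !all_cat => /andP[s1 s2] pw rw; apply/andP; split; last first.
  apply/allP => e er; have := allP s2 e er; have := allP rw e er.
  rewrite /inside /hits !inE; do 2!case: (_ == w) => //=.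
rewrite all_map; apply/allP => p pp.
have := allP s1 (glue p); rewrite map_f // => /(_ isT).
rewrite /inside /= !inE => /andP[-> ->].
by have /andP[-> ->] := allP pw p pp.
Qed.

Lemma split_one k D w l : ~~ odd k -> 1 < k -> supp D l -> ev l -> conn k D l -> w \in D ->
  D :\ w != set0 ->
  exists m, [/\ red [set w] l m, supp (D :\ w) m & conn k (D :\ w) m].
Proof.
move=> ko k1 sl el cl wD /set0Pn[y]; rewrite !inE => /andP[yw yD].
have c0 : 0 < cut [set w] l.
  apply: leq_trans (cl [set w] w y _ _ _ _); rewrite ?inE ?eqxx //; exact: ltnW.
have wS : w \in [set w] by rewrite inE.
have [l0 [red0 l0w c0E]] := remove_loops wS c0.
have wT : w \notin D :\ w by rewrite !inE eqxx.
have cl0 : conn k (D :\ w) l0.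
  apply: conn_le (conn_sub (subsetDl _ _) cl) => // X; by rewrite c0E.
have lw : all (fun e => hits w e <= 1) l0.
  apply: sub_all l0w => e; rewrite /loop /hits; by do 2!case: (_ == w).
have [ps [r [red1 pw rw c1]]] := split_vertex ko wT (red_ev red0 el) cl0 lw.
have red2 : red [set w] l (map (@glue V) ps ++ r).
  apply: red_trans red0 _; apply: red_trans (red0_sub _ red1) _; exact: red_glues.
exists (map (@glue V) ps ++ r); split=> //.
by apply: glues_supp pw rw; exact: red_supp red2 sl.
Qed.

Lemma split_all k D T l : ~~ odd k -> 1 < k -> supp D l -> ev l -> conn k D l ->
  T \subset D -> T != set0 ->
  exists m, [/\ red (D :\: T) l m, supp T m & conn k T m].
Proof.
move=> ko k1; move: {2}#|D :\: T| (leqnn #|D :\: T|) => n.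
elim: n D l => [|n IH] D l; rewrite ?leqn0 ?cards_eq0 => dn sl el cl TD T0.
  exists l; split; first exact: red_refl.
  - by apply: supp_sub sl; rewrite -setD_eq0.
  - exact: conn_sub cl.
have [D0|/set0Pn[w]] := eqVneq (D :\: T) set0.
  by apply: IH; rewrite ?D0 ?cards0.
rewrite inE => /andP[wT wD].
have TD' : T \subset D :\ w.
  by apply/subsetP => x xT; rewrite !inE (subsetP TD) // andbT; apply: contraNneq wT => <-.
have D'0 : D :\ w != set0.
  by apply: contraNneq T0 => D0; rewrite -subset0 -D0.
have [m [red1 s1 c1]] := split_one ko k1 sl el cl wD D'0.
have [|m' [red2 s2 c2]] := IH _ m _ s1 (red_ev red1 el) c1 TD' T0.
  have : (D :\ w) :\: T \proper D :\: T.
    apply/properP; split; first by apply: setSD; exact: subsetDl.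
    by exists w; rewrite !inE ?wT ?wD ?eqxx ?andbF.
  by move/proper_card => h; rewrite -ltnS; exact: leq_trans dn.
exists m'; split=> //.
apply: red_trans (red_sub _ red1) _; first by rewrite sub1set inE wT.
apply: red_sub red2; apply: setSD; exact: subsetDl.
Qed.

End SplitAll.

(** * Contracting one side of a cut *)
Section Lift.
Variables (V1 V2 : finType) (f : V1 -> V2).

Definition remap (e : ed V1) : ed V2 := (f e.1.1, f e.1.2, e.2).

Lemma perm_map_lift (T1 T2 : eqType) (h : T1 -> T2) (s : seq T1) (t : seq T2) :
  perm_eq (map h s) t -> exists2 s', perm_eq s s' & t = map h s'.
Proof.
case: s => [|x0 s]; first by rewrite perm_sym => /perm_nilP->; exists [::].
rewrite perm_sym; move=> /(perm_iotaP (h x0))[Is pI ->].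
exists (map (nth x0 (x0 :: s)) Is).
  by rewrite perm_sym; apply/(perm_iotaP x0); exists Is; rewrite // -(size_map h).
rewrite -map_comp; apply/eq_in_map => i /=.
rewrite (perm_mem pI) mem_iota /= add0n size_map => si.
by rewrite -/(map h (x0 :: s)) (nth_map x0).
Qed.

Lemma red_lift (S : {set V2}) l m' :
  (forall v v', f v \in S -> f v = f v' -> v = v') -> red S (map remap l) m' ->
  exists2 m, red (f @^-1: S) l m & m' = map remap m.
Proof.
move=> fS; move Dl: (map remap l) => L rL; elim: rL l Dl => {L m'}.
- move=> L m' p l Dl; move: p; rewrite -Dl => /perm_map_lift[m lm ->].
  by exists m => //; exact: red_perm.
- move=> x y s L [//|[[x' y'] s'] l] [<- <- <- <-].
  by exists ((y', x', s') :: l) => //; exact: red_flip.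
- move=> a w b s t L wS [//|[[a' w1] s'] [//|[[w2 b'] t'] l]] [<- w1w <- w2w <- <- <-].
  have {w2w}-> : w2 = w1 by apply/esym/fS; rewrite w1w ?w2w.
  exists ((a', b', s' (+) t') :: l) => //.
  by apply: red_splice; rewrite inE w1w.
- move=> L m' r' _ IH1 _ IH2 l /IH1[m lm] /esym/IH2[r mr ->].
  by exists r => //; exact: red_trans lm mr.
Qed.

Lemma cut_remap (Y : {set V2}) l : cut Y (map remap l) = cut (f @^-1: Y) l.
Proof. by rewrite /cut count_map; apply: eq_count => e; rewrite /cross /= !inE. Qed.

Lemma deg_remap w l : deg w (map remap l) = \sum_(v | f v == w) deg v l.
Proof.
rewrite /deg exchange_big big_map; apply: eq_bigr => e _.
rewrite /hits /= big_split /=.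
have H u : (f u == w : nat) = \sum_(v | f v == w) (u == v).
  have [uw|uw] := boolP (f u == w).
    by rewrite (bigD1 u) //= eqxx big1 // => v /andP[_ /negPf]; rewrite eq_sym => ->.
  by rewrite big1 // => v vw; case: eqP => // uv; rewrite uv vw in uw.
by rewrite !H.
Qed.

End Lift.

Section Contract.
Variable V : finType.
Implicit Types (l m r A : seq (ed V)) (e : ed V) (X Y U S T D : {set V}) (v w x o : V).

Definition touch X e : bool := (e.1.1 \in X) || (e.1.2 \in X).
Definition collapse x X v : V := if v \in X then x else v.
Definition contract x X l : seq (ed V) :=
  map (remap (collapse x X)) (filter (predC (inside X)) l).
Definition inner_even X l := all (fun e => inside X e ==> ~~ e.2) l.

Lemma contract_cat x X l m : contract x X (l ++ m) = contract x X l ++ contract x X m.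
Proof. by rewrite /contract filter_cat map_cat. Qed.

Lemma red0_map_contract x X l m : perm_eq l m -> perm_eq (contract x X l) (contract x X m).
Proof. by move=> p; apply: perm_map; exact: perm_filter. Qed.

Lemma red_contract S X x l m : S \subset X -> red S l m -> cut X m = cut X l ->
  inner_even X l -> all (touch X) l ->
  [/\ inner_even X m, all (touch X) m & red set0 (contract x X l) (contract x X m)].
Proof.
move=> /subsetP SX; elim=> {l m} [l m p|a b s l|a w b s t l wS|m l k r1 IH1 r2 IH2].
- move=> _; rewrite /inner_even !(perm_all _ p) => il tl; split=> //.
  by apply: red_perm; exact: red0_map_contract.
- move=> _; rewrite /inner_even /= /touch /inside /= => /andP[il il'] /andP[tl tl'].
  split; rewrite ?il' ?tl' ?andbT //; rewrite 1?andbC 1?orbC //.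
  rewrite /contract /= /inside /= [(b \in X) && _]andbC.
  case: (_ && _) => /=; first exact: red_refl.
  exact: red_flip.
- have wX := SX _ wS.
  rewrite /inner_even /= /touch /inside /= wX orbT /= andbT.
  rewrite /cut /= /cross /= wX /contract /= /inside /= wX andbT /=.
  have [aX|aX] := boolP (a \in X); have [bX|bX] := boolP (b \in X) => /=.
  + by move=> _ /and3P[/negPf-> /negPf-> ->] ->; split=> //; exact: red_refl.
  + move=> _ /andP[/negPf-> ->] ->; split=> //.
    by rewrite /remap /collapse /= aX wX; exact: red_refl.
  + move=> _ /andP[/negPf-> ->] ->; split=> //.
    by rewrite /remap /collapse /= bX wX addbF; exact: red_refl.
  + by clear; set c := count _ _ => h; exfalso; move: h; clear; lia.
- move=> ck il tl.
  have c1 := red_cut X r1; have c2 := red_cut X r2.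
  have cl : cut X m = cut X l by apply/eqP; rewrite eqn_leq c1 -ck c2.
  have [//|//|il1 tl1 k1] := IH1 cl.
  have [//|//|il2 tl2 k2] := IH2 (etrans ck (esym cl)).
  by split=> //; exact: red_trans k1 k2.
Qed.

Lemma split_inside A X T o k : ~~ odd k -> 1 < k -> o \notin X -> T \subset X ->
  all (touch X) A -> (forall v, v \in X -> ~~ odd (deg v A)) -> ~~ odd (cut X A) ->
  (forall U, U \subset X -> U != set0 -> k <= cut U A) ->
  exists Q, [/\ red X A Q, (forall x, x \in T -> k <= cut X Q) &
    forall e, e \in Q -> (e.1.1 \in X -> e.1.1 \in T) /\ (e.1.2 \in X -> e.1.2 \in T)].
Proof.
move=> ko k1 oX /subsetP TX tA evA cX cU.
pose f v := if v \in X then v else o.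
pose B := map (remap f) A; pose D := o |: X.
have fD v : f v \in D by rewrite /f !inE; case: ifP => [->|]; rewrite ?orbT ?eqxx.
have sB : supp D B by rewrite /supp all_map; apply/allP => e _; rewrite /inside /= !fD.
have pre Y : o \notin Y -> f @^-1: Y = Y :&: X.
  move=> oY; apply/setP => v; rewrite !inE /f; case: (v \in X); rewrite ?andbT ?andbF //.
  exact: negPf.
have eB : ev B.
  move=> w; have [->|wo] := eqVneq w o.
    have -> : deg o B = cut X A by
      rewrite /deg /cut big_map -sum1_count [RHS]big_mkcond /=;
      rewrite big_seq [RHS]big_seq; apply: eq_bigr => e eA;
      have := allP tA e eA; rewrite /touch /hits /cross /= /f;
      have H u : u \in X -> (u == o) = false by [move=> uX; apply: contraNF oX => /eqP<-];
      have [e1|e1] := boolP (e.1.1 \in X); have [e2|e2] := boolP (e.1.2 \in X) => //=;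
      rewrite ?eqxx ?(H _ e1) ?(H _ e2).
    exact: cX.
  rewrite deg_remap; have [wX|wX] := boolP (w \in X).
    rewrite (big_pred1 w) ?evA // => v /=; rewrite /f; case: ifP => // vX.
    rewrite eq_sym (negPf wo); apply/esym; apply: contraFF vX => /eqP->; exact: wX.
  rewrite big_pred0 // => v /=; rewrite /f; case: ifP => vX.
    by apply: contraNF wX => /eqP<-.
  by rewrite eq_sym (negPf wo).
have cB : conn k D B.
  suff H Y a b : a \in D -> b \in D -> a \in Y -> b \notin Y -> o \notin Y -> k <= cut Y B.
    move=> Y a b aD bD aY bY; have [oY|oY] := boolP (o \in Y); last exact: (H Y a b).
    by rewrite -cutC; apply: (H _ b a); rewrite // !inE ?negbK.
  move=> aD bD aY bY oY; rewrite cut_remap pre //; apply: cU; first exact: subsetIr.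
  apply/set0Pn; exists a; rewrite inE aY; move: aD; rewrite !inE => /orP[/eqP ao|//].
  by rewrite ao (negPf oY) in aY.
have TD : o |: T \subset D by apply: setUS; exact/subsetP.
have T0 : o |: T != set0 by apply/set0Pn; exists o; rewrite !inE eqxx.
have [P1 [rP sP cP]] := split_all ko k1 sB eB cB TD T0.
have SX : f @^-1: (D :\: (o |: T)) \subset X.
  apply/subsetP => v; rewrite !inE negb_or /f; case: ifP => //.
  by rewrite eqxx.
have fS v v' : f v \in D :\: (o |: T) -> f v = f v' -> v = v'.
  rewrite !inE negb_or /f; case: ifP => vX; last by rewrite eqxx.
  by case: ifP => // v'X /andP[/andP[vo _] _] vE; rewrite vE eqxx in vo.
have [Q rQ PQ] := red_lift fS rP.
exists Q; split; first exact: red_sub SX rQ.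
  move=> x xT; have preX : f @^-1: X = X by rewrite pre // setIid.
  rewrite -preX -cut_remap -PQ.
  by apply: (cP X x o); rewrite ?inE ?eqxx ?xT ?orbT // TX.
move=> e eQ; have := allP sP (remap f e); rewrite PQ map_f // => /(_ isT).
have H u : u \in X -> f u \in o |: T -> u \in T.
  by rewrite /f => uX; rewrite uX !inE => /orP[/eqP uo|//]; rewrite -uo uX in oX.
by case/andP=> /= h1 h2; split=> /H; exact.
Qed.

Lemma contract_red A X x o k : ~~ odd k -> 1 < k -> x \in X -> o \notin X ->
  all (touch X) A -> inner_even X A -> (forall v, v \in X -> ~~ odd (deg v A)) ->
  cut X A = k -> (forall U, U \subset X -> U != set0 -> k <= cut U A) ->
  red X A (contract x X A).
Proof.
move=> ko k1 xX oX tA iA evA cX cU.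
have xX1 : [set x] \subset X by rewrite sub1set.
have oc : ~~ odd (cut X A) by rewrite cX.
have [Q [rQ kQ Qx']] := split_inside ko k1 oX xX1 tA evA oc cU.
have cQ : cut X Q = cut X A.
  by apply/eqP; rewrite eqn_leq (red_cut X rQ) cX (kQ x) // inE.
have [iQ tQ eQ] := red_contract x (subxx X) rQ cQ iA tA.
have Qx e : e \in Q -> (e.1.1 \in X -> e.1.1 = x) /\ (e.1.2 \in X -> e.1.2 = x).
  by move=> /Qx'; rewrite !inE => -[h1 h2]; split=> h; apply/eqP; [exact: h1|exact: h2].
have cE : contract x X Q = filter (predC (inside X)) Q.
  rewrite /contract -[RHS]map_id; apply/eq_in_map => -[[u v] s]; rewrite mem_filter.
  case/andP=> _ /Qx[/= h1 h2]; rewrite /remap /collapse /=.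
  by case: ifP => [/h1->|_]; case: ifP => [/h2->|_].
apply: red_trans rQ _.
apply: red_trans _ (red0_sub _ (red0_sym eQ)); rewrite cE.
have -> : filter (predC (inside X)) Q = filter (predC (loop x)) Q.
  apply: eq_in_filter => e /Qx[h1 h2] /=; rewrite /inside /loop; congr (~~ _).
  apply/andP/andP => -[]; first by move=> /h1-> /h2->.
  by move=> /eqP-> /eqP->.
have Xx Y : (x \in Y) = (x \in Y :&: X) by rewrite inE xX andbT.
apply: drop_even_loops => //.
  have -> : cut [set x] Q = cut X Q; last by rewrite cQ cX; exact: ltnW.
  apply: eq_in_count => e /Qx[h1 h2]; rewrite /cross !inE.
  by congr (_ (+) _); apply/eqP/idP => [->//|]; [exact: h1|exact: h2].
apply/allP => e eQ'; apply/implyP => /andP[/eqP e1 /eqP e2].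
by have := allP iQ e eQ'; rewrite /inside e1 e2 xX.
Qed.

End Contract.

Section Switch.
Variables (V : finType) (c : V -> bool).
Implicit Types (l m : seq (ed V)) (e : ed V).

Definition switch e : ed V := (e.1.1, e.1.2, tint c e).

Lemma red_switch (S : {set V}) l m : red S l m -> red S (map switch l) (map switch m).
Proof.
elim=> {l m} [l m p|a b s l|a w b s t l wS|m l k _ IH1 _ IH2] /=.
- by apply: red_perm; exact: perm_map.
- by rewrite /switch /tint /= [in X in red _ _ X]addbAC; exact: red_flip.
- rewrite [in X in red _ _ X]/switch /tint /=.
  have -> : s (+) t (+) c a (+) c b = (s (+) c a (+) c w) (+) (t (+) c w (+) c b).
    by case: s; case: t; case: (c a); case: (c b); case: (c w).
  exact: red_splice.
- exact: red_trans IH1 IH2.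
Qed.

Lemma switchK : involutive switch.
Proof. by case=> [[x y] s]; rewrite /switch /tint /=; case: (c x); case: (c y); case: s. Qed.

Lemma triple_switch l : triple (map switch l) -> triple l.
Proof.
case=> [x [m [/red_switch rm sm cm]]]; exists x, (map switch m); split.
- by move: rm; rewrite (mapK switchK).
- by rewrite /supp all_map; exact: sm.
- rewrite count_map; apply: leq_trans cm _; rewrite leq_eqVlt; apply/orP; left; apply/eqP.
  apply: eq_in_count => e /(allP sm); rewrite /inside !inE => /andP[/eqP e1 /eqP e2].
  by rewrite /= /tint e1 e2 -addbA addbb addbF.
Qed.

Lemma cut_switch (X : {set V}) l : cut X (map switch l) = cut X l.
Proof. by rewrite /cut count_map. Qed.

Lemma deg_switch v l : deg v (map switch l) = deg v l.
Proof. by rewrite /deg big_map. Qed.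

Lemma supp_switch (X : {set V}) l : supp X (map switch l) = supp X l.
Proof. by rewrite /supp all_map. Qed.
End Switch.

Section Glue.
Variables (V : finType) (z : V).
Implicit Types (l m r : seq (ed V)) (e : ed V).

Definition at_ e : bool := (e.1.1 == z) || (e.1.2 == z).
Definition other e : V := if e.1.1 == z then e.1.2 else e.1.1.

(* Junk unless exactly two edges are at [z]. *)
Definition suppress l : seq (ed V) :=
  if filter at_ l is [:: e1; e2] then (other e1, other e2, e1.2 (+) e2.2) :: filter (predC at_) l
  else [::].

Lemma red_count_at (S : {set V}) l m : z \notin S -> red S l m -> count at_ m <= count at_ l.
Proof.
move=> zS; elim=> {l m} [l m p|a b s l|a w b s t l wS|m l k _ IH1 _ IH2].
- by rewrite (permP p).
- by rewrite /= /at_ /= orbC.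
- have wz : (w == z) = false by apply: contraNF zS => /eqP<-.
  by rewrite /= /at_ /= wz orbF addnA leq_add2r; case: (a == z); case: (b == z).
- exact: leq_trans IH2 IH1.
Qed.

Lemma red_suppress (S : {set V}) l m : z \notin S -> red S l m ->
  count at_ l = 2 -> count at_ m = 2 -> red S (suppress l) (suppress m).
Proof.
move=> zS; elim=> {l m} [l m p|a b s l|a w b s t l wS|m l k r1 IH1 r2 IH2].
- move=> cl cm; rewrite /suppress.
  have := perm_filter at_ p; have pC := perm_filter (predC at_) p.
  case El: (filter at_ l) => [|e1 [|e2 [|? ?]]]; move: cl; rewrite -size_filter El //= => _.
  case Em: (filter at_ m) => [|f1 [|f2 [|? ?]]]; move: cm; rewrite -size_filter Em //= => _ p2.
  have : f1 \in [:: e1; e2] by rewrite (perm_mem p2) mem_head.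
  rewrite !inE => /orP[/eqP ef|/eqP ef]; subst f1.
    move: p2; rewrite perm_cons => /perm_small_eq -/(_ isT) [<-].
    by apply: red_perm; rewrite perm_cons.
  have {}p2 : perm_eq [:: e2; e1] [:: e2; f2].
    by apply: perm_trans p2; rewrite -[X in perm_eq X _]/(rcons [:: e2] e1) perm_rcons.
  move: p2; rewrite perm_cons => /perm_small_eq -/(_ isT) [<-]; rewrite addbC.
  apply: red_trans (red_flip _ _ _ _ _) _; apply: red_perm; by rewrite perm_cons.
- rewrite /= /suppress /= /at_ /= [(b == z) || _]orbC => cl cm.
  case: ifP cl cm => [ab|ab] /=; last first.
    rewrite !add0n; case El: (filter _ l) => [|e1 [|e2 [|? ?]]] _ _;
      try exact: red_refl.
    by apply: red_cons; exact: red_flip.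
  rewrite -size_filter; case El: (filter _ l) => [|e1 [|? ?]] //= _ _.
  suff -> : other (a, b, s) = other (b, a, s) by exact: red_refl.
  by rewrite /other /=; case: eqP ab => [->|_]; case: eqP => // -> .
- have wz : (w == z) = false by apply: contraNF zS => /eqP<-.
  rewrite /suppress /= /at_ /= wz orbF /=.
  have [->|az] := eqVneq a z; have [->|bz] := eqVneq b z => //=.
  + by move=> h1 h2; exfalso; move: h1 h2; clear; set c := count _ _; lia.
  + rewrite -size_filter; case El: (filter _ l) => [|e1 [|? ?]] //= _ _.
    rewrite /other /= ?eqxx ?wz.
    apply: red_trans (red_flip _ _ _ _ _) _.
    apply: red_trans (red_splice _ _ _ _ _ wS) _.
    apply: red_trans (red_flip _ _ _ _ _) _.
    by rewrite addbAC; exact: red_refl.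
  + rewrite -size_filter; case El: (filter _ l) => [|e1 [|? ?]] //= _ _.
    rewrite /other /= ?(negPf az) ?wz.
    apply: (@red_trans _ _ ((a, w, s) :: (w, if e1.1.1 == z then e1.1.2 else e1.1.1, t (+) e1.2) :: filter (predC at_) l)).
      by apply: red_perm; apply/permP => q /=; rewrite addnCA.
    by rewrite -addbA; exact: red_splice.
  + case El: (filter _ l) => [|e1 [|e2 [|? ?]]] _ _; try exact: red_refl.
    by apply: red_cons; exact: red_splice.
- move=> cl cm; have c1 := red_count_at zS r1; have c2 := red_count_at zS r2.
  have cE : count at_ m = 2.
    by apply/eqP; rewrite eqn_leq; apply/andP; split; [rewrite -cl|rewrite -cm].
  exact: red_trans (IH1 cl cE) (IH2 cE cm).
Qed.
End Glue.

Section Pinch.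
Variable V : finType.
Implicit Types (l m r A : seq (ed V)) (e : ed V) (X Y U S T D : {set V}) (v w x o : V).

Lemma pinch X x a b A : x \in X -> a \in X -> b \in X ->
  all (touch X) A -> inner_even X A ->
  (forall v, v \in X -> ~~ odd (deg v ((a, b, true) :: A))) -> cut X A = 4 ->
  (forall U, U \proper X -> U != set0 -> 6 <= cut U ((a, b, true) :: A)) ->
  red X ((a, b, true) :: A) ((x, x, true) :: contract x X A).
Proof.
move=> xX aX bX tA iA evA cX cU.
pose A' := map (remap (@Some V)) A; pose X' := Some @: X.
pose P := (Some a, None, true) :: (None, Some b, false) :: A'.
have inX v : (Some v \in X') = (v \in X) by rewrite mem_imset // => ? ? [].
have NX : None \notin X' by apply/negP => /imsetP[].
have pre : Some @^-1: X' = X by apply/setP => v; rewrite inE inX.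
have rP : red X' P (contract (Some x) X' P).
  apply: (@contract_red _ P X' (Some x) None 6); rewrite ?inX //.
  - rewrite /= /touch /= !inX aX bX orbT /= all_map.
    by apply: sub_all tA => e; rewrite /touch /= !inX.
  - rewrite /inner_even /= /inside /= (negPf NX) andbF /= all_map.
    by apply: sub_all iA => e; rewrite /inside /= !inX.
  - move=> [v|]; last by rewrite (negPf NX).
    rewrite inX => /evA; congr (~~ odd _).
    rewrite /deg !big_cons /hits /= -!/(deg _ _) !addn0 /A' deg_remap (big_pred1 v) ?addnA //.
  - rewrite /cut /= -/(cut _ _) /cross /= !inX aX bX (negPf NX) /= cut_remap pre cX.
    by [].
  - move=> U UX U0; pose W := Some @^-1: U.
    have NU : None \notin U by apply: contra NX => /(subsetP UX).
    have WX : W \subset X by apply/subsetP => v; rewrite inE => /(subsetP UX); rewrite inX.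
    have W0 : W != set0.
      case/set0Pn: U0 => -[v|] vU; last by rewrite vU in NU.
      by apply/set0Pn; exists v; rewrite inE.
    have -> : cut U P = (a \in W) + (b \in W) + cut W A.
      by rewrite {1}/cut /= -/(cut U A') /cross /= cut_remap !inE (negPf NU) addbF addnA.
    have [->|WnX] := eqVneq W X; first by rewrite aX bX cX.
    have := cU W; rewrite properEneq WnX WX W0 => /(_ isT isT).
    rewrite /cut /= -/(cut _ _) /cross /=.
    by move=> h; apply: leq_trans h _; rewrite leq_add2r; case: (a \in W); case: (b \in W).
have cE : contract (Some x) X' P =
    (Some x, None, true) :: (None, Some x, false) :: map (remap (@Some V)) (contract x X A).
  rewrite /contract /= /inside /= (negPf NX) andbF /=.
  rewrite /remap /collapse /= !inX aX bX (negPf NX); congr [:: _, _ & _].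
  rewrite -map_comp filter_map -map_comp.
  have -> : [seq i <- A | preim (remap (@Some V)) (predC (inside X')) i] = filter (predC (inside X)) A.
    by apply: eq_filter => e; rewrite /= /inside /= !inX.
  apply: eq_map => e; rewrite /= /remap /=; congr (_, _, _).
    by rewrite inX; case: ifP.
  by rewrite inX; case: ifP.
have fN l : filter (at_ None) (map (remap (@Some V)) l) = [::].
  by elim: l => //= e l ->.
have fC l : filter (predC (at_ None)) (map (remap (@Some V)) l) = map (remap (@Some V)) l.
  by elim: l => //= e l ->.
have cN l : count (at_ None) (map (remap (@Some V)) l) = 0 by rewrite -size_filter fN.
have := red_suppress NX rP; rewrite cE /= !cN => /(_ erefl erefl).
rewrite /suppress /= !fN !fC /= /other /=.
rewrite -[_ :: A']/(map (remap (@Some V)) ((a, b, true) :: A)).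
move=> /red_lift[|m rm]; first by move=> v v' _ [].
rewrite -[_ :: map _ _]/(map (remap (@Some V)) ((x, x, true) :: contract x X A)).
have Sinj : injective (remap (@Some V)) by move=> [[? ?] ?] [[? ?] ?] [-> -> ->].
by move=> /(inj_map Sinj) mE; move: rm; rewrite pre -mE.
Qed.
End Pinch.

(** * Highly edge-connected graphs *)
Section TwoLoops.
Variable V : finType.
Implicit Types (l m r A : seq (ed V)) (e : ed V) (X Y U S T D W : {set V}) (u v w x o : V).

Lemma perm_swap12 (T : eqType) (a b : T) s : perm_eq [:: a, b & s] [:: b, a & s].
Proof. by apply/permP => p /=; rewrite addnCA. Qed.

Lemma red_pairs u v (bs : seq bool) n : size bs = n.*2 ->
  exists2 m, red setT [seq (u, v, b) | b <- bs] m & supp [set u] m.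
Proof.
elim: n bs => [|n IH] [|b1 [|b2 bs]] //=.
  by move=> _; exists [::] => //; exact: red_refl.
move=> [/IH[m rm sm]]; exists ((u, u, b1 (+) b2) :: m); last first.
  by rewrite /= sm /inside /= inE eqxx.
apply: (@red_trans _ _ ((v, u, b2) :: (u, v, b1) :: [seq (u, v, b) | b <- bs])).
  apply: red_trans (red_perm _ (perm_swap12 _ _ _)) _; exact: red_flip.
apply: red_trans (red_perm _ (perm_swap12 _ _ _)) _.
apply: red_trans (red_splice _ _ _ _ _ (in_setT _)) _; exact: red_cons.
Qed.

Lemma red_orient u v l :
  all (fun e => (e.1 == (u, v)) || (e.1 == (v, u))) l ->
  exists bs, red set0 l [seq (u, v, b) | b <- bs].
Proof.
elim: l => [|[[x y] s] l IH] /=; first by exists [::]; exact: red_refl.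
move=> /andP[h /IH[bs rb]]; exists (s :: bs) => /=.
apply: red_trans (red_cons _ rb) _.
case/orP: h => /eqP[-> ->]; first exact: red_refl.
exact: red_flip.
Qed.

Lemma two_loops W l u v : u \in W -> v \in W -> u != v ->
  supp W ((u, u, true) :: (v, v, true) :: l) -> ev ((u, u, true) :: (v, v, true) :: l) ->
  conn 4 W ((u, u, true) :: (v, v, true) :: l) -> par ((u, u, true) :: (v, v, true) :: l) ->
  triple ((u, u, true) :: (v, v, true) :: l).
Proof.
move=> uW vW uv sl el cl pl.
have {}el : ev l.
  move=> x; have := el x; rewrite /deg !big_cons /hits /= !oddD -/(deg x l).
  by rewrite !addbb.
have {}sl : supp W l by move: sl => /and3P[].
have {}cl : conn 4 W l.
  apply: conn_le cl => // X; rewrite /cut /= /cross /= !addbb; exact: leqnn.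
have TW : [set u; v] \subset W by apply/subsetP => x; rewrite !inE => /orP[]/eqP->.
have T0 : [set u; v] != set0 by apply/set0Pn; exists u; rewrite !inE eqxx.
have [m [rm sm cm]] := split_all (isT : ~~ odd 4) isT sl el cl TW T0.
have c4 : 4 <= cut [set u] m.
  by apply: (cm _ u v); rewrite ?inE ?eqxx ?orbT // eq_sym.
have em := red_ev rm el.
pose lu := filter (loop u) m; pose m1 := filter (predC (loop u)) m.
pose lv := filter (loop v) m1; pose m2 := filter (predC (loop v)) m1.
have p1 : perm_eq m (lu ++ lv ++ m2).
  apply: perm_trans (perm_filterC (loop u) m) _; rewrite perm_cat2l; exact: perm_filterC.
have slu : supp [set u] lu.
  apply/allP => e; rewrite mem_filter /loop /inside !inE; by case/andP.
have olu : all (loop u) lu by exact: filter_all.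
have olv : all (loop v) lv by exact: filter_all.
have [bs rbs] : exists bs, red set0 m2 [seq (u, v, b) | b <- bs].
  apply: red_orient; apply/allP => -[[x y] s].
  rewrite !mem_filter /= /loop /= => /and3P[h1 h2 /(allP sm)].
  rewrite /inside !inE /= => /andP[/orP[]/eqP xE /orP[]/eqP yE]; subst x y;
    by rewrite ?eqxx ?orbT // in h1 h2 *.
have sbs : size bs = cut [set u] m.
  rewrite (perm_cut _ p1) !cut_cat (cut_loops _ olu) (cut_loops _ olv) -(red0_cut _ rbs) /=.
  rewrite /cut count_map -size_filter; congr size; apply/esym/all_filterP/allP => b _.
  by rewrite /= /cross /= !inE eqxx eq_sym (negPf uv).
have ebs : ~~ odd (size bs) by rewrite sbs even_cut.
case: bs rbs sbs ebs c4 => [|b1 [|b2 [|b3 [|b4 bs]]]] rbs sbs; rewrite -sbs //=.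
rewrite !negbK => /even_halfK/esym/(red_pairs u v)[us rus sus] _.
have r1 : red setT l (lu ++ lv ++ [:: (u, v, b1), (u, v, b2), (u, v, b3), (u, v, b4) & us]).
  apply: red_trans (red_sub (subsetT _) rm) _; apply: red_trans (red_perm _ p1) _.
  do 2!apply: red_catl; apply: red_trans (red0_sub _ rbs) _ => /=.
  by do 4!apply: red_cons.
pose q := par lv.
have r2 : red setT l [:: (u, v, q (+) b1), (u, v, b2), (u, v, b3), (u, v, b4) & us ++ lu].
  apply: red_trans r1 _; apply: red_trans (red_perm _ (_ : perm_eq _ (lv ++
      [:: (u, v, b1), (u, v, b2), (u, v, b3), (u, v, b4) & us] ++ lu))) _.
    by rewrite perm_catC -catA.
  apply: red_trans (red_catl _ (red_flip _ _ _ _ _)) _.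
  apply: red_trans (absorb_loops _ _ _ (in_setT _) olv) _; exact: red_flip.
have {r1}pE := red_par r2.
set c1 := q (+) b1 in r2 pE.
have glue2 s t k : red setT [:: (u, v, s), (u, v, t) & k] ((u, u, s (+) t) :: k).
  apply: red_trans (red_perm _ (perm_swap12 _ _ _)) _.
  apply: red_trans (red_flip _ _ _ _ _) _.
  apply: red_trans (red_perm _ (perm_swap12 _ _ _)) _; exact: red_splice.
have absv s k : red setT [:: (v, v, true), (u, v, s) & k] ((u, v, ~~ s) :: k).
  apply: red_trans (red_perm _ (perm_swap12 _ _ _)) _.
  by rewrite -addbT; exact: red_splice.
pose c2 := c1 (+) b2; pose c3 := b3 (+) b4.
have r3 : red setT ((u, u, true) :: (v, v, true) :: l)
   [:: (u, u, true), (u, u, ~~ c2), (u, u, c3) & us ++ lu].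
  apply: red_trans (red_cons _ (red_cons _ r2)) _; apply: red_cons.
  apply: red_trans (absv _ _) _; apply: red_trans (glue2 _ _ _) _.
  rewrite addNb; apply: red_cons; exact: glue2.
have r4 : red setT ((u, u, true) :: (v, v, true) :: l)
   [:: (u, u, true), (u, u, ~~ c3), (u, u, c2) & us ++ lu].
  apply: red_trans (red_cons _ (red_cons _ r2)) _; apply: red_cons.
  apply: (@red_trans _ _ [:: (v, v, true), (u, v, b3), (u, v, b4), (u, v, c1), (u, v, b2) & us ++ lu]).
    apply: red_cons; apply: red_perm.
    apply/permPl; exact: (perm_catCA [:: (u, v, c1); (u, v, b2)] [:: (u, v, b3); (u, v, b4)] (us ++ lu)).
  apply: red_trans (absv _ _) _; apply: red_trans (glue2 _ _ _) _.
  rewrite addNb; apply: red_cons; exact: glue2.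
have sus' : supp [set u] (us ++ lu) by rewrite /supp all_cat; apply/andP.
have pE' : c2 (+) c3 (+) par (us ++ lu).
  move: pl; rewrite /par /= -/(par l) -pE /par /= !oddD !oddb -/(par (us ++ lu)) /c2 /c3.
  by rewrite negbK !addbA.
have sl1 b : inside [set u] (u, u, b) by rewrite /inside /= !inE eqxx.
have [c23|c23] := boolP (c2 (+) c3); last first.
  exists u; eexists; split; [exact: r3 | by rewrite /= !sl1|].
  have : 0 < count snd (us ++ lu).
    by move: pE'; rewrite (negPf c23) /= /par; case: (count _ _).
  by move: c23 => /=; case: (c2); case: (c3) => //= _; rewrite ?add0n ?add1n !ltnS.
case: (boolP c2) c23 => c2T; rewrite /= ?addFb => c3T.
  exists u; eexists; split; [exact: r4 | by rewrite /= !sl1|].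
  by rewrite /= c2T c3T.
exists u; eexists; split; [exact: r3 | by rewrite /= !sl1|].
by rewrite /= c2T c3T.
Qed.
End TwoLoops.

Section SixConnected.
Variable V : finType.
Implicit Types (l m r A : seq (ed V)) (e : ed V) (X Y U S T D W : {set V}) (u v w x o : V).

Lemma count_tint_glues (c : V -> bool) w g ps :
  all (fun p => (p.1.1 != w) && (p.2.1 != w)) ps ->
  (forall p, p \in ps -> ~~ tint c (glue p) -> c p.1.1 (+) p.1.2 = g) ->
  count (tint (fun v => if v == w then g else c v)) (unglues w ps) =
  count (tint c) (map (@glue V) ps).
Proof.
elim: ps => [|p ps IH] //= /andP[/andP[p1 p2] pw] H.
rewrite IH //; last by move=> q qps; apply: H; rewrite inE qps orbT.
rewrite addnA; congr (_ + _).
have {H} := H p (mem_head _ _); clear IH.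
rewrite /tint /= eqxx (negPf p1) (negPf p2).
case: p.1.2; case: p.2.2; case: (c p.1.1); case: (c p.2.1) => /= H;
  by rewrite -?(H isT); case: g {H}.
Qed.

Lemma count_tint_at (c d : V -> bool) w l :
  (forall v, v != w -> c v = d v) -> all (fun e => hits w e == 0) l ->
  count (tint c) l = count (tint d) l.
Proof.
move=> cd /allP lw; apply: eq_in_count => e /lw; rewrite /hits /tint.
case: (eqVneq e.1.1 w) => // e1; case: (eqVneq e.1.2 w) => // e2 _; by rewrite !cd.
Qed.

Lemma cut_supp X l : supp X l -> cut X l = 0.
Proof.
move=> /allP sl; apply/eqP; rewrite -leqn0 leqNgt -has_count; apply/hasPn => e /sl.
by rewrite /cross => /andP[-> ->].
Qed.

Lemma contract_supp x X l : supp X l -> contract x X l = [::].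
Proof.
move=> sl; rewrite /contract (_ : filter _ l = [::]) //.
apply/eqP; rewrite -size_eq0 size_filter -leqn0 leqNgt -has_count; apply/hasPn => e.
by move=> /(allP sl) /= ->.
Qed.

(* Two pairs at [w] of opposite colours, re-paired crosswise, and the odd edge make three odd closed trails. *)
Lemma unglue_triple (c : V -> bool) W w p q l : w \in W -> W :\ w != set0 ->
  (p.1.1 != w) && (p.2.1 != w) -> (q.1.1 != w) && (q.2.1 != w) ->
  ~~ tint c (glue p) -> ~~ tint c (glue q) ->
  c p.1.1 (+) p.1.2 = false -> c q.1.1 (+) q.1.2 = true ->
  supp (W :\ w) (glue p :: glue q :: l) -> count (tint c) l = 1 ->
  ev (unglue w p ++ unglue w q ++ l) -> conn 6 (W :\ w) (glue p :: glue q :: l) ->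
  triple (unglue w p ++ unglue w q ++ l).
Proof.
move=> wW /set0Pn[x xX] /andP[p1w p2w] /andP[q1w q2w] tp tq cp cq sl cl el kl.
set X := W :\ w in xX sl kl *.
have wX : w \notin X by rewrite !inE eqxx.
have [[[a b] s] el1 te] : exists2 e, e \in l & tint c e by apply/hasP; rewrite has_count cl.
pose r := rem (a, b, s) l.
have pl : perm_eq l ((a, b, s) :: r) := perm_to_rem el1.
have cr : all (fun e => ~~ tint c e) r.
  by move: cl; rewrite (permP pl) /= te => -[/eqP]; rewrite -leqn0 leqNgt -has_count -all_predC.
have {sl}[gp gq sab sr] : [/\ inside X (glue p), inside X (glue q), inside X (a, b, s) & supp X r].
  by move: sl; rewrite /supp /= (perm_all _ pl) /= => /and4P.
pose d v := (v != w) && c v.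
have dX v : v \in X -> d v = c v by rewrite /d => vX; case: eqP => // vw; rewrite -vw vX in wX.
have dw : d w = false by rewrite /d eqxx.
have /andP[/= p1X p2X] := gp; have /andP[/= q1X q2X] := gq; have /andP[/= aX bX] := sab.
pose A := map (switch d) (unglue w p ++ unglue w q ++ r).
have dtint e : inside X e -> tint d e = tint c e.
  by case/andP=> e1 e2; rewrite /tint !dX.
have swe : switch d (a, b, s) = (a, b, true) by rewrite /switch dtint ?te.
have pA : perm_eq (map (switch d) (unglue w p ++ unglue w q ++ l)) ((a, b, true) :: A).
  rewrite -swe /A -map_cons; apply: perm_map.
  rewrite !catA; apply: perm_trans (_ : perm_eq ((unglue w p ++ unglue w q) ++ [:: (a, b, s)] ++ r) _).
    by rewrite perm_cat2l.
  by apply/permPl; exact: perm_catCA.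
apply: (@triple_switch _ d); apply: triple_red (red_perm setT pA) _.
have sA : supp X (map (switch d) r) by rewrite supp_switch.
have AE : A = [:: (p.1.1, w, false); (w, p.2.1, false); (q.1.1, w, true); (w, q.2.1, true)]
    ++ map (switch d) r.
  rewrite /A !map_cat /= /switch /tint /= dw !dX //; move: tp tq cp cq; rewrite /tint /=.
  case: p.1.2; case: p.2.2; case: (c p.1.1); case: (c p.2.1) => //=;
  by case: q.1.2; case: q.2.2; case: (c q.1.1); case: (c q.2.1).
have cutA U : cut U A = cross U (p.1.1, w, false) + (cross U (w, p.2.1, false) +
   (cross U (q.1.1, w, true) + (cross U (w, q.2.1, true) + cut U r))).
  by rewrite AE cut_cat cut_switch /cut /= addn0 !addnA.
have tA : all (touch X) A.
  rewrite AE all_cat /= /touch /= p1X p2X q1X q2X ?orbT /=.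
  by apply: sub_all sA => e /andP[->].
have iA : inner_even X A.
  rewrite AE /inner_even all_cat /= /inside /= (negPf wX) !andbF /= all_map.
  apply/allP => e er /=; have := allP cr e er; have ie := allP sr e er.
  by rewrite dtint // => te'; rewrite te' implybT.
have evA v : v \in X -> ~~ odd (deg v ((a, b, true) :: A)).
  by rewrite -(perm_deg v pA) deg_switch.
have c4 : cut X A = 4.
  by rewrite cutA (cut_supp sr) /cross /= p1X p2X q1X q2X (negPf wX).
have c6 U : U \proper X -> U != set0 -> 6 <= cut U ((a, b, true) :: A).
  move=> /properP[UX [y yX yU]] /set0Pn[y' y'U].
  have := kl U y' y (subsetP UX _ y'U) yX y'U yU.
  rewrite -[cut U (glue p :: _)]/(cross U (glue p) + (cross U (glue q) + cut U l)).
  rewrite -[cut U (_ :: A)]/(cross U (a, b, true) + cut U A) cutA (perm_cut U pl).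
  rewrite -[cut U (_ :: r)]/(cross U (a, b, s) + cut U r) /cross /=.
  have wU : w \notin U by apply: contra wX => /(subsetP UX).
  rewrite (negPf wU).
  case: (p.1.1 \in U); case: (p.2.1 \in U); case: (q.1.1 \in U); case: (q.2.1 \in U) => /=;
  case: (_ (+) _); move: (cut U r); clear; lia.
have rA := pinch xX aX bX tA iA evA c4 c6.
apply: triple_red rA _; rewrite AE contract_cat (contract_supp _ sA) cats0.
rewrite /contract /= /inside /= (negPf wX) !andbF /= /remap /collapse /=.
rewrite p1X p2X q1X q2X (negPf wX).
exists x, [:: (x, x, true); (x, x, true); (x, x, true)]; split=> //; last first.
  by rewrite /= /inside /= !inE eqxx.
apply: red_cons.
apply: (@red_trans _ _ [:: (x, w, false); (w, x, true); (x, w, true); (w, x, false)]).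
  by apply: red_perm; apply/permP => f /=; do 4!case: (f _).
apply: red_trans (red_splice _ _ _ _ _ (in_setT _)) _; apply: red_cons.
exact: red_splice.
Qed.

Lemma odd_loops_distinct W l u v : u \in W -> v \in W -> u != v -> supp W l -> ev l ->
  conn 4 W l -> par l -> (u, u, true) \in l -> (v, v, true) \in l -> triple l.
Proof.
move=> uW vW uv sl el cl pl ul vl.
have p1 := perm_to_rem ul.
have v1 : (v, v, true) \in rem (u, u, true) l.
  by move: vl; rewrite (perm_mem p1) inE => /orP[/eqP[vu]|//]; rewrite vu eqxx in uv.
have p2 := perm_to_rem v1.
have p : perm_eq l [:: (u, u, true), (v, v, true) & rem (v, v, true) (rem (u, u, true) l)].
  by apply: perm_trans p1 _; rewrite perm_cons.
apply: triple_red (red_perm setT p) _; apply: two_loops uW vW uv _ _ _ _.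
- by rewrite -(perm_supp _ p).
- exact: perm_ev p el.
- exact: conn_perm p cl.
- by rewrite -(perm_par p).
Qed.

Theorem six_conn W l : W != set0 -> supp W l -> ev l -> conn 6 W l -> par l -> ~ triple l ->
  exists c : V -> bool, count (tint c) l = 1.
Proof.
move: {2}#|W| (leqnn #|W|) => n; elim: n W l => [|n IH] W l.
  by rewrite leqn0 cards_eq0 => ->.
move=> Wn W0 sl el cl pl nt.
have [/cards1P[x Wx]|W1] := boolP (#|W| == 1).
  exists (fun _ => false); have c3 : count snd l < 3.
    rewrite ltnNge; apply/negP => c3; apply: nt; exists x, l.
    by rewrite -Wx; split=> //; exact: red_refl.
  rewrite (@eq_count _ _ snd); last by move=> e; rewrite /tint !addbF.
  by move: pl c3; rewrite /par; case: (count _ _) => [|[|[|]]].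
have cl4 : conn 4 W l by apply: conn_le cl.
have [w wW wl] : exists2 w, w \in W & (w, w, true) \notin l.
  have [u uW] := set0Pn _ W0.
  have [|ul] := boolP ((u, u, true) \notin l); first by exists u.
  have : W :\ u != set0.
    by apply: contra W1 => /eqP W1; rewrite (cardsD1 u) uW W1 cards0.
  case/set0Pn=> v; rewrite !inE => /andP[vu vW]; exists v => //.
  apply/negP => vl; apply: nt; rewrite negbK in ul.
  by apply: odd_loops_distinct uW vW _ sl el cl4 pl ul vl; rewrite eq_sym.
have W'0 : W :\ w != set0.
  by apply: contra W1 => /eqP W1; rewrite (cardsD1 w) wW W1 cards0.
have [y] := set0Pn _ W'0; rewrite !inE => /andP[yw yW].
have c0 : 0 < cut [set w] l.
  by apply: leq_trans (cl [set w] w y _ _ _ _); rewrite ?inE ?eqxx.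
have wle : all (fun e => loop w e ==> ~~ e.2) l.
  apply/allP => -[[u v] s] el'; apply/implyP => /andP[/= /eqP uw /eqP vw].
  by apply: contraNN wl; rewrite -{1}uw -vw; case: s el'.
have red0 := drop_even_loops (in_setT w) c0 wle; set l0 := filter _ l in red0.
have wT : w \notin W :\ w by rewrite !inE eqxx.
have cl0 : conn 6 (W :\ w) l0.
  apply: conn_le (conn_sub (subsetDl _ _) cl) => // X.
  by rewrite (perm_cut X (perm_filterC (loop w) l)) cut_cat (@cut_loops _ X w) ?filter_all.
have lw : all (fun e => hits w e <= 1) l0.
  apply/allP => e; rewrite mem_filter /= /loop /hits => /andP[].
  by do 2!case: (_ == w).
have el0 := red_ev red0 el.
have [ps [r [red1 pw rw c1]]] := split_vertex (isT : ~~ odd 6) wT el0 cl0 lw.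
pose m := map (@glue V) ps ++ r.
have r0m : red setT l0 m by apply: red_trans (red0_sub _ red1) _; apply: red_glues.
have rm : red setT l m by exact: red_trans red0 r0m.
have sm : supp (W :\ w) m by apply: glues_supp pw rw; exact: red_supp rm sl.
have [||c cm] := IH _ m _ W'0 sm (red_ev rm el) c1 _ (fun h => nt (triple_red rm h)).
- have := Wn; rewrite (cardsD1 w) wW; exact.
- by rewrite (red_par rm).
pose ok p := ~~ tint c (glue p).
have mono g : (forall p, p \in ps -> ok p -> c p.1.1 (+) p.1.2 = g) ->
    exists c : V -> bool, count (tint c) l = 1.
  move=> H; exists (fun v => if v == w then g else c v); set c' := fun v => _.
  rewrite (permP (perm_filterC (loop w) l)) count_cat -/l0.
  rewrite (@eq_in_count _ (tint c') pred0 (filter _ l)) ?count_pred0; last first.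
    move=> e; rewrite mem_filter => /andP[/[dup] le /andP[/eqP e1 /eqP e2] /(allP wle)].
    by rewrite le /tint e1 e2 -addbA addbb addbF => /negPf.
  rewrite (red0_count _ red1); last by move=> u v s; rewrite /tint /= addbAC.
  rewrite count_cat (count_tint_glues pw H).
  rewrite (@count_tint_at c' c w r _ rw) -?count_cat // => v vw.
  by rewrite /c' (negPf vw).
have [/hasP[p pp /andP[okp cp]]|np] := boolP (has (fun p => ok p && ~~ (c p.1.1 (+) p.1.2)) ps); last first.
  apply: (mono true) => p pp okp; have := hasPn np p pp.
  by rewrite okp /= negbK.
have [/hasP[q qp /andP[okq cq]]|nq] := boolP (has (fun p => ok p && (c p.1.1 (+) p.1.2)) ps); last first.
  apply: (mono false) => q qp okq; have := hasPn nq q qp.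
  by rewrite okq /= => /negPf.
have p1 := perm_to_rem pp; set ps1 := rem p ps in p1.
have q1 : q \in ps1.
  by move: qp; rewrite (perm_mem p1) inE => /orP[/eqP pq|//]; rewrite pq (negPf cp) in cq.
have p2 := perm_to_rem q1; set ps2 := rem q ps1 in p2.
have p12 : perm_eq ps [:: p, q & ps2] by apply: perm_trans p1 _; rewrite perm_cons.
pose t := map (@glue V) ps2 ++ r.
have pm : perm_eq m [:: glue p, glue q & t].
  by rewrite /m /t -[_ :: _]/(map (@glue V) [:: p, q & ps2] ++ r) perm_cat2r; exact: perm_map.
have rt : red setT l0 (unglue w p ++ unglue w q ++ t).
  apply: red_trans (red0_sub _ red1) _.
  apply: red_trans (red_perm _ (_ : perm_eq _ (unglues w [:: p, q & ps2] ++ r))) _.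
    by rewrite perm_cat2r; apply: perm_flatten; exact: perm_map.
  do 4!apply: red_cons; exact: red_glues.
case: nt; apply: (triple_red red0); apply: (triple_red rt).
apply: (@unglue_triple c W) => //.
- exact: allP pw p pp.
- exact: allP pw q qp.
- exact: negPf.
- by rewrite -(perm_supp _ pm).
- by move: cm; rewrite -/m (permP pm) /= (negPf okp) (negPf okq).
- exact: red_ev rt el0.
- exact: conn_perm pm c1.
Qed.

End SixConnected.

(** * Cuts of size 2 and 4 *)
Section Cuts.
Variable V : finType.
Implicit Types (l m r A L : seq (ed V)) (e : ed V) (X Y U S T D W : {set V}) (u v w x o : V).

Lemma const_cut S X l m : [disjoint S & X] -> red S l m -> cut X m = cut X l ->
  (forall U, U \subset X -> cut U m = cut U l) /\
  (forall p : pred (ed V), (forall x y s, p (x, y, s) = p (y, x, s)) ->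
    count (fun e => inside X e && p e) m = count (fun e => inside X e && p e) l).
Proof.
move=> dSX; elim=> {l m} [l m pl|a b s l|a w b s t l wS|m l k r1 IH1 r2 IH2].
- by move=> _; split=> [U _|p pC]; [rewrite (perm_cut U pl)|rewrite (permP pl)].
- move=> _; split=> [U _|p pC]; first by rewrite /cut /= /cross /= addbC.
  by rewrite /= pC /inside /= [(a \in X) && _]andbC.
- have wX : w \in X = false.
    by apply/negbTE; apply: contraL wS => wX; rewrite (disjointFl dSX).
  rewrite /cut /= /cross /= wX addbF /=.
  case: (boolP (a \in X)) => aX; case: (boolP (b \in X)) => bX /= cE.
  + by exfalso; move: cE; clear; set c := count _ _; lia.
  + split=> [U /subsetP UX|p pC]; last by rewrite /inside /= aX (negPf bX) wX.
    have -> : w \in U = false by apply: contraFF wX => /UX.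
    have -> : b \in U = false by apply/negbTE; apply: contra bX => /UX.
    by rewrite /= addbF add0n.
  + split=> [U /subsetP UX|p pC]; last by rewrite /inside /= wX (negPf aX).
    have -> : w \in U = false by apply: contraFF wX => /UX.
    have -> : a \in U = false by apply/negbTE; apply: contra aX => /UX.
    by rewrite /= add0n.
  + split=> [U /subsetP UX|p pC]; last by rewrite /inside /= wX (negPf aX) (negPf bX).
    have -> : w \in U = false by apply: contraFF wX => /UX.
    have -> : a \in U = false by apply/negbTE; apply: contra aX => /UX.
    have -> : b \in U = false by apply/negbTE; apply: contra bX => /UX.
    by [].
- move=> ck; have c1 := red_cut X r1; have c2 := red_cut X r2.
  have cl : cut X m = cut X l by apply/eqP; rewrite eqn_leq c1 -ck c2.
  have [u1 p1] := IH1 cl; have [u2 p2] := IH2 (etrans ck (esym cl)).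
  by split=> [U UX|p pC]; [rewrite u2 // u1 | rewrite p2 // p1].
Qed.

Lemma sum_deg_out X l : all (touch X) l -> \sum_(v in ~: X) deg v l = cut X l.
Proof.
move=> tl; rewrite /deg exchange_big /= /cut -sum1_count [RHS]big_mkcond /=.
rewrite big_seq [RHS]big_seq; apply: eq_bigr => e /(allP tl).
rewrite /touch /hits big_split /= /cross.
have H u : \sum_(v in ~: X) (u == v) = (u \notin X).
  have [uX|uX] := boolP (u \in X).
    by rewrite big1 // => v; rewrite inE => vX; case: eqP => // uv; rewrite -uv uX in vX.
  by rewrite (bigD1 u) ?inE //= eqxx big1 ?addn0 // => v /andP[_ /negPf]; rewrite eq_sym => ->.
rewrite !H; by case: (e.1.1 \in X); case: (e.1.2 \in X).
Qed.

Lemma red_two_cut A X : all (touch X) A -> (forall v, v \in X -> ~~ odd (deg v A)) ->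
  cut X A = 2 -> (forall U, U \subset X -> U != set0 -> 2 <= cut U A) ->
  exists o1 o2 s, [/\ o1 \notin X, o2 \notin X & red X A [:: (o1, o2, s)]].
Proof.
move=> tA evA cX cU.
have [o oX] : exists o, o \notin X.
  have [|a [b [s [m [_ aX bX _]]]]] := @exists_cross _ X A; first by rewrite cX.
  by exists b.
have oc : ~~ odd (cut X A) by rewrite cX.
have [Q [rQ _ QX]] := split_inside (isT : ~~ odd 2) isT oX (sub0set X) tA evA oc cU.
have : \sum_(v in ~: X) deg v Q = 2.
  rewrite -cX -(sum_deg_out tA); apply: eq_bigr => v; rewrite inE => vX.
  exact: red_deg rQ vX.
have QX' e : e \in Q -> (e.1.1 \notin X) && (e.1.2 \notin X).
  by move/QX; rewrite !inE => -[h1 h2]; apply/andP; split; apply/negP; [move/h1|move/h2].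
have H u : u \notin X -> \sum_(v in ~: X) (u == v) = 1.
  move=> uX; rewrite (bigD1 u) ?inE //= eqxx big1 // => v /andP[_ /negPf].
  by rewrite eq_sym => ->.
rewrite /deg exchange_big /= big_seq (eq_bigr (fun=> 2)) => [|e /QX' /andP[e1 e2]].
  rewrite -big_seq big_const_seq count_predT iter_addn_0.
  move=> /eqP; rewrite -[X in _ == X]muln1 eqn_mul2l /=.
  case: Q QX' rQ {QX} => [|[[a b] s] [|? ?]] //= QX' rQ _.
  by have /andP[aX bX] := QX' _ (mem_head _ _); exists a, b, s.
by rewrite /hits big_split /= !H.
Qed.

Lemma inner_cut_split u X l : u \in X ->
  cut [set u] l + cut (X :\ u) l <= cut X l + (count (inside X) l).*2.
Proof.
move=> uX; elim: l => // e l IH.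
rewrite /cut /= -!/(cut _ _) /cross /inside !inE.
have H v : (v == u) || ((v != u) && (v \in X)) = (v \in X) by case: eqVneq => // ->.
move: IH; rewrite -(H e.1.1) -(H e.1.2).
move: (cut [set u] l) (cut (X :\ u) l) (cut X l) (count _ l); clear.
by case: (e.1.1 == u); case: (e.1.2 == u); case: (e.1.1 \in X); case: (e.1.2 \in X) => /= a b c d; lia.
Qed.

Lemma deg_loops w l : deg w l = cut [set w] l + (count (loop w) l).*2.
Proof.
elim: l => [|e l IH]; first by rewrite /deg big_nil.
rewrite /deg big_cons -/(deg w l) IH /cut /= -!/(cut _ _) /cross /loop /hits !inE.
move: (cut _ l) (count _ l); clear.
by case: (e.1.1 == w); case: (e.1.2 == w) => /= a b; lia.
Qed.

(* A cut of size 4 that is minimal on the side of [X] makes [X] 6-edge-connected once the other side is split off. *)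
Lemma inner_almost_balanced X W l y : X \subset W -> X != set0 -> y \in W -> y \notin X ->
  supp W l -> ev l -> conn 4 W l -> par l -> ~ triple l -> cut X l = 4 ->
  (forall U, U \proper X -> U != set0 -> 6 <= cut U l) ->
  exists c : V -> bool, count (fun e => inside X e && tint c e) l <= 1.
Proof.
move=> XW X0 yW yX sl el cl pl nt cX c6.
pose T := y |: X.
have TW : T \subset W by rewrite subUset sub1set yW.
have T0 : T != set0 by apply/set0Pn; exists y; rewrite !inE eqxx.
have [x xX] := set0Pn _ X0.
have [m1 [r1 s1 k1]] := split_all (isT : ~~ odd 4) isT sl el cl TW T0.
have yT : y \in T by rewrite !inE eqxx.
have xT : x \in T by rewrite !inE xX orbT.
have cy : 0 < cut [set y] m1.
  apply: leq_trans (k1 [set y] y x yT xT _ _); rewrite ?inE ?eqxx //.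
  by apply: contraNneq yX => <-.
have yS : y \in ~: X by rewrite inE.
have [m2 [r2 n2 c2]] := remove_loops yS cy.
have r12 : red (~: X) l m2.
  apply: red_trans r2; apply: red_sub r1; apply/subsetP => v.
  by rewrite !inE negb_or => /andP[/andP[]].
have cX2 : cut X m2 = cut X l.
  apply/eqP; rewrite eqn_leq (red_cut X r12) cX c2.
  exact: k1 xT yT xX yX.
have dX : [disjoint ~: X & X] by rewrite -setI_eq0 setIC setICr.
have [cU cp] := const_cut dX r12 cX2.
have s2 : supp T m2 := red_supp r2 s1.
have k2 : conn 6 X m2.
  suff H Y a b : a \in X -> b \in X -> a \in Y -> b \notin Y -> y \notin Y -> 6 <= cut Y m2.
    move=> Y a b aX bX aY bY; have [yY|yY] := boolP (y \in Y); last exact: (H Y a b).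
    by rewrite -cutC; apply: (H _ b a); rewrite // !inE ?negbK.
  move=> aX bX aY bY yY; rewrite -(cut_restrict Y s2).
  have -> : Y :&: T = Y :&: X.
    by apply/setP => v; rewrite !inE; case: eqP => // ->; rewrite (negPf yY).
  rewrite cU ?subsetIr //; apply: c6.
    by apply/properP; split; [exact: subsetIr | exists b => //; rewrite !inE (negPf bY)].
  by apply/set0Pn; exists a; rewrite inE aY.
have lw : all (fun e => hits y e <= 1) m2.
  by apply: sub_all n2 => e; rewrite /loop /hits; do 2!case: (_ == y).
have [ps [r [r3 pw rw k3]]] := split_vertex (isT : ~~ odd 6) yX (red_ev r12 el) k2 lw.
pose m3 := map (@glue V) ps ++ r.
have rm : red setT l m3.
  apply: red_trans (red_sub (subsetT _) r12) _; apply: red_trans (red0_sub _ r3) _.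
  exact: red_glues.
have s3 : supp X m3.
  have -> : X = T :\ y by rewrite /T setU1K.
  apply: glues_supp pw rw; apply: red_supp s2.
  by apply: red_trans (red0_sub setT r3) _; exact: red_glues.
have [|c cm] := six_conn X0 s3 (red_ev rm el) k3 _ (fun h => nt (triple_red rm h)).
  by rewrite (red_par rm).
exists c; have tC u v s : tint c (u, v, s) = tint c (v, u, s) by rewrite /tint /= addbAC.
rewrite -(cp (tint c) tC) -cm.
rewrite (red0_count _ r3); last by move=> u v s; rewrite tC /inside /= [(u \in X) && _]andbC.
rewrite !count_cat.
have -> : count (fun e => inside X e && tint c e) (unglues y ps) = 0.
  elim: ps {pw r3 k3 m3 rm s3 cm} => //= p ps ->.
  by rewrite /inside /= (negPf yX) andbF.
rewrite add0n; apply: leq_trans (leq_addl _ _); apply: sub_count => e.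
by case/andP.
Qed.

Definition quotient x X L : seq (ed V) :=
  map (remap (collapse x X)) (filter (fun e => ~~ inside X e || e.2) L).

Lemma quotient_even x X L : inner_even X L -> quotient x X L = contract x X L.
Proof.
move=> /allP iL; congr map; apply: eq_in_filter => e /iL /=.
by case: (inside X e) => //= /negPf.
Qed.

Lemma contract_outside x X B : all (predC (touch X)) B -> contract x X B = B.
Proof.
elim: B => [|[[u v] s] B IH] //= /andP[]; rewrite /touch /= negb_or => /andP[uX vX] /IH {}IH.
by rewrite /contract /= /inside /= (negPf uX) /= /remap /collapse /= (negPf uX) (negPf vX) -/(contract _ _ _) IH.
Qed.

Lemma red_quotient x X y L : x \in X -> y \notin X -> ev L -> cut X L = 4 ->
  (forall U, U \subset X -> U != set0 -> 4 <= cut U L) ->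
  (forall U, U \proper X -> U != set0 -> 6 <= cut U L) ->
  count (fun e => inside X e && e.2) L <= 1 -> red setT L (quotient x X L).
Proof.
move=> xX yX eL cX c4 c6 cL.
have tsplit M : perm_eq M (filter (touch X) M ++ filter (predC (touch X)) M) := perm_filterC _ _.
have cB U M : U \subset X -> cut U (filter (predC (touch X)) M) = 0.
  move=> UX; apply/eqP; rewrite -leqn0 leqNgt -has_count; apply/hasPn => e.
  rewrite mem_filter /= /touch negb_or /cross => /andP[/andP[e1 e2] _].
  by rewrite !(contraNF (subsetP UX _)).
have dB v M : v \in X -> deg v (filter (predC (touch X)) M) = 0.
  move=> vX; rewrite /deg big_seq big1 // => e; rewrite mem_filter /= /touch negb_or /hits.
  by move=> /andP[/andP[e1 e2] _]; do 2!(case: eqP => [ev|_]; first by rewrite ev vX in e1 e2).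
have cA U M : U \subset X -> cut U (filter (touch X) M) = cut U M.
  by move=> UX; rewrite [RHS](perm_cut U (tsplit M)) cut_cat cB ?addn0.
have dA v M : v \in X -> deg v (filter (touch X) M) = deg v M.
  by move=> vX; rewrite [RHS](perm_deg v (tsplit M)) deg_cat dB ?addn0.
have [[[[a b] s] eL' /andP[/= ie se]]|ne] := altP (@hasP _ (fun e => inside X e && e.2) L); last first.
  have iL : inner_even X L.
    by move: ne; rewrite -all_predC; apply: sub_all => e /=; rewrite negb_and implybE.
  rewrite quotient_even //; pose A := filter (touch X) L; pose B := filter (predC (touch X)) L.
  apply: red_trans (red_perm _ (tsplit L)) _.
  apply: red_trans (_ : red _ (contract x X A ++ B) _).
    apply: red_cat; apply: (red_sub (subsetT X)).
    apply: (@contract_red _ A X x y 4) => //.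
    - exact: filter_all.
    - by apply/allP => e; rewrite mem_filter => /andP[_ /(allP iL)].
    - by move=> v vX; rewrite dA.
    - by rewrite cA.
    - by move=> U UX U0; rewrite cA //; exact: c4.
  apply: red_perm; rewrite -{1}(@contract_outside x X B) ?filter_all // -contract_cat.
  by rewrite perm_sym; exact: red0_map_contract.
case: s eL' ie se => // eL' ie _; pose r := rem (a, b, true) L.
have pL : perm_eq L ((a, b, true) :: r) := perm_to_rem eL'.
have ir : inner_even X r.
  move: cL; rewrite (permP pL) /= ie /= add1n ltnS leqn0 => /eqP c0.
  apply/allP => e er; apply/implyP => ie'; apply/negP => se'.
  have : 0 < count (fun e => inside X e && e.2) r.
    by rewrite -has_count; apply/hasP; exists e; rewrite ?ie'.
  by rewrite c0.
pose A := filter (touch X) r; pose B := filter (predC (touch X)) r.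
have /andP[/= aX bX] := ie.
have pLA : perm_eq L (((a, b, true) :: A) ++ B).
  by apply: perm_trans pL _; rewrite /= perm_cons; exact: tsplit.
have pq : perm_eq (quotient x X L) ((x, x, true) :: contract x X A ++ B).
  have pq1 : perm_eq (quotient x X L) (quotient x X ((a, b, true) :: r)).
    by apply: perm_map; exact: perm_filter.
  apply: perm_trans pq1 _; rewrite /quotient /= orbT /= -/(quotient x X r) quotient_even //.
  rewrite /remap /collapse /= aX bX perm_cons.
  rewrite -{1}(@contract_outside x X B) ?filter_all // -contract_cat.
  exact: red0_map_contract.
apply: red_trans (red_perm _ pLA) _.
apply: red_trans _ (red_perm _ (_ : perm_eq _ (quotient x X L))); last by rewrite perm_sym; exact: pq.
rewrite -cat_cons; apply: red_cat; apply: (red_sub (subsetT X)).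
have cXe M : cross M (a, b, true) + cut M r = cut M L by rewrite (perm_cut M pL).
apply: pinch => //.
- exact: filter_all.
- by apply/allP => e; rewrite mem_filter => /andP[_ /(allP ir)].
- move=> v vX; have := eL v; rewrite (perm_deg v pL) /deg !big_cons -!/(deg _ _) dA //.
- by rewrite cA // -cX -cXe /cross /= aX bX.
- move=> U UX U0; have := c6 U UX U0; rewrite -cXe.
  by rewrite -[cut U (_ :: A)]/(cross U (a, b, true) + cut U A) cA // proper_sub.
Qed.

End Cuts.

Import GRing.Theory.

(** * Flows modulo 3 *)

(* An oriented edge is a pair of darts [(v, b)], outgoing at [v] when [b] holds. *)
Notation od V := (((V * bool) * (V * bool))%type).

Section Flows.
Variable V : finType.
Implicit Types (F : seq (od V)) (f : od V) (d : V * bool) (X Y U W : {set V}) (u v w x y : V).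

Definition edge_of f : ed V := (f.1.1, f.2.1, f.1.2 == f.2.2).
Local Notation edges F := (map edge_of F).

Definition out_in (b : bool) : 'F_3 := (if b then 1 else -1)%R.
Definition dart_at v d : 'F_3 := (out_in d.2 *+ (d.1 == v))%R.
Definition flow_at v f : 'F_3 := (dart_at v f.1 + dart_at v f.2)%R.
Definition flow F := forall v, (\sum_(f <- F) flow_at v f = 0)%R.

Lemma out_inN b : out_in (~~ b) = (- out_in b)%R.
Proof. by case: b; rewrite /out_in ?opprK. Qed.

Definition switch_flow (c : V -> bool) f : od V :=
  ((f.1.1, f.1.2 (+) c f.1.1), (f.2.1, f.2.2 (+) c f.2.1)).

Lemma edge_switch c f : edge_of (switch_flow c f) = switch c (edge_of f).
Proof.
rewrite /edge_of /switch /tint /=; congr (_, _, _).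
by case: f.1.2; case: f.2.2; case: (c f.1.1); case: (c f.2.1).
Qed.

Lemma flow_switch c F : flow F -> flow (map (switch_flow c) F).
Proof.
move=> fF v; rewrite big_map.
have H d : dart_at v (d.1, d.2 (+) c d.1) = ((if c v then -1 else 1) * dart_at v d)%R.
  rewrite /dart_at /=; case: eqP => [->|_]; last by rewrite !mulr0n mulr0.
  by rewrite !mulr1n; case: (c v); rewrite ?addbT ?addbF ?out_inN ?mulN1r ?mul1r.
under eq_bigr => f _ do rewrite /flow_at /= (H f.1) (H f.2) -mulrDr.
by rewrite -mulr_sumr fF mulr0.
Qed.

Lemma sum_dart_at d : (\sum_v dart_at v d = out_in d.2)%R.
Proof.
rewrite (bigD1 d.1) //= /dart_at eqxx big1 ?addr0 // => v /negPf.
by rewrite eq_sym => ->.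
Qed.

Lemma flow_balanced_but_one (c : V -> bool) F : flow F -> count (tint c) (edges F) <> 1.
Proof.
move=> fF cF; have fG := flow_switch c fF; set G := map _ _ in fG.
have cG : count snd (edges G) = 1.
  rewrite -cF /G -map_comp !count_map; apply: eq_count => f.
  exact: (congr1 snd (edge_switch c f)).
have : (\sum_v \sum_(f <- G) flow_at v f = 0)%R by rewrite big1.
rewrite exchange_big /=.
under eq_bigr => f _ do rewrite /flow_at big_split /= !sum_dart_at.
have H f : (out_in f.1.2 + out_in f.2.2 = if f.1.2 == f.2.2 then out_in f.1.2 *+ 2 else 0)%R.
  by case: f.1.2; case: f.2.2; rewrite /out_in ?mulr2n ?subrr ?addNr.
under eq_bigr => f _ do rewrite H.
elim: G cG {fG} => [//|f G IH] /=; rewrite big_cons.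
case: (f.1.2 == f.2.2) => /= cG; last by rewrite add0r; apply: IH.
have -> : (\sum_(j <- G) (if j.1.2 == j.2.2 then out_in j.1.2 *+ 2 else 0) = 0)%R.
  move: cG => [/eqP]; rewrite -leqn0 leqNgt -has_count has_map => /hasPn nG.
  by rewrite big_seq big1 // => g /nG /negPf /= ->.
by rewrite addr0; case: f.1.2 => /eqP.
Qed.

(* The parity hypothesis says that the new edge has the sign of the part that it replaces. *)
Lemma two_cut_step X W F f1 f2 y : X \subset W -> X != set0 -> supp W (edges F) -> ev (edges F) ->
  conn 2 W (edges F) -> par (edges F) -> flow F ->
  y \in W -> y \notin X ->
  filter (fun f => cross X (edge_of f)) F = [:: f1; f2] ->
  let outer f := if f.1.1 \in X then f.2 else f.1 in
  par (filter (touch X) (edges F)) = ((outer f1).2 == (outer f2).2) ->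
  let F' := (outer f1, outer f2) :: filter (fun f => ~~ touch X (edge_of f)) F in
  [/\ size F' < size F, supp (W :\: X) (edges F'), ev (edges F') & conn 2 (W :\: X) (edges F')] /\
  [/\ par (edges F'), flow F' & triple (edges F') -> triple (edges F)].
Proof.
move=> XW X0 sF eF kF pF fF yW yX Ff outer pX F'.
pose A := filter (touch X) (edges F); pose B := filter (predC (touch X)) (edges F).
have pAB : perm_eq (edges F) (A ++ B) := perm_filterC _ _.
have BE : edges (filter (fun f => ~~ touch X (edge_of f)) F) = B by rewrite /B filter_map.
have cX : cut X (edges F) = 2 by rewrite /cut count_map -size_filter Ff.
have crossf f : f \in [:: f1; f2] -> f \in F /\ cross X (edge_of f).
  by rewrite -Ff mem_filter => /andP[].
have [f1F cf1] := crossf f1 (mem_head _ _).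
have [f2F cf2] : f2 \in F /\ cross X (edge_of f2) by apply: crossf; rewrite !inE eqxx orbT.
have outX f : cross X (edge_of f) -> (outer f).1 \notin X.
  by rewrite /outer /cross /edge_of /=; case: (boolP (f.1.1 \in X)).
have cB U : U \subset X -> cut U B = 0.
  move=> UX; apply/eqP; rewrite -leqn0 leqNgt -has_count; apply/hasPn => e.
  rewrite mem_filter /= /touch negb_or /cross => /andP[/andP[e1 e2] _].
  by rewrite !(contraNF (subsetP UX _)).
have dB v : v \in X -> deg v B = 0.
  move=> vX; rewrite /deg big_seq big1 // => e; rewrite mem_filter /= /touch negb_or /hits.
  by move=> /andP[/andP[e1 e2] _]; do 2!(case: eqP => [ev|_]; first by rewrite ev vX in e1 e2).
have cA U : U \subset X -> cut U A = cut U (edges F).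
  by move=> UX; rewrite [RHS](perm_cut U pAB) cut_cat cB ?addn0.
have tA : all (touch X) A by exact: filter_all.
have [|||o1 [o2 [s [o1X o2X rA]]]] := red_two_cut tA.
- by move=> v vX; have := eF v; rewrite (perm_deg v pAB) deg_cat dB ?addn0.
- by rewrite cA.
- move=> U UX /set0Pn[u uU]; rewrite cA //.
  apply: (kF U u y) => //; first exact: subsetP XW _ (subsetP UX _ uU).
  by apply: contra yX => /(subsetP UX).
have touchE f : touch X (edge_of f) = inside X (edge_of f) || cross X (edge_of f).
  by rewrite /touch /inside /cross; case: (_ \in X); case: (_ \in X).
have dA v : v \notin X -> deg v A = ((outer f1).1 == v) + ((outer f2).1 == v).
  move=> vX; have nv u : u \in X -> (u == v) = false by move=> uX; apply: contraNF vX => /eqP<-.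
  have H f : cross X (edge_of f) -> hits v (edge_of f) = ((outer f).1 == v).
    rewrite /cross /hits /outer /=; case: ifP => [/nv->//|_ /= /nv->]; exact: addn0.
  have -> : deg v A = \sum_(f <- filter (fun f => cross X (edge_of f)) F) hits v (edge_of f).
    rewrite /deg /A filter_map big_map !big_filter big_mkcond [RHS]big_mkcond /=.
    apply: eq_bigr => f _; rewrite touchE.
    case: (cross X _); rewrite ?orbT // orbF; case: ifP => // /andP[/nv e1 /nv e2].
    by rewrite /hits e1 e2.
  by rewrite Ff !big_cons big_nil addn0 !H.
have oE v : v \notin X -> (o1 == v) + (o2 == v) = ((outer f1).1 == v) + ((outer f2).1 == v).
  move=> vX; rewrite -dA // -(red_deg rA vX) /deg big_cons big_nil /hits /=.
  by rewrite addn0.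
have sE : s = par A by have := red_par rA; rewrite /par /= addn0 oddb.
have rS : red X [:: (o1, o2, s)] [:: ((outer f1).1, (outer f2).1, s)].
  have := oE o1 o1X; have := oE o2 o2X; rewrite !eqxx.
  case: (eqVneq (outer f1).1 o1) => [<-|n1].
    by case: (eqVneq (outer f2).1 o2) => [<- _ _|n2]; [exact: red_refl | case: (_ == o2)].
  case: (eqVneq (outer f2).1 o1) => [<-|n2]; last by case: (o2 == o1).
  case: (eqVneq (outer f1).1 o2) => [<- _ _|n3]; last by case: (_ == o2).
  exact: red_flip.
have rF : red setT (edges F) (edges F').
  apply: red_trans (red_perm _ pAB) _; rewrite /F' /= BE -cat1s.
  apply: red_cat; apply: (red_sub (subsetT X)); apply: red_trans rA _.
  by move: rS; rewrite sE pX.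
have sB : supp (W :\: X) B.
  apply/allP => e; rewrite mem_filter /= /touch negb_or => /andP[/andP[e1 e2] /(allP sF)].
  by rewrite /inside !inE e1 e2.
have oW f : f \in F -> (outer f).1 \in W.
  move=> fF'; have := allP sF (edge_of f); rewrite map_f // => /(_ isT) /andP[/= w1 w2].
  by rewrite /outer; case: ifP.
have eF' := red_ev rF eF.
have szF : size F' < size F.
  rewrite /F' /= size_filter -(count_predC (fun f => touch X (edge_of f)) F).
  rewrite -add2n leq_add2r -[2]/(size [:: f1; f2]) -Ff size_filter.
  by apply: sub_count => f; rewrite touchE => ->; rewrite orbT.
have kF' : conn 2 (W :\: X) (edges F').
  move=> Y a b; rewrite !inE => /andP[aX aW] /andP[bX bW] aY bY.
  have := even_cut Y eF'; suff : 0 < cut Y (edges F') by case: (cut _ _) => [|[]].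
  rewrite lt0n; apply/eqP => c0.
  have : cut Y (edges F') = ((outer f1).1 \in Y) (+) ((outer f2).1 \in Y) + cut Y B.
    by rewrite /F' /= BE.
  rewrite c0 => /esym/eqP; rewrite addn_eq0 eqb0 => /andP[oY /eqP cYB].
  pose Z := if (outer f1).1 \in Y then Y :|: X else Y :\: X.
  have cZ : 2 <= cut Z (edges F).
    by apply: (kF Z a b) => //; rewrite /Z; case: ifP => _; rewrite !inE ?aY ?aX ?(negPf bY) ?(negPf bX).
  have /eqP : cut Z (edges F) = 0; last by apply/negP; rewrite -lt0n; exact: ltnW.
  rewrite /cut count_map; apply/eqP; rewrite -leqn0 leqNgt -has_count; apply/hasPn => f fF' /=.
  have [t|t] := boolP (touch X (edge_of f)); last first.
    have : ~~ cross Y (edge_of f).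
      have : count (cross Y) B = 0 by exact: cYB.
      move/eqP; rewrite -leqn0 leqNgt -has_count => /hasPn; apply.
      by rewrite mem_filter /= t map_f.
    move: t; rewrite /touch negb_or /cross /= => /andP[t1 t2].
    by rewrite /Z; case: ifP => _; rewrite !inE (negPf t1) (negPf t2) ?orbF.
  move: t; rewrite touchE => /orP[/andP[/= t1 t2]|cf].
    by rewrite /Z; case: ifP => _; rewrite /cross /= !inE t1 t2 ?orbT.
  have oY' : ((outer f).1 \in Y) = ((outer f1).1 \in Y).
    have : f \in [:: f1; f2] by rewrite -Ff mem_filter cf.
    rewrite !inE => /orP[/eqP->//|/eqP->].
    by move: oY; case: (_ \in Y); case: (_ \in Y).
  have oZ : ((outer f).1 \in Z) = ((outer f1).1 \in Y).
    rewrite /Z; case: ifP => h; rewrite !inE oY' h ?andbF //.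
  have iZ u : u \in X -> (u \in Z) = ((outer f1).1 \in Y).
    by rewrite /Z => uX; case: ifP => h; rewrite !inE uX ?orbT.
  move: oZ cf; rewrite /outer /cross /=; case: ifP => h; first by rewrite (iZ _ h) => ->; rewrite addbb.
  by move=> -> /= h2; rewrite (iZ _ h2) addbb.
split; split=> //.
- rewrite /F' /= BE /= -/(supp _ B) sB andbT /inside /= !inE.
  by rewrite !outX // !oW.
- by rewrite (red_par rF).
- move=> v; rewrite /F' big_cons big_filter.
  have [vX|vX] := boolP (v \in X).
    have nv u : u \notin X -> (u == v) = false by move=> uX; apply: contraNF uX => /eqP->.
    rewrite /flow_at /dart_at !(nv _ (outX _ _)) // !mulr0n !add0r big1 // => f.
    by rewrite /touch negb_or => /andP[/nv e1 /nv e2]; rewrite e1 e2 addr0.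
  have nv u : u \in X -> (u == v) = false by move=> uX; apply: contraNF vX => /eqP<-.
  rewrite -[RHS](fF v) [RHS](bigID (fun f => touch X (edge_of f))) /=; congr (_ + _)%R.
  have -> : (\sum_(f <- F | touch X (edge_of f)) flow_at v f =
    \sum_(f <- filter (fun f => cross X (edge_of f)) F) flow_at v f)%R.
    rewrite big_filter big_mkcond [RHS]big_mkcond /=.
    apply: eq_bigr => f _; rewrite touchE.
    case: (cross X _); rewrite ?orbT // orbF; case: ifP => // /andP[/nv e1 /nv e2].
    by rewrite /flow_at /dart_at e1 e2 addr0.
  have H f : cross X (edge_of f) -> flow_at v f = dart_at v (outer f).
    rewrite /cross /flow_at /outer /=; case: ifP => [/nv h _|_ /= /nv h].
      by rewrite [dart_at v f.1]/dart_at h mulr0n add0r.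
    by rewrite [dart_at v f.2]/dart_at h mulr0n addr0.
  by rewrite Ff !big_cons big_nil addr0 (H f1) // (H f2).
- exact: triple_red rF.
Qed.

End Flows.

Section FlowTriple.
Variable V : finType.
Implicit Types (F G : seq (od V)) (f : od V) (d : V * bool) (X Y U W : {set V}) (u v w x y : V).
Local Notation edges F := (map (@edge_of V) F).

Definition odd_flow_graph W F :=
  [/\ supp W (edges F), ev (edges F), conn 2 W (edges F), par (edges F) & flow F].

Definition reducible F := exists F' W,
  [/\ size F' < size F, odd_flow_graph W F' & triple (edges F') -> triple (edges F)].

Lemma two_cut_reducible X W F y : X \subset W -> X != set0 -> y \in W -> y \notin X ->
  odd_flow_graph W F -> cut X (edges F) = 2 -> reducible F.
Proof.
move=> XW X0 yW yX [sF eF kF pF fF] cX.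
case Ff: (filter (fun f => cross X (edge_of f)) F) => [|f1 [|f2 [|f3 s]]];
  have := cX; rewrite /cut count_map -size_filter Ff //= => _.
pose X' := W :\: X.
have sW f : f \in F -> (f.1.1 \in W) && (f.2.1 \in W) by move=> fF'; have := allP sF (edge_of f); rewrite map_f // => /(_ isT).
have inX' u : u \in W -> (u \in X') = (u \notin X) by rewrite !inE => ->; rewrite andbT.
have cX' f : f \in F -> cross X' (edge_of f) = cross X (edge_of f).
  by move=> /sW /andP[w1 w2]; rewrite /cross /= !inX' //; case: (_ \in X); case: (_ \in X).
have Ff' : filter (fun f => cross X' (edge_of f)) F = [:: f1; f2].
  by rewrite -Ff; apply: eq_in_filter => f /cX'.
have [x xX] := set0Pn _ X0; have xW := subsetP XW _ xX.
have X'0 : X' != set0 by apply/set0Pn; exists y; rewrite inX'.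
have xX' : x \notin X' by rewrite inX' // negbK.
have stepX := two_cut_step XW X0 sF eF kF pF fF yW yX Ff.
have stepX' := two_cut_step (subsetDl W X) X'0 sF eF kF pF fF xW xX' Ff'.
pose out (Z : {set V}) f := if f.1.1 \in Z then f.2 else f.1.
have [pX|pX] := eqVneq (par (filter (touch X) (edges F))) ((out X f1).2 == (out X f2).2).
  have [[h1 h2 h3 h4] [h5 h6 h7]] := stepX pX; 
  eexists _, (W :\: X); split; [exact: h1 | by split | exact: h7].
have pX' : par (filter (touch X') (edges F)) = ((out X' f1).2 == (out X' f2).2).
  have cross12 f : f \in [:: f1; f2] -> f \in F /\ cross X (edge_of f).
    by rewrite -Ff mem_filter => /andP[].
  have [f1F cf1] := cross12 f1 (mem_head _ _).
  have [f2F cf2] : f2 \in F /\ cross X (edge_of f2) by apply: cross12; rewrite !inE eqxx orbT.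
  have cE : count snd (filter (touch X') (edges F)) =
      count snd (filter (predC (touch X)) (edges F)) + ((edge_of f1).2 + (edge_of f2).2).
    rewrite !count_filter; pose c2 := count (predI snd (cross X)) (edges F).
    have -> : ((edge_of f1).2 : nat) + (edge_of f2).2 = c2.
      rewrite /c2 -count_filter filter_map count_map Ff /= addn0.
      by [].
    rewrite -count_predUI [X in _ + X](_ : _ = 0) ?addn0; last first.
      rewrite (@eq_count _ _ pred0) ?count_pred0 // => e.
      rewrite /= /touch /cross; case: e.2 => //=; by case: (_ \in X); case: (_ \in X).
    apply: eq_in_count => e /mapP[f fF' ->] /=.
    have /andP[w1 w2] := sW f fF'.
    rewrite /touch /cross /= !inX' //; case: (_ == _) => //=.
    by case: (_ \in X); case: (_ \in X).
  have pT : par (edges F) = par (filter (touch X) (edges F)) (+) par (filter (predC (touch X)) (edges F)).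
    by rewrite (perm_par (perm_filterC (touch X) (edges F))) /par count_cat oddD.
  rewrite {1}/par cE oddD oddD !oddb -/(par (filter (predC (touch X)) (edges F))).
  have oX f : f \in F -> cross X (edge_of f) ->
      (edge_of f).2 = ((out X f).2 == (out X' f).2).
    move=> fF' cf; have /andP[w1 w2] := sW f fF'.
    move: cf; rewrite /cross /out /= inX' //; case: (f.1.1 \in X) => //= _; exact: eq_sym.
  rewrite (oX f1) // (oX f2) //; move: pT pX; rewrite pF -/(out X f1) -/(out X f2).
  by case: (par _); case: (par _); case: (out X f1).2; case: (out X f2).2;
    case: (out X' f1).2; case: (out X' f2).2.
have [[h1 h2 h3 h4] [h5 h6 h7]] := stepX' pX'.
by eexists _, (W :\: X'); split; [exact: h1 | by split | exact: h7].
Qed.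

Definition darts F := flatten [seq [:: f.1; f.2] | f <- F].

Definition same F G := [/\ size F = size G, red set0 (edges F) (edges G) &
  forall v, (\sum_(f <- F) flow_at v f = \sum_(f <- G) flow_at v f)%R].

Lemma same_trans F G H : same F G -> same G H -> same F H.
Proof.
move=> [s1 r1 e1] [s2 r2 e2]; split; [by rewrite s1 | exact: red_trans r1 r2|].
by move=> v; rewrite e1.
Qed.

Lemma same_cons f F G : same F G -> same (f :: F) (f :: G).
Proof.
move=> [s1 r1 e1]; split; [by rewrite /= s1 | exact: red_cons|].
by move=> v; rewrite !big_cons e1.
Qed.

Lemma same_flip d d' F : same ((d, d') :: F) ((d', d) :: F).
Proof.
split=> //; first by rewrite /= /edge_of /= [d'.2 == _]eq_sym; exact: red_flip.
by move=> v; rewrite !big_cons /flow_at /= [(dart_at v d' + _)%R]addrC.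
Qed.

Lemma pick_dart d F : d \in darts F -> exists q F0, same F ((q, d) :: F0) /\
  forall d', d' \in darts F -> [|| d' == d, d' == q | d' \in darts F0].
Proof.
elim: F => //= f F IH; rewrite /darts /= !inE => /or3P[/eqP->|/eqP->|/IH[q [F0 [sF H]]]].
- exists f.2, F; split; first by case: f => ? ?; exact: same_flip.
  by move=> d'; rewrite !inE.
- exists f.1, F; split; last by move=> d'; rewrite !inE orbCA.
  by case: f => ? ?; split=> //; exact: red_refl.
exists q, (f :: F0); split; last first.
  by move=> d'; rewrite !inE => /or3P[->|->|/H/or3P[->|->|]]; rewrite ?orbT // => ->; rewrite !orbT.
apply: same_trans (same_cons f sF) _; split=> //=.
- by apply: red_perm; exact: perm_swap12.
- by move=> v; rewrite !big_cons addrCA.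
Qed.

Lemma splice_reducible W F w : odd_flow_graph W F -> conn 4 W (edges F) ->
  (w, true) \in darts F -> (w, false) \in darts F -> reducible F.
Proof.
move=> [sF eF kF pF fF] k4 /pick_dart[q [F0 [[s0 r0 e0] H]]] /H.
have sF0 : supp W (edges ((q, (w, true)) :: F0)) := red_supp r0 sF.
have wW : w \in W by case/andP: sF0 => /andP[].
case/or3P=> [/eqP[]//|/eqP qE|/pick_dart[q' [F1 [sm H']]]].
  have rl : red set0 (edges F) ((w, w, false) :: edges F0) by move: r0; rewrite -qE.
  have p0 : par (edges F0) by have := red_par rl; rewrite /par /= => ->.
  have cE X : cut X (edges F0) = cut X (edges F).
    by rewrite -(red0_cut X rl) /cut /= /cross /= addbb.
  have sF0' : supp W (edges F0) by case/andP: sF0.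
  have dw : 0 < deg w (edges F0).
    have [/existsP[y /andP[yW yw]]|nW] := boolP [exists y, (y \in W) && (y != w)].
      rewrite deg_loops cE; apply: leq_trans (leq_addr _ _).
      apply: leq_trans (kF _ w y wW yW _ _); rewrite ?inE ?eqxx //; exact: negbTE.
    case: (F0) p0 sF0' => [//|g G] _ /= /andP[/andP[/= g1 _] _].
    rewrite /deg big_cons /hits /=; case: eqVneq => [_//|gw].
    by case/existsP: nW; exists g.1.1; rewrite g1.
  have [b [t [m rm]]] := exists_hit dw.
  have r1 : red setT (edges F) (edges F0).
    apply: red_trans (red0_sub _ rl) _; apply: red_trans (red_cons _ (red0_sub _ rm)) _.
    apply: red_trans (red_splice _ _ _ _ _ (in_setT w)) _.
    exact: red0_sub (red0_sym rm).
  exists F0, W; split; [by rewrite s0|split=> // |exact: triple_red r1].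
  - exact: red_ev r1 eF.
  - by apply: conn_le kF => // X; rewrite cE.
  - move=> v; rewrite -[RHS](fF v) e0 big_cons -qE [flow_at v (_, _)]/flow_at /dart_at /=.
    by case: (w == v); rewrite ?mulr1n /out_in ?addNr ?mulr0n ?addr0 ?add0r.
have [s1 r1 e1] : same F ((q, (w, true)) :: ((w, false), q') :: F1).
  apply: same_trans (And3 s0 r0 e0) _; apply: same_cons.
  apply: same_trans sm _; exact: same_flip.
have r2 : red setT (edges F) (edges ((q, q') :: F1)).
  apply: red_trans (red0_sub _ r1) _ => /=; rewrite /edge_of /=.
  have -> : (q.2 == q'.2) = (q.2 == true) (+) (false == q'.2) by case: (q.2); case: (q'.2).
  exact: red_splice.
exists ((q, q') :: F1), W; split; [by rewrite s1|split|exact: triple_red r2].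
- exact: red_supp r2 sF.
- exact: red_ev r2 eF.
- move=> X x y xW yW xX yX; have := k4 X x y xW yW xX yX.
  rewrite -(red0_cut X r1) /= /cut /= -!/(cut _ _) /cross /=.
  move: (cut X (edges F1)); clear.
  by case: (_ \in X); case: (_ \in X); case: (_ \in X) => /= c; lia.
- by rewrite (red_par r2).
- move=> v; rewrite -[RHS](fF v) e1 !big_cons addrA; congr (_ + _)%R.
  rewrite /flow_at /= [dart_at v (w, true)]/dart_at [dart_at v (w, false)]/dart_at /=.
  by case: (w == v); rewrite ?mulr1n /out_in ?mulr0n ?addr0 ?add0r // addrA addrK.
Qed.

Lemma uniform_deg (b : V -> bool) F : flow F ->
  (forall d, d \in darts F -> d.2 = b d.1) -> forall v, 3 %| deg v (edges F).
Proof.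
move=> fF ub v; have p3 : (3 \in [pchar 'F_3])%R by rewrite pchar_Fp.
rewrite (dvdn_pcharf p3).
have H G : {subset G <= F} ->
    (\sum_(f <- G) flow_at v f = out_in (b v) * (deg v (edges G))%:R)%R.
  elim: G => [|f G IH] sG; first by rewrite big_nil /deg big_nil mulr0.
  rewrite big_cons IH; last by move=> g gG; apply: sG; rewrite inE gG orbT.
  rewrite /deg /= big_cons -/(deg v (edges G)) /hits !natrD !mulrDr; congr (_ + _)%R.
  have fF' : f \in F by apply: sG; rewrite mem_head.
  have Hd d : d \in [:: f.1; f.2] -> (dart_at v d = out_in (b v) * ((d.1 == v) : nat)%:R)%R.
    move=> df; have /ub : d \in darts F by apply/flattenP; exists [:: f.1; f.2]; rewrite ?map_f //; apply/mapP; exists f.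
    rewrite /dart_at => ->; case: eqP => [->|_]; by rewrite ?mulr1n ?mulr1 ?mulr0n ?mulr0.
  by rewrite /flow_at !Hd // !inE eqxx ?orbT.
have := fF v; rewrite H // => /eqP; rewrite mulf_eq0; case/orP=> // .
by case: (b v).
Qed.
End FlowTriple.

Section FlowTriple.
Variable V : finType.
Implicit Types (l : seq (ed V)) (F G : seq (od V)) (f : od V) (d : V * bool) (X Y U W : {set V}) (u v w x y : V).
Local Notation edges F := (map (@edge_of V) F).

Lemma par_switch (c : V -> bool) l : ev l -> par (map (switch c) l) = par l.
Proof.
move=> el; suff -> : par (map (switch c) l) = par l (+) odd (\sum_(v | c v) deg v l).
  rewrite [odd _](_ : _ = false) ?addbF //; apply/negbTE.
  by elim/big_rec: _ => // v n _ nn; rewrite oddD (negPf (el v)).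
rewrite /deg exchange_big /= /par; elim: l {el} => [|e l IH]; first by rewrite big_nil.
rewrite big_cons /= !oddD IH /hits big_split /= oddD /tint.
have H u : odd (\sum_(v | c v) (u == v)) = c u.
  have [cu|cu] := boolP (c u).
    by rewrite (bigD1 u) //= eqxx big1 // => v /andP[_ /negPf]; rewrite eq_sym => ->.
  by rewrite big1 // => v cv; case: eqP => // uv; rewrite uv cv in cu.
rewrite !H !oddb; by case: e.2; case: (c _); case: (c _); case: (odd _); case: (odd _).
Qed.

Lemma quotient_reducible X W F y : odd_flow_graph W F -> conn 4 W (edges F) ->
  X \subset W -> y \in W -> y \notin X -> cut X (edges F) = 4 ->
  (forall U, U \proper X -> U != set0 -> 6 <= cut U (edges F)) -> 1 < #|X| ->
  ~ triple (edges F) -> reducible F.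
Proof.
move=> [sF eF kF pF fF] k4 XW yW yX cX c6 X1 nt.
have X0 : X != set0 by rewrite -cards_eq0; case: #|X| X1.
have c4 U : U \subset X -> U != set0 -> 4 <= cut U (edges F).
  move=> UX /set0Pn[u uU]; apply: (k4 U u y) => //.
    exact: subsetP XW _ (subsetP UX _ uU).
  by apply: contra yX => /(subsetP UX).
have [c cc] := inner_almost_balanced XW X0 yW yX sF eF k4 pF nt cX c6.
have [x xX] := set0Pn _ X0; have xW := subsetP XW _ xX.
pose d v := (v \in X) && c v; pose G := map (switch_flow d) F.
have GE : edges G = map (switch d) (edges F).
  by rewrite /G -!map_comp; apply: eq_map => f; exact: edge_switch.
have cG : count (fun e => inside X e && e.2) (edges G) <= 1.
  rewrite GE count_map; apply: leq_trans cc; rewrite leq_eqVlt; apply/orP; left; apply/eqP.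
  apply: eq_count => e; rewrite /= /inside /=; case: (boolP (e.1.1 \in X)) => //= e1.
  by case: (boolP (e.1.2 \in X)) => //= e2; rewrite /tint /d e1 e2.
have cutG U : cut U (edges G) = cut U (edges F) by rewrite GE cut_switch.
have eG : ev (edges G) by move=> v; rewrite GE deg_switch; exact: eF.
pose g := collapse x X; pose rm f : od V := ((g f.1.1, f.1.2), (g f.2.1, f.2.2)).
pose keep f := ~~ inside X (edge_of f) || (edge_of f).2.
pose Q := map rm (filter keep G).
have QE : edges Q = quotient x X (edges G).
  by rewrite /quotient filter_map /Q -!map_comp; apply: eq_map.
have rQ : red setT (edges G) (edges Q).
  rewrite QE; apply: (@red_quotient _ x X y) => //.
  - by rewrite cutG.
  - by move=> U UX U0; rewrite cutG; exact: c4.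
  - by move=> U UX U0; rewrite cutG; exact: c6.
have gW v : v \in W -> g v \in x |: (W :\: X).
  by move=> vW; rewrite /g /collapse !inE; case: ifP => vX; rewrite ?eqxx // vX vW orbT.
exists Q, (x |: (W :\: X)); split.
- have ci : 4 <= count (inside X) (edges G).
    have := inner_cut_split (edges G) xX; rewrite !cutG cX.
    have p1 : [set x] \proper X by rewrite properEcard sub1set xX cards1.
    have p2 : X :\ x \proper X by rewrite properD1.
    have n2 : X :\ x != set0 by move: X1; rewrite (cardsD1 x) xX -cards_eq0; case: #|_|.
    have n1 : [set x] != set0 by apply/set0Pn; exists x; rewrite inE.
    have := c6 _ p1 n1; have := c6 _ p2 n2; move: (count _ _) (cut _ _) (cut _ _).
    by clear; lia.
  rewrite /Q size_map size_filter -[size F](size_map (switch_flow d)) -/G.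
  rewrite -(count_predC keep G) -addn1 leq_add2l lt0n; apply: contraTneq cG => k0.
  have /hasPn nk : ~~ has (predC keep) G by rewrite has_count k0.
  rewrite -ltnNge (@eq_in_count _ _ (inside X)); first exact: leq_trans ci.
  move=> e /mapP[f fG' ->]; have := nk f fG'; rewrite /= /keep negbK.
  by case: (inside X _) => //= ->.
- split.
  + rewrite QE /supp /quotient all_map; apply/allP => e; rewrite mem_filter => /andP[_ eG'].
    have : supp W (edges G) by rewrite GE supp_switch.
    move/allP/(_ e eG') => /andP[e1 e2]; by rewrite /inside /= !gW.
  + exact: red_ev rQ eG.
  + move=> Y a b aW bW aY bY.
    have gid v : v \in x |: (W :\: X) -> g v = v /\ v \in W.
      rewrite !inE /g /collapse => /orP[/eqP->|/andP[/negPf-> ->]] //.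
      by rewrite xX.
    have [ga aW'] := gid _ aW; have [gb bW'] := gid _ bW.
    have : 4 <= cut (g @^-1: Y) (edges F) by apply: (k4 _ a b); rewrite ?inE ?ga ?gb.
    rewrite -cutG => h; apply: leq_trans (leq_trans _ h) _ => //.
    rewrite QE /quotient cut_remap /cut count_filter leq_eqVlt; apply/orP; left; apply/eqP.
    apply: eq_count => e; rewrite /= /cross !inE /inside /g /collapse.
    by case: (boolP (e.1.1 \in X)) => e1; case: (boolP (e.1.2 \in X)) => e2; rewrite ?andbT ?addbb.
  + by rewrite (red_par rQ) GE par_switch.
  + have fG : flow G := flow_switch d fF.
    have dc v h : (dart_at v (g h.1, h.2) = \sum_(u | g u == v) dart_at u h)%R.
      rewrite /dart_at /=; have [gv|gv] := boolP (g h.1 == v).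
        rewrite (bigD1 h.1) //= eqxx big1 ?addr0 // => u /andP[_ /negPf].
        by rewrite eq_sym => ->.
      by rewrite big1 // => u gu; case: eqP => // hu; rewrite hu gu in gv.
    move=> v; rewrite /Q big_map big_filter big_mkcond /=.
    have -> : (\sum_(f <- G) (if keep f then flow_at v (rm f) else 0) =
       \sum_(f <- G) flow_at v (rm f))%R.
      apply: eq_bigr => f _; case: ifP => // /negbT.
      rewrite /keep negb_or negbK => /andP[/andP[/= f1 f2] f3].
      rewrite /flow_at /dart_at /rm /= /g /collapse f1 f2.
      case: (x == v); last by rewrite !mulr0n addr0.
      by move: f3; case: (f.1.2); case: (f.2.2); rewrite // /out_in ?subrr ?addNr.
    under eq_bigr => f _ do rewrite /flow_at /= !dc -big_split /=.
    rewrite exchange_big /= big1 // => u _; exact: fG.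
- move=> tQ; apply: (@triple_switch _ d); rewrite -GE; exact: triple_red rQ tQ.
Qed.

Lemma minimal_cut X0 W F : X0 \subset W -> X0 != set0 -> W :\: X0 != set0 ->
  ev (edges F) -> conn 4 W (edges F) -> cut X0 (edges F) = 4 ->
  exists X, [/\ X \subset X0, X != set0, cut X (edges F) = 4 &
    forall U, U \proper X -> U != set0 -> 6 <= cut U (edges F)].
Proof.
move=> XW X00 WX eF k4 cX.
pose P X := (X != set0) && (cut X (edges F) == 4).
have [|X /minsetP[/andP[Xn /eqP c] minX] XX0] := @minset_exists _ P X0.
  by rewrite /P X00 cX.
exists X; split=> // U UX Un.
have [y] := set0Pn _ WX; rewrite inE => /andP[yX yW].
have [u uU] := set0Pn _ Un; have UX' := proper_sub UX.
have c4 : 4 <= cut U (edges F).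
  apply: (k4 U u y) => //; first exact: subsetP XW _ (subsetP XX0 _ (subsetP UX' _ uU)).
  by apply: contra yX => yU; exact: subsetP XX0 _ (subsetP UX' _ yU).
have n4 : cut U (edges F) <> 4.
  by move=> cU; move: UX; rewrite (minX U) ?properxx // /P Un cU.
by have := even_cut U eF; case: (cut _ _) c4 n4 => [|[|[|[|[|[|]]]]]].
Qed.

Lemma singleton_loop x b W F : odd_flow_graph W F -> x \in W -> W :\ x != set0 ->
  conn 4 W (edges F) -> (forall d, d \in darts F -> d.2 = b d.1) ->
  cut [set x] (edges F) = 4 -> (x, x, true) \in edges F.
Proof.
move=> [sF eF kF pF fF] xW /set0Pn[y]; rewrite !inE => /andP[yx yW] k4 ub cx.
have := uniform_deg fF ub x; rewrite deg_loops cx.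
case cl: (count (loop x) (edges F)) => [//|n] _.
have : has (loop x) (edges F) by rewrite has_count cl.
case/hasP=> e /mapP[f fF' ->] /andP[/eqP /= f1 /eqP /= f2].
suff -> : (x, x, true) = edge_of f by exact: map_f.
rewrite /edge_of f1 f2; congr (_, _, _); apply/esym/eqP.
have H d : d \in [:: f.1; f.2] -> d \in darts F.
  by move=> df; apply/flattenP; exists [:: f.1; f.2] => //; apply/mapP; exists f.
by rewrite (ub f.1) ?(ub f.2) ?f1 ?f2 // H // !inE eqxx ?orbT.
Qed.

Theorem flow_triple W F : odd_flow_graph W F -> triple (edges F).
Proof.
move: {2}(size F) (leqnn (size F)) => n; elim: n W F => [|n IH] W F.
  by rewrite leqn0 size_eq0 => /eqP-> [].
move=> sn ofg; have [//|nt] := classic (triple (edges F)).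
have nred : ~ reducible F.
  case=> F' [W' [sF' ofg' t]]; apply: nt; apply: t; apply: IH ofg'.
  by rewrite -ltnS; exact: leq_trans sF' sn.
have [sF eF kF pF fF] := ofg; exfalso.
have k4 : conn 4 W (edges F).
  move=> X x y xW yW xX yX; rewrite -(cut_restrict X sF).
  set Z := X :&: W; have ZW : Z \subset W by exact: subsetIr.
  have Z0 : Z != set0 by apply/set0Pn; exists x; rewrite inE xX.
  have yZ : y \notin Z by rewrite inE (negPf yX).
  have c2 : 2 <= cut Z (edges F) by apply: (kF Z x y); rewrite // inE xX.
  have n2 : cut Z (edges F) <> 2.
    by move=> c; apply: nred; exact: two_cut_reducible ZW Z0 yW yZ ofg c.
  by have := even_cut Z eF; case: (cut _ _) c2 n2 => [|[|[|[|]]]].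
pose b v := (v, true) \in darts F.
have ub d : d \in darts F -> d.2 = b d.1.
  case: d => w [] dF; first by rewrite /b dF.
  apply/esym/negbTE/negP => wt; apply: nred; exact: splice_reducible ofg k4 wt dF.
have [/existsP[x /existsP[y /and3P[xW yW xy]]]|W1] :=
  boolP [exists x, exists y, [&& x \in W, y \in W & x != y]]; last first.
  have e1 f : f \in F -> f.1.1 = f.2.1 /\ f.1.2 = f.2.2.
    move=> fF'; have := allP sF (edge_of f); rewrite map_f // => /(_ isT) /andP[/= w1 w2].
    have f12 : f.1.1 = f.2.1.
      apply/eqP; apply: contraNT W1 => ne.
      by apply/existsP; exists f.1.1; apply/existsP; exists f.2.1; rewrite w1 w2.
    have H d : d \in [:: f.1; f.2] -> d \in darts F.
      by move=> df; apply/flattenP; exists [:: f.1; f.2] => //; apply/mapP; exists f.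
    by split=> //; rewrite (ub f.1) ?(ub f.2) ?f12 // H // !inE eqxx ?orbT.
  have cs : count snd (edges F) = size F.
    rewrite count_map -size_filter; congr size; apply/all_filterP/allP => f /e1[_ /= ->].
    exact: eqxx.
  case DF: F pF => [//|f F0] _.
  have ff : f \in F by rewrite DF mem_head.
  have f11W : f.1.1 \in W by have := allP sF (edge_of f); rewrite map_f // => /(_ isT) /andP[].
  have WE : W = [set f.1.1].
    apply/setP => v; rewrite inE; apply/idP/eqP => [vW|->//]; apply/eqP.
    apply: contraNT W1 => ne.
    by apply/existsP; exists v; apply/existsP; exists f.1.1; rewrite vW f11W.
  have dF : deg f.1.1 (edges F) = (size F).*2.
    rewrite deg_loops cut_supp -?WE // add0n; congr _.*2; rewrite -(size_map (@edge_of V)).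
    rewrite -size_filter; congr size; apply/all_filterP/allP => e /(allP sF).
    by rewrite WE /inside !inE.
  have := uniform_deg fF ub f.1.1; rewrite dF -muln2 Gauss_dvdl // => d3.
  apply: nt; exists f.1.1, (edges F); split; first exact: red_refl.
  - by rewrite -WE.
  - by rewrite cs; apply: dvdn_leq d3; rewrite DF.
have W'0 : W :\ x != set0 by apply/set0Pn; exists y; rewrite !inE eq_sym xy.
have [/existsP[X0 /and4P[XW X00 WX /eqP cX]]|n4] :=
  boolP [exists X : {set V}, [&& X \subset W, X != set0, W :\: X != set0 & cut X (edges F) == 4]];
  last first.
  have k6 : conn 6 W (edges F).
    move=> X u v uW vW uX vX; rewrite -(cut_restrict X sF); set Z := X :&: W.
    have c4 : 4 <= cut Z (edges F) by apply: (k4 Z u v); rewrite // inE ?uX ?(negPf vX).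
    have c5 : cut Z (edges F) <> 4.
      move=> c; case/existsP: n4; exists Z; rewrite c eqxx subsetIr andbT /=.
      apply/andP; split; apply/set0Pn; first by exists u; rewrite inE uX.
      by exists v; rewrite !inE (negPf vX) vW.
    by have := even_cut Z eF; case: (cut _ _) c4 c5 => [|[|[|[|[|[|]]]]]].
  have W0 : W != set0 by apply/set0Pn; exists x.
  have [c c1] := six_conn W0 sF eF k6 pF nt.
  exact: flow_balanced_but_one fF c1.
have noX X v : X \subset W -> X != set0 -> v \in W -> v \notin X -> cut X (edges F) = 4 ->
   (forall U, U \proper X -> U != set0 -> 6 <= cut U (edges F)) ->
   exists2 z, X = [set z] & (z, z, true) \in edges F.
  move=> XW' Xn vW vX cX' c6; have [X1|X1] := ltnP 1 #|X|.
    case: nred; exact: quotient_reducible ofg k4 XW' vW vX cX' c6 X1 nt.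
  have /cards1P[z Xz] : #|X| == 1 by rewrite eqn_leq X1 card_gt0.
  have zX : z \in X by rewrite Xz inE.
  have zW := subsetP XW' _ zX; exists z => //.
  apply: (singleton_loop ofg zW _ k4 ub); last by rewrite -Xz.
  by apply/set0Pn; exists v; rewrite !inE vW andbT; apply: contraNneq vX => ->.
have [X1 [X1X X1n cX1 c61]] := minimal_cut XW X00 WX eF k4 cX.
have [v] := set0Pn _ WX; rewrite inE => /andP[vX vW].
have vX1 : v \notin X1 by apply: contra vX => /(subsetP X1X).
have X1W := subset_trans X1X XW.
have [z1 X1z l1] := noX X1 v X1W X1n vW vX1 cX1 c61.
have cX' : cut (W :\: X1) (edges F) = 4.
  rewrite -cX1 -[RHS]cutC -[RHS](cut_restrict _ sF); congr (cut _ _).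
  by apply/setP => u; rewrite !inE andbC.
have X'0 : W :\: X1 != set0 by apply/set0Pn; exists v; rewrite inE vX1 vW.
have WX' : W :\: (W :\: X1) != set0.
  by have [u uX] := set0Pn _ X1n; apply/set0Pn; exists u; rewrite !inE uX (subsetP X1W).
have [X2 [X2X X2n cX2 c62]] := minimal_cut (subsetDl W X1) X'0 WX' eF k4 cX'.
have X2W := subset_trans X2X (subsetDl W X1).
have z1X1 : z1 \in X1 by rewrite X1z inE.
have z1W := subsetP X1W _ z1X1.
have z1X2 : z1 \notin X2 by apply/negP => /(subsetP X2X); rewrite inE z1X1.
have [z2 X2z l2] := noX X2 z1 X2W X2n z1W z1X2 cX2 c62.
have z2X2 : z2 \in X2 by rewrite X2z inE.
apply: nt; apply: odd_loops_distinct z1W (subsetP X2W _ z2X2) _ sF eF k4 pF l1 l2.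
by apply: contraNneq z1X2 => ->.
Qed.
End FlowTriple.

(** * Trails and subgraphs *)
Section Trails.
Variable G : signed_graph.
Notation V := (vertex G).
Notation dart := ((edge G * bool)%type).
Implicit Types (h : dart) (p q : seq dart) (x y v w : V) (e : edge G) (es : seq (edge G)).

Definition rv h : dart := (h.1, ~~ h.2).
Definition base e : ed V := (half_end (e, false), half_end (e, true), negative e).
Definition psign p : bool := odd (count (fun h => negative h.1) p).

Fixpoint walk x p y : bool :=
  if p is h :: p' then (half_end h == x) && walk (half_end (rv h)) p' y else x == y.

Lemma rvK : involutive rv. Proof. by case=> e b; rewrite /rv negbK. Qed.

Lemma walk_cat x p q y : walk x (p ++ q) y = [exists z, walk x p z && walk z q y].
Proof.
elim: p x => [|h p IH] x /=.
  by apply/idP/existsP => [w|[z /andP[/eqP->]]] //; exists x; rewrite eqxx.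
by rewrite IH; case: eqP => //= _; apply/esym/existsP => -[].
Qed.

Lemma walk_trans x p y q z : walk x p y -> walk y q z -> walk x (p ++ q) z.
Proof. by move=> w1 w2; rewrite walk_cat; apply/existsP; exists y; rewrite w1. Qed.

Definition prev p : seq dart := rev (map rv p).

Lemma walk_prev x p y : walk x p y -> walk y (prev p) x.
Proof.
elim: p x => [|h p IH] x /=; first by move/eqP->; exact: eqxx.
move=> /andP[/eqP hx /IH w]; rewrite /prev /= rev_cons -cats1.
apply: walk_trans w _; by rewrite /= eqxx rvK hx eqxx.
Qed.

Lemma psign_cat p q : psign (p ++ q) = psign p (+) psign q.
Proof. by rewrite /psign count_cat oddD. Qed.

Lemma psign_prev p : psign (prev p) = psign p.
Proof. by rewrite /psign /prev count_rev count_map. Qed.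

Lemma fst_prev p : perm_eq (map fst (prev p)) (map fst p).
Proof. by rewrite /prev map_rev perm_rev -map_comp. Qed.

Definition trail_ok (t : ed V * seq dart) : bool :=
  walk t.1.1.1 t.2 t.1.1.2 && (psign t.2 == t.1.2).

Definition labels (L : seq (ed V * seq dart)) := flatten [seq map fst t.2 | t <- L].

Lemma red_trails (S : {set V}) l m : red S l m ->
  forall L, map fst L = l -> all trail_ok L ->
  exists L', [/\ map fst L' = m, all trail_ok L' & perm_eq (labels L) (labels L')].
Proof.
elim=> {l m} [l m plm|x y s l|a w b s t l wS|m l k _ IH1 _ IH2] L Ll okL.
- move: plm; rewrite -Ll => /perm_map_lift[L' pL ->]; exists L'; split=> //.
    by rewrite -(perm_all _ pL).
  by apply: perm_flatten; exact: perm_map.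
- case: L Ll okL => [//|[e1 p] L] [E1 El] /= /andP[ok1 okL]; rewrite /= in E1; subst e1.
  exists (((y, x, s), prev p) :: L); split; rewrite /= ?El //.
    rewrite okL andbT; move: ok1; rewrite /trail_ok /= psign_prev => /andP[/walk_prev -> ->].
    by [].
  by rewrite /labels /= perm_cat2r perm_sym; exact: fst_prev.
- case: L Ll okL => [//|[e1 p] [//|[e2 q] L]] [E1 E2 El] /= /and3P[ok1 ok2 okL].
  rewrite /= in E1 E2; subst e1 e2.
  exists (((a, b, s (+) t), p ++ q) :: L); split; rewrite /= ?El //.
    rewrite okL andbT; move: ok1 ok2; rewrite /trail_ok /= psign_cat.
    by move=> /andP[w1 /eqP->] /andP[w2 /eqP->]; rewrite (walk_trans w1 w2) /=.
  by rewrite /labels /= map_cat catA.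
- have [L1 [m1 ok1 p1]] := IH1 L Ll okL; have [L2 [m2 ok2 p2]] := IH2 L1 m1 ok1.
  by exists L2; split=> //; exact: perm_trans p1 p2.
Qed.

Lemma base_trails (S : {set V}) es m : red S (map base es) m ->
  exists L, [/\ map fst L = m, all trail_ok L & perm_eq (labels L) es].
Proof.
pose L0 := [seq (base e, [:: (e, false)]) | e <- es].
have L0E : map fst L0 = map base es by rewrite /L0 -map_comp.
have okL0 : all trail_ok L0.
  rewrite /L0 all_map; apply/allP => e _; rewrite /= /trail_ok /= /rv /= !eqxx /psign /= addn0.
  by rewrite oddb eqxx.
move=> /red_trails/(_ L0 L0E okL0)[L [mL okL pL]]; exists L; split=> //.
rewrite perm_sym; apply: perm_trans pL.
by elim: es {mL okL L0E okL0} @L0 => //= e es IH; rewrite /labels /= perm_cons; exact: IH.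
Qed.

Section Subgraph.
Variable H : subgraph G.
Let l := map base (enum (eset H)).

Lemma deg_valency v : deg v l = valency H v.
Proof.
rewrite /deg /l big_map big_enum /= /valency -sum1_card.
rewrite (eq_bigl (fun h : dart => (h.1 \in eset H) && (half_end h == v))) => [|h]; last by rewrite inE.
rewrite (eq_bigr (fun e => \sum_(b | half_end (e, b) == v) 1)).
  by rewrite pair_big_dep /=; apply: eq_bigl => -[e b].
move=> e _; rewrite big_mkcond /= big_bool /= /hits /= addnC.
by case: (_ == v); case: (_ == v).
Qed.

Lemma supp_subgraph : supp (vset H) l.
Proof.
rewrite /supp /l all_map; apply/allP => e; rewrite mem_enum => eH /=.
by rewrite /inside /= !(@ends_in_vset _ H (_, _)).
Qed.

Lemma ev_subgraph : eulerian H -> ev l.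
Proof.
move=> [_ eH] v; rewrite deg_valency; have [vH|vH] := boolP (v \in vset H); first exact: eH.
rewrite /valency eq_card0 // => h; rewrite !inE; apply/negbTE; apply: contra vH => /andP[hH /eqP<-].
exact: ends_in_vset.
Qed.

Lemma cut_connect (X : {set V}) x y : connect (adjacent H) x y -> x \in X -> y \notin X -> 0 < cut X l.
Proof.
move=> /connectP[p pth ->]; elim: p x pth => [|z p IH] x /=; first by move=> _ ->.
move=> /andP[/existsP[e /andP[eH /existsP[b /andP[/eqP ex /eqP ez]]]] pth] xX lX.
have [zX|zX] := boolP (z \in X); first exact: IH pth zX lX.
rewrite -has_count; apply/hasP; exists (base e); first by rewrite /l map_f // mem_enum.
rewrite /cross /=; case: b ex ez => /= -> ->; by rewrite xX (negPf zX).
Qed.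

Lemma conn_subgraph : eulerian H -> conn 2 (vset H) l.
Proof.
move=> eH X x y xH yH xX yX; have [[_ cH] _] := eH.
have := cut_connect (cH x y xH yH) xX yX; have := even_cut X (ev_subgraph eH).
by case: (cut _ _) => [|[]].
Qed.

Lemma par_subgraph : par l = odd (num_negative H).
Proof.
rewrite /par /l count_map -size_filter /num_negative cardE; congr (odd _).
rewrite -(size_map id); apply: perm_size; rewrite map_id; apply: uniq_perm.
- exact/filter_uniq/enum_uniq.
- exact: enum_uniq.
- move=> e; rewrite mem_filter !mem_enum /= [RHS]inE; exact: andbC.
Qed.

Lemma euler_trail v : eulerian H -> v \in vset H -> eset H != set0 ->
  exists p, [/\ walk v p v, psign p = odd (num_negative H) & perm_eq (map fst p) (enum (eset H))].
Proof.
move=> eH vH E0.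
have v1 : [set v] \subset vset H by rewrite sub1set.
have v0 : [set v] != set0 by apply/set0Pn; exists v; rewrite inE.
have [m [rm sm _]] := split_all (isT : ~~ odd 2) isT supp_subgraph (ev_subgraph eH)
  (conn_subgraph eH) v1 v0.
have [L [Lm okL pL]] := base_trails rm.
have okp t : t \in L -> walk v t.2 v.
  move=> tL; have := allP okL t tL; rewrite /trail_ok => /andP[w _].
  have := allP sm t.1; rewrite -Lm map_f // => /(_ isT); rewrite /inside !inE => /andP[/eqP e1 /eqP e2].
  by rewrite -{1}e1 -e2.
pose p := flatten (map snd L).
have pp : perm_eq (map fst p) (enum (eset H)).
  by apply: perm_trans pL; rewrite /p map_flatten -map_comp.
exists p; split=> //.
- rewrite /p; elim: (L) okp => [|t L' IH] okp /=; first exact: eqxx.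
  apply: walk_trans (okp t (mem_head _ _)) (IH _) => u uL; apply: okp.
  by rewrite inE uL orbT.
- rewrite -par_subgraph /psign /par /l count_map -(permP pp) count_map.
  by congr (odd _); exact: eq_count.
Qed.
End Subgraph.
End Trails.

Section TrailSubgraph.
Variable G : signed_graph.
Notation V := (vertex G).
Notation dart := ((edge G * bool)%type).
Implicit Types (h : dart) (p q : seq dart) (x y v w : V) (e : edge G).

Lemma trail_ends x p h :
  h.1 \in [set e in map fst p] -> half_end h \in x |: [set v | has (fun k => (half_end k == v) || (half_end (rv k) == v)) p].
Proof.
rewrite inE => /mapP[k kp hk]; rewrite !inE; apply/orP; right; apply/hasP; exists k => //.
move: hk; case: h => e b; case: k {kp} => e' b' /= ->; rewrite /rv /=.
by case: b; case: b'; rewrite eqxx ?orbT.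
Qed.

Definition trail_subgraph x p : subgraph G := Subgraph (@trail_ends x p).

Lemma hits_base v h : hits v (base h.1) = (half_end h == v) + (half_end (rv h) == v).
Proof. by case: h => e [] //=; rewrite /hits /= addnC. Qed.

Lemma odd_deg_walk v x p y : walk x p y ->
  odd (deg v (map (@base G) (map fst p))) = (x == v) (+) (y == v).
Proof.
elim: p x => [|h p IH] x /=; first by move=> /eqP->; rewrite /deg big_nil addbb.
move=> /andP[/eqP hx /IH]; rewrite /deg big_cons oddD => ->; rewrite hits_base hx oddD !oddb.
by rewrite addbA -[_ (+) _ (+) (half_end (rv h) == v)]addbA addbb addbF.
Qed.

Lemma adjacent_sym (H : subgraph G) : symmetric (adjacent H).
Proof.
move=> x y; apply/existsP/existsP => -[e /andP[eH /existsP[b /andP[h1 h2]]]];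
  by exists e; rewrite eH; apply/existsP; exists (~~ b); rewrite negbK h2 h1.
Qed.

Lemma walk_connect (H : subgraph G) x p y v : walk x p y ->
  {subset map fst p <= eset H} ->
  has (fun k => (half_end k == v) || (half_end (rv k) == v)) p -> connect (adjacent H) x v.
Proof.
elim: p x => [|h p IH] x //= /andP[/eqP hx w] sp.
have hH : h.1 \in eset H by apply: sp; rewrite inE eqxx.
have adj : adjacent H x (half_end (rv h)).
  apply/existsP; exists h.1; rewrite hH; apply/existsP; exists h.2.
  by rewrite -hx /rv; case: (h) => e b /=; rewrite !eqxx.
case/orP => [/orP[/eqP<-|/eqP<-]|hv]; first by rewrite hx connect0.
  exact: connect1.
apply: connect_trans (connect1 adj) _; apply: IH w _ hv => e ep.
by apply: sp; rewrite inE ep orbT.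
Qed.

Lemma enum_trail p : uniq (map fst p) -> perm_eq (enum [set e in map fst p]) (map fst p).
Proof.
move=> u; apply: uniq_perm => //; first exact: enum_uniq.
by move=> e; rewrite mem_enum inE.
Qed.

Lemma eulerian_trail x p : walk x p x -> uniq (map fst p) -> eulerian (trail_subgraph x p).
Proof.
move=> w u; split.
  split; first by apply/set0Pn; exists x; rewrite !inE eqxx.
  have cx v : v \in vset (trail_subgraph x p) -> connect (adjacent (trail_subgraph x p)) x v.
    rewrite !inE => /orP[/eqP->|]; first exact: connect0.
    by apply: walk_connect w _ => e; rewrite inE.
  move=> a b /cx ca /cx cb; apply: connect_trans cb.
  by rewrite (sym_connect_sym (@adjacent_sym _)).
move=> v _; rewrite -deg_valency.
have /(perm_map (@base G)) pe := enum_trail u.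
by rewrite (perm_deg v pe) (odd_deg_walk v w) addbb.
Qed.

Lemma num_negative_trail x p : uniq (map fst p) ->
  odd (num_negative (trail_subgraph x p)) = psign p.
Proof.
move=> u; rewrite -par_subgraph.
have /(perm_map (@base G)) pe := enum_trail u.
rewrite (perm_par pe) /par /psign !count_map; congr (odd _); exact: eq_count.
Qed.

Lemma triple_decomposition : triple (map (@base G) (enum (edge G))) ->
  odd (num_negative (whole G)) -> odd_triple_decomposition G.
Proof.
move=> [x [m [rm sm cm]]] on.
have [L [Lm okL pL]] := base_trails rm.
pose od (t : ed V * seq dart) := t.1.2.
have cL : count od L = count snd m by rewrite -Lm count_map; exact: eq_count.
have okp t : t \in L -> walk x t.2 x /\ psign t.2 = od t.
  move=> tL; have := allP okL t tL; rewrite /trail_ok => /andP[w /eqP].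
  have := allP sm t.1; rewrite -Lm map_f // => /(_ isT); rewrite /inside !inE => /andP[/eqP e1 /eqP e2].
  by rewrite -{1}e1 -e2.
have [t1 t1L o1] : exists2 t, t \in L & od t.
  by apply/hasP; rewrite has_count cL; case: (count _ _) cm.
have p1 := perm_to_rem t1L; set L1 := rem t1 L in p1.
have c1 : 2 <= count od L1 by move: cm; rewrite -cL (permP p1) /= o1.
have [t2 t2L o2] : exists2 t, t \in L1 & od t.
  by apply/hasP; rewrite has_count; case: (count _ _) c1.
have p2 := perm_to_rem t2L; set R := rem t2 L1 in p2.
have pR : perm_eq L [:: t1, t2 & R] by apply: perm_trans p1 _; rewrite perm_cons.
have okR t : t \in R -> t \in L by move=> tR; rewrite (perm_mem pR) !inE tR !orbT.
pose p3 := flatten (map snd R).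
have w3 : walk x p3 x.
  rewrite /p3; elim: (R) okR => [|t L' IH] okR /=; first exact: eqxx.
  have [|w _] := okp t; first by apply: okR; rewrite mem_head.
  apply: walk_trans w (IH _) => u uL; apply: okR; by rewrite inE uL orbT.
have pp : perm_eq (map fst (t1.2 ++ t2.2 ++ p3)) (enum (edge G)).
  apply: perm_trans pL; rewrite perm_sym.
  apply: perm_trans (perm_flatten (perm_map _ pR)) _.
  by rewrite /= !map_cat /p3 map_flatten -map_comp.
have t2L' : t2 \in L by rewrite (perm_mem p1) inE t2L orbT.
have [w1 s1] := okp t1 t1L; have [w2 s2] := okp t2 t2L'.
have s3 : psign p3.
  have : psign (t1.2 ++ t2.2 ++ p3) = odd (num_negative (whole G)).
    rewrite -par_subgraph /par /psign !count_map.
    have -> : enum (eset (whole G)) = enum (edge G).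
      by apply: eq_enum => e; rewrite inE.
    rewrite -(permP pp) count_map; congr (odd _); exact: eq_count.
  by rewrite !psign_cat s1 s2 o1 o2 on /= negbK => ->.
have := perm_uniq pp; rewrite enum_uniq !map_cat !cat_uniq.
move=> /and3P[u1 /hasPn d1 /and3P[u2 /hasPn d2 u3]].
pose p (i : 'I_3) := nth [::] [:: t1.2; t2.2; p3] i.
have wp i : walk x (p i) x by case: i => -[|[|[]]].
have up i : uniq (map fst (p i)) by case: i => -[|[|[]]].
have sp i : psign (p i) by case: i => -[|[|[|//]]] ? /=; rewrite /p /= ?s1 ?s2 ?s3.
exists (fun i => trail_subgraph x (p i)); split.
- by move=> i; exact: eulerian_trail.
- by move=> i; rewrite num_negative_trail.
- have D (i j : 'I_3) : i < j -> [disjoint eset (trail_subgraph x (p i)) & eset (trail_subgraph x (p j))].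
    move=> ij; rewrite -setI_eq0; apply/eqP/setP => e; rewrite !inE.
    apply/negP => /andP[ei ej]; move: i j ij ei ej.
    case=> -[|[|[|//]]] ?; case=> -[|[|[|//]]] ? //= _; rewrite /p /= => ei ej.
    + by have := d1 e; rewrite mem_cat ej => /(_ isT); rewrite ei.
    + by have := d1 e; rewrite mem_cat ej orbT => /(_ isT); rewrite ei.
    + by have := d2 e ej; rewrite ei.
  move=> i j; rewrite neq_ltn => /orP[/D//|/D]; by rewrite disjoint_sym.
- apply/setP => e; rewrite inE; have : e \in enum (edge G) by rewrite mem_enum.
  rewrite -(perm_mem pp) !map_cat !mem_cat => eP; apply/bigcupP.
  case/or3P: eP => eP.
  + by exists ord0; rewrite //= inE.
  + by exists (@Ordinal 3 1 isT); rewrite //= inE.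
  + by exists (@Ordinal 3 2 isT); rewrite //= inE.
- by exists x => i; rewrite !inE eqxx.
Qed.
End TrailSubgraph.

Import Order.TTheory Num.Theory.

(** * Flows along trails *)
Section TrailFlow.
Local Open Scope ring_scope.
Variable G : signed_graph.
Notation V := (vertex G).
Notation dart := ((edge G * bool)%type).
Implicit Types (h : dart) (p q : seq dart) (x y v w : V) (e : edge G).

Definition net (o : pred dart) (xi : edge G -> int) v : int :=
  \sum_(h : dart | half_end h == v) (-1) ^+ o h * xi h.1.

Lemma is_flowP o (xi : edge G -> int) : is_flow o xi <-> forall v, net o xi v = 0.
Proof.
have E v : net o xi v = \sum_(h : dart | (half_end h == v) && ~~ o h) xi h.1
    - \sum_(h : dart | (half_end h == v) && o h) xi h.1.
  rewrite /net (bigID o) /= addrC -sumrN; congr (_ + _); apply: eq_bigr => h /andP[_].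
    by move/negbTE ->; rewrite mul1r.
  by move=> ->; rewrite mulN1r.
by split=> H v; [rewrite E | rewrite -E].
Qed.

Definition std_orientation : pred dart := fun h => h.2 && ~~ negative h.1.

Lemma std_orientationP : orientation std_orientation.
Proof. by move=> e; rewrite /std_orientation /=; case: (negative e). Qed.

Variables (x y : V) (p : seq dart) (h0 : dart).
Hypothesis wp : walk x p y.
Let m := size p.
Let H k := nth h0 p k.
Definition prefix_sign k : bool := psign (take k p).
Definition trail_vertex k : V := if (k < size p)%N then half_end (nth h0 p k) else y.
Definition trail_flow (g : nat -> int) e : int :=
  \sum_(k < size p) if (nth h0 p k).1 == e
    then (-1) ^+ (prefix_sign k (+) std_orientation (nth h0 p k)) * g k else 0.
Definition passage v k : int := (-1) ^+ prefix_sign k * (trail_vertex k == v)%:R.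

Lemma prefix_signS k : (k < m)%N -> prefix_sign k.+1 = prefix_sign k (+) negative (H k).1.
Proof.
move=> km; rewrite /prefix_sign (take_nth h0) // -cats1 psign_cat /psign /= addn0.
by rewrite oddb.
Qed.

Lemma trail_vertexS k : (k < m)%N -> trail_vertex k.+1 = half_end (rv (H k)).
Proof.
rewrite /trail_vertex /H /m; elim: p x k wp => [//|h q IH] z [|k] /= /andP[_ w] km.
  by case: q w {IH km} => [/eqP->|h' q /= /andP[/eqP->]].
by rewrite ltnS; exact: (IH _ k w).
Qed.

Lemma trail_vertex0 : trail_vertex 0 = x.
Proof. by rewrite /trail_vertex; case: p wp => [/eqP->|h q /andP[/eqP->]]. Qed.

Lemma net_trail_flow g v : net std_orientation (trail_flow g) v =
  \sum_(k < m) g k * (passage v k - passage v k.+1).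
Proof.
rewrite /net /trail_flow; under eq_bigr => h _ do rewrite mulr_sumr.
rewrite exchange_big /=; apply: eq_bigr => k _; have km := ltn_ord k.
rewrite /passage prefix_signS // trail_vertexS // [trail_vertex k]/trail_vertex km -/(H k).
set P := prefix_sign k; set d := H k.
have dr : rv d != d by apply/eqP => /(congr1 snd) /=; case: (d.2).
rewrite (eq_bigr (fun h => if (h == d) || (h == rv d) then
   (-1) ^+ std_orientation h * ((-1) ^+ (P (+) std_orientation d) * g k) else 0)); last first.
  move=> h _; have -> : (d.1 == h.1) = (h == d) || (h == rv d).
    rewrite /rv; case: h => e b; case: (d) => e' b'; rewrite !xpair_eqE /= [e' == e]eq_sym -andb_orr.
    by case: b; case: b'; rewrite ?andbT.
  by case: ifP; rewrite ?mulr0.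
rewrite big_mkcond (bigD1 d) //= (bigD1 (rv d)) //= big1 ?addr0; last first.
  by move=> h /andP[/negPf-> /negPf->]; case: ifP.
rewrite !eqxx orbT /std_orientation /rv /=.
by case: (half_end d == v); case: (half_end (d.1, ~~ d.2) == v); case: P; case: (d.2);
  case: (negative d.1); rewrite /= ?expr0 ?expr1; ring.
Qed.

Lemma net_segment v i j : (i <= j)%N -> (j <= m)%N ->
  \sum_(k < m) ((i <= k < j)%N : nat)%:R * (passage v k - passage v k.+1) =
  passage v i - passage v j.
Proof.
move=> ij jm; rewrite -opprB -(telescope_sumr (passage v) ij) -sumrN.
rewrite (eq_bigr (fun k => passage v k - passage v k.+1)); last by move=> k _; rewrite opprB.
rewrite -(big_mkord xpredT (fun k => ((i <= k < j)%N : nat)%:R * (passage v k - passage v k.+1))).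
rewrite (big_cat_nat (n := i)) ?(leq_trans ij) //= (big_cat_nat (n := j) (m := i)) //=.
rewrite big_nat_cond big1 ?add0r; last first.
  by move=> k /andP[/andP[_ ki] _]; rewrite leqNgt ki mul0r.
rewrite addrC big_nat_cond big1 ?add0r; last first.
  by move=> k /andP[/andP[jk _] _]; rewrite [(k < j)%N]ltnNge jk andbF mul0r.
rewrite big_nat_cond [RHS]big_nat_cond; apply: eq_bigr => k /andP[-> _].
by rewrite mul1r.
Qed.

Lemma trail_flow_nth g k : uniq (map fst p) -> (k < m)%N ->
  trail_flow g (H k).1 = (-1) ^+ (prefix_sign k (+) std_orientation (H k)) * g k.
Proof.
move=> u km; rewrite /trail_flow (bigD1 (Ordinal km)) //= eqxx big1 ?addr0 // => j jk.
case: eqP => // E; case/eqP: jk; apply: val_inj; apply/eqP => /=.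
rewrite -(nth_uniq h0.1 _ _ u) ?size_map // !(nth_map h0) //.
exact/eqP.
Qed.

Lemma trail_flow_out g e : e \notin map fst p -> trail_flow g e = 0.
Proof.
move=> ep; rewrite /trail_flow big1 // => k _; case: eqP => // E; case/negP: ep.
by rewrite -E map_f // mem_nth.
Qed.

Lemma norm_sign (b : bool) (a : int) : `|(-1) ^+ b * a| = `|a|.
Proof. by rewrite normrM normr_sign mul1r. Qed.

Lemma net_unit v : net std_orientation (trail_flow (fun=> 1)) v =
  (x == v)%:R - (-1) ^+ psign p * (y == v)%:R.
Proof.
rewrite net_trail_flow (eq_bigr (fun k : 'I_m => ((0 <= k < m)%N : nat)%:R *
  (passage v k - passage v k.+1))); last by move=> k _; rewrite /= ltn_ord.
rewrite net_segment // /passage trail_vertex0 /prefix_sign take0 take_size mul1r.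
by rewrite /trail_vertex ltnn.
Qed.

Lemma norm_unit e : uniq (map fst p) -> `|trail_flow (fun=> 1) e| = (e \in map fst p)%:R.
Proof.
move=> u; have [ep|ep] := boolP (e \in map fst p); last by rewrite trail_flow_out ?normr0.
have [k km <-] := nthP h0.1 ep; rewrite size_map in km.
by rewrite (nth_map h0) // trail_flow_nth // norm_sign normr1.
Qed.

End TrailFlow.

Section Arcs.
Local Open Scope nat_scope.
Variables (m : nat) (s : nat -> bool).
Implicit Types (a b : 'I_m.+1 * 'I_m.+1) (k : nat).

(* The positions covered by the arc between the visits [a.1 < a.2] of a trail with
   prefix signs [s]: the segment between them if it is even, else its complement. *)
Definition arc a k : bool := (s a.1 != s a.2) (+) (a.1 <= k < a.2).

(* Around [k], an arc through [k] is the cyclic interval from [arc_left a k] positions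
   before [k] to [arc_right a k - 1] positions after it. *)
Definition arc_right a k := if s a.1 == s a.2 then a.2 - k
  else if a.2 <= k then m + a.1 - k else a.1 - k.
Definition arc_left a k := if s a.1 == s a.2 then k - a.1
  else if a.2 <= k then k - a.2 else m + k - a.2.
Definition forward k k' := if k <= k' then k' - k else m + k' - k.
Definition backward k k' := if k' <= k then k - k' else m + k - k'.

Lemma arc_reach a k k' : a.1 < a.2 -> k < m -> k' < m -> arc a k ->
  arc a k' = (forward k k' < arc_right a k) || (backward k k' <= arc_left a k).
Proof.
rewrite /arc /arc_right /arc_left /forward /backward.
case: a => -[i im] [j jm] /=; clear -im jm.
by case: eqP => _; case: (leqP k k'); case: (leqP k' k); case: (leqP j k) => /=; lia.
Qed.

Variable valid : pred ('I_m.+1 * 'I_m.+1).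
Hypothesis valid_lt : forall a, valid a -> a.1 < a.2.

Definition arc_cover (S : {set 'I_m.+1 * 'I_m.+1}) : bool :=
  (S \subset valid) && [forall k : 'I_m, [exists a in S, arc a k]].

(* Of three arcs through [k], the third is covered by the two that reach furthest to
   the right and to the left. *)
Lemma minimal_cover_twice S : minset arc_cover S ->
  forall k : 'I_m, #|[set a in S | arc a k]| <= 2.
Proof.
move=> /minsetP[/andP[Sv cS] minS] k; rewrite leqNgt; apply/negP => big3.
set E := [set a in S | arc a k] in big3.
have [a0 a0E] : exists a, a \in E by apply/set0Pn; rewrite -card_gt0; apply: leq_trans big3.
pose a1 := [arg max_(a > a0 in E) arc_right a k].
pose a2 := [arg max_(a > a0 in E) arc_left a k].
have [a1E mx1] : a1 \in E /\ forall b, b \in E -> arc_right b k <= arc_right a1 k.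
  by rewrite /a1; case: arg_maxnP.
have [a2E mx2] : a2 \in E /\ forall b, b \in E -> arc_left b k <= arc_left a2 k.
  by rewrite /a2; case: arg_maxnP.
have [c cE c12] : exists2 c, c \in E & c \notin [set a1; a2].
  apply/subsetPn; apply: contraL big3 => /subset_leq_card cd; rewrite -leqNgt.
  by apply: leq_trans cd _; rewrite cards2; case: eqP.
have vE a : a \in E -> [/\ a \in S, a.1 < a.2 & arc a k].
  by rewrite inE => /andP[aS ->]; split=> //; apply: valid_lt; exact: (subsetP Sv).
have [cS' cl ck] := vE c cE; have [S1 l1 k1] := vE a1 a1E; have [S2 l2 k2] := vE a2 a2E.
have ne1 : c != a1 by apply: contra c12 => /eqP->; rewrite !inE eqxx.
have ne2 : c != a2 by apply: contra c12 => /eqP->; rewrite !inE eqxx orbT.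
have /minS : arc_cover (S :\ c).
  apply/andP; split; first exact: subset_trans (subsetDl _ _) Sv.
  apply/forallP => k'; have /existsP[b /andP[bS bk]] := forallP cS k'; apply/existsP.
  have [bc|bc] := eqVneq b c; last by exists b; rewrite !inE bc bS.
  move: bk; rewrite bc (arc_reach cl (ltn_ord k) (ltn_ord k') ck) => /orP[r|l].
    exists a1; rewrite !inE eq_sym ne1 S1 (arc_reach l1 (ltn_ord k) (ltn_ord k') k1).
    by rewrite (leq_trans r (mx1 _ cE)).
  exists a2; rewrite !inE eq_sym ne2 S2 (arc_reach l2 (ltn_ord k) (ltn_ord k') k2).
  by rewrite (leq_trans l (mx2 _ cE)) orbT.
by move=> /(_ (subsetDl _ _))/setP/(_ c); rewrite !inE eqxx cS'.
Qed.

Lemma minimal_cover_private S a : minset arc_cover S -> a \in S ->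
  exists2 e : 'I_m, arc a e & forall b, b \in S -> b != a -> ~~ arc b e.
Proof.
move=> /minsetP[/andP[Sv cS] minS] aS.
have : ~~ arc_cover (S :\ a).
  apply/negP => /minS/(_ (subsetDl _ _))/setP/(_ a); by rewrite !inE eqxx aS.
rewrite /arc_cover (subset_trans (subsetDl _ _) Sv) /= negb_forall => /existsP[e].
rewrite negb_exists => /forallP pe; have /existsP[b /andP[bS be]] := forallP cS e.
exists e; first by have := pe b; rewrite !inE bS be andbT /= andbT negbK => /eqP<-.
by move=> d dS da; have := pe d; rewrite !inE da dS.
Qed.
End Arcs.

Section ClosedTrail.
Local Open Scope ring_scope.
Variable G : signed_graph.
Notation V := (vertex G).
Notation dart := ((edge G * bool)%type).
Implicit Types (h : dart) (e : edge G) (w : V).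
Variables (v0 : V) (p : seq dart) (h0 : dart).
Hypotheses (wp : walk v0 p v0) (odd_p : psign p) (up : uniq (map fst p)).
Hypothesis all_p : forall e, e \in map fst p.
Let m := size p.
Local Notation s := (prefix_sign p).
Local Notation T := (trail_vertex v0 p h0).

Lemma sign_start : s 0%N = false. Proof. by rewrite /prefix_sign take0. Qed.
Lemma sign_end : s m. Proof. by rewrite /prefix_sign take_size. Qed.
Lemma trail_closed : T m = T 0%N.
Proof. by rewrite (trail_vertex0 h0 wp) /trail_vertex ltnn. Qed.

Definition chord (a : 'I_m.+1 * 'I_m.+1) : bool := (a.1 < a.2)%N && (T a.1 == T a.2).

Definition arc_flow (a : 'I_m.+1 * 'I_m.+1) (k : nat) : int :=
  if s a.1 == s a.2 then ((a.1 <= k < a.2)%N : nat)%:R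
  else ((a.2 <= k < m)%N : nat)%:R - ((0 <= k < a.1)%N : nat)%:R.

Lemma net_arc a w : chord a ->
  \sum_(k < m) arc_flow a k * (passage v0 p h0 w k - passage v0 p h0 w k.+1) = 0.
Proof.
case: a => i j /andP[/= ij /eqP Tij]; have jm : (j <= m)%N by rewrite -ltnS.
rewrite /arc_flow /=; case: eqP => [sij|/eqP sij].
  by rewrite (net_segment v0 h0) // 1?ltnW // /passage sij Tij subrr.
under eq_bigr => k _ do rewrite mulrBl.
have := net_segment v0 h0 w (leq0n i) (leq_trans (ltnW ij) jm) => /= Ei.
rewrite sumrB (net_segment v0 h0) // Ei /passage trail_closed sign_start sign_end Tij.
by case: (s i) sij; case: (s j) => // _; rewrite ?expr0 ?expr1; ring.
Qed.

Lemma net_combination (g : nat -> int) w :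
  (forall w, \sum_(k < m) g k * (passage v0 p h0 w k - passage v0 p h0 w k.+1) = 0) ->
  net (@std_orientation G) (trail_flow p h0 g) w = 0.
Proof. by move=> /(_ w); rewrite (net_trail_flow h0 wp). Qed.

Lemma covered_flow (S : {set 'I_m.+1 * 'I_m.+1}) : minset (arc_cover s chord) S ->
  has_nz_kflow G 4.
Proof.
move=> minS; have /andP[/subsetP Sv /forallP cS] := minsetp minS.
have m0 : (0 < m)%N by rewrite /m; case: (p) odd_p.
have /existsP[a /andP[aS _]] := cS (Ordinal m0).
have [e ae pe] := minimal_cover_private minS aS.
pose tau k : int := if (k < e)%N then -1 else 1.
pose g k : int := arc_flow a k *+ 2 + \sum_(b in S :\ a) (arc s b k : nat)%:R * tau k.
have vlt b : chord b -> (b.1 < b.2)%N by case/andP.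
have oriented b : b \in S -> b != a -> exists t : int, forall k : 'I_m,
    (arc s b k : nat)%:R * tau k = t * arc_flow b k.
  move=> bS ba; have := pe b bS ba; have := vlt b (Sv b bS).
  case: b {bS ba} => -[i im] [j jm] /=; rewrite /arc /arc_flow /tau /=; clear -im jm.
  case: eqP => _ /= ij; rewrite ?negbK => ne.
    exists (if (j <= e)%N then -1 else 1) => -[k km] /=.
    case: (leqP i k); case: (ltnP k j); case: (ltnP k e); case: (leqP j e); rewrite /= ?mulr0 ?mul0r ?mulr1 ?mul1r // => *; lia.
  exists 1 => -[k km] /=; rewrite km andbT.
  by case: (leqP i k); case: (ltnP k j); case: (ltnP k e); rewrite /= => *; try lia.
have gnet w : \sum_(k < m) g k * (passage v0 p h0 w k - passage v0 p h0 w k.+1) = 0.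
  under eq_bigr => k _ do rewrite mulrDl mulr_suml mulrnAl.
  rewrite big_split /= sumrMnl net_arc ?mul0rn ?add0r; last exact: Sv.
  rewrite exchange_big big1 // => b; rewrite !inE => /andP[ba bS].
  have [t tb] := oriented b bS ba.
  under eq_bigr => k _ do rewrite tb -mulrA.
  by rewrite -mulr_sumr net_arc ?mulr0 //; exact: Sv.
exists (@std_orientation G), (trail_flow p h0 g); split.
- exact: std_orientationP.
- by apply/is_flowP => w; apply: net_combination.
move=> d; have [k km <-] := nthP h0.1 (all_p d); rewrite size_map in km.
rewrite (nth_map h0) // trail_flow_nth // norm_sign /g -mulr_suml -natr_sum.
have := minimal_cover_twice vlt minS (Ordinal km).
have /existsP[b0 /andP[b0S b0k]] := cS (Ordinal km).
have c0 : (0 < #|[set b in S | arc s b (Ordinal km)]|)%N.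
  by apply/card_gt0P; exists b0; rewrite inE b0S.
move: c0; rewrite (cardsD1 a) inE aS /=.
have -> : (\sum_(b in S :\ a) arc s b k)%N = #|[set b in S | arc s b k] :\ a|.
  rewrite -sum1_card big_mkcond [RHS]big_mkcond; apply: eq_bigr => b _.
  by rewrite !inE; case: (_ != _); case: (_ \in _); case: (arc _ _ _).
move: (#|_|) => n; have : `|arc_flow a k| = (arc s a k : nat)%:R.
  have := vlt a (Sv a aS); case: (a) => -[i im] [j jm] /=; rewrite /arc /arc_flow /= km andbT; clear.
  by case: eqP => _; case: (leqP i k); case: (ltnP k j) => //= *; lia.
rewrite /tau; case: (arc s a k); case: ifP => _ /=; clear; lia.
Qed.

Lemma uncovered_potential (k : 'I_m) : (forall a, chord a -> ~~ arc s a k) ->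
  exists c : V -> bool, forall e, tint c (base e) = (e == (nth h0 p k).1).
Proof.
move=> unc.
have agree (i j : nat) : (i < j)%N -> (j <= m)%N -> T i = T j ->
    s i (+) (i <= k)%N = s j (+) (j <= k)%N.
  move=> ij jm Tij; have im : (i < m.+1)%N by rewrite ltnS (leq_trans (ltnW ij)).
  have := unc (Ordinal im, Ordinal (jm : (j < m.+1)%N)); rewrite /chord /arc /= ij Tij eqxx.
  move=> /(_ isT); rewrite [(k < j)%N]ltnNge; case: (leqP j k) => [jk|kj].
    by rewrite (leq_trans (ltnW ij) jk); case: (s i); case: (s j).
  by case: (s i); case: (s j); case: (i <= k)%N.
have agree2 (i j : nat) : (i <= m)%N -> (j <= m)%N -> T i = T j ->
    s i (+) (i <= k)%N = s j (+) (j <= k)%N.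
  move=> im jm Tij; case: (ltngtP i j) => [ij|ji|-> //]; first exact: agree.
  by apply/esym/agree.
pose c w := [exists i : 'I_m.+1, (T i == w) && (s i (+) (i <= k)%N)].
have cT (i : nat) : (i <= m)%N -> c (T i) = s i (+) (i <= k)%N.
  move=> im; apply/existsP/idP => [[j /andP[/eqP Tj sj]]|si].
    by rewrite -(agree2 j i) // -ltnS.
  by exists (Ordinal (im : (i < m.+1)%N)); rewrite /= eqxx.
exists c => e; have [i im <-] := nthP h0.1 (all_p e); rewrite size_map in im.
rewrite (nth_map h0) //; set h := nth h0 p i.
have -> : (h.1 == (nth h0 p k).1) = (i == k).
  by rewrite -(nth_uniq h0.1 _ _ up) ?size_map // !(nth_map h0).
have -> : tint c (base h.1) = negative h.1 (+) c (T i) (+) c (T i.+1).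
  rewrite (trail_vertexS h0 wp) // /trail_vertex im -/h /tint /rv; case: (h) => e' [] //=.
  by rewrite addbAC.
rewrite !cT ?(ltnW im) // (prefix_signS h0) // -/h.
rewrite eqn_leq; case: (leqP i k) => ik /=.
  by rewrite [(i < k)%N]ltnNge; case: (s i); case: (negative _); case: (k <= i)%N.
by rewrite ltnNge (ltnW ik) /=; case: (s i); case: (negative _).
Qed.

Lemma four_flow_or_potential : has_nz_kflow G 4 \/
  exists (c : V -> bool) (e0 : edge G), forall e, tint c (base e) = (e == e0).
Proof.
have [cov|] := boolP (arc_cover s chord [set a | chord a]).
  by left; have [S minS _] := minset_exists cov; exact: covered_flow minS.
rewrite /arc_cover; have -> /= : [set a | chord a] \subset chord.
  by apply/subsetP => a; rewrite inE.
rewrite negb_forall => /existsP[k]; rewrite negb_exists => /forallP unc; right.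
have [a ch|c cE] := @uncovered_potential k.
  by have := unc a; rewrite inE ch.
by exists c, (nth h0 p k).1.
Qed.
End ClosedTrail.

Section SmallFlows.
Local Open Scope ring_scope.
Variable G : signed_graph.
Notation V := (vertex G).
Notation dart := ((edge G * bool)%type).
Implicit Types (h : dart) (e : edge G) (w x y v : V) (p : seq dart) (H : subgraph G).

Lemma weighted_net o (xi : edge G -> int) (c : V -> bool) : orientation o ->
  \sum_w (-1) ^+ c w * net o xi w =
  \sum_(e | tint c (base e)) (-1) ^+ (c (half_end (e, false)) (+) o (e, false)) * xi e *+ 2.
Proof.
move=> oo; rewrite /net; under eq_bigr => w _ do rewrite mulr_sumr.
rewrite (exchange_big_dep xpredT) //=.
rewrite (eq_bigr (fun h => (-1) ^+ (c (half_end (h.1, h.2)) (+) o (h.1, h.2)) * xi h.1));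
  last first.
  by move=> [e b] _; rewrite (big_pred1 (half_end (e, b))) ?signr_addb ?mulrA // => w; rewrite eq_sym.
rewrite -(pair_bigA _ (fun e b => (-1) ^+ (c (half_end (e, b)) (+) o (e, b)) * xi e)) /=.
rewrite [RHS]big_mkcond; apply: eq_bigr => e _; rewrite big_bool /= addrC -mulrDl.
have := oo e; rewrite /tint /base /=.
by case: (c _); case: (c _); case: (o _); case: (o _); case: (negative e) => //= _;
  rewrite ?mulN1r ?mul1r ?mulr2n ?subrr ?addNr ?mul0r // mulrDl ?mulN1r ?mul1r.
Qed.

Lemma tight_no_flow (c : V -> bool) e0 : (forall e, tint c (base e) = (e == e0)) ->
  ~ has_nz_flow G int.
Proof.
move=> ce [o [xi [oo /is_flowP fl nz]]]; have := weighted_net xi c oo.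
rewrite big1 => [|w _]; last by rewrite fl mulr0.
rewrite (big_pred1 e0) => [|e]; last exact: ce.
move/eqP; rewrite eq_sym -mulrnAr mulf_eq0 signr_eq0 mulrn_eq0 /=; exact/negP.
Qed.

Lemma two_flow_even : has_nz_kflow G 2 -> ~~ odd (num_negative (whole G)).
Proof.
move=> [o [xi [oo /is_flowP fl nz]]]; have := weighted_net xi (fun=> false) oo.
rewrite big1 => [|w _]; last by rewrite fl mulr0.
rewrite sumrMnl => /eqP; rewrite eq_sym mulrn_eq0 /= => /eqP.
rewrite (eq_bigr (fun e => 1 - ((-1) ^+ o (e, false) * xi e == -1 : nat)%:R *+ 2)) => [|e _]; last first.
  have : `|(-1) ^+ o (e, false) * xi e| = 1.
    by rewrite norm_sign; have := nz e; lia.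
  by case: eqP; lia.
rewrite sumrB !sumrMnl -natr_sum sumr_const.
set n := #|_|; set k := (\sum_(i | _) _)%N.
have -> : n = num_negative (whole G).
  by apply: eq_card => e; rewrite !inE /in_mem /= /tint /base /= !addbF.
move: (num_negative _) k => a b; clear; lia.
Qed.

Lemma even_two_flow : eulerian (whole G) -> ~~ odd (num_negative (whole G)) -> has_nz_kflow G 2.
Proof.
move=> eG en; have [E0|E0] := eqVneq (eset (whole G)) set0.
  exists (@std_orientation G), (fun=> 0); split; first exact: std_orientationP.
    by apply/is_flowP => v; rewrite /net big1 // => h _; rewrite mulr0.
  by move=> e; have := in_set0 e; rewrite -E0 inE.
have [v _] := set0Pn _ eG.1.1; have [p [wp sp pp]] := euler_trail eG (in_setT v) E0.
case: p => [|h0 p'] in wp sp pp *.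
  by case/negP: E0; apply/eqP/setP => e; rewrite in_set0 -mem_enum -(perm_mem pp).
exists (@std_orientation G), (trail_flow (h0 :: p') h0 (fun=> 1)); split.
- exact: std_orientationP.
- by apply/is_flowP => w; rewrite (net_unit h0 wp) sp (negPf en) mul1r subrr.
- move=> e; rewrite norm_unit; last by rewrite (perm_uniq pp) enum_uniq.
  by rewrite (perm_mem pp) mem_enum inE.
Qed.

Lemma netD o (xi zt : edge G -> int) v : net o (fun e => xi e + zt e) v = net o xi v + net o zt v.
Proof. by rewrite /net -big_split; apply: eq_bigr => h _; rewrite mulrDr. Qed.

Lemma netZ o a (xi : edge G -> int) v : net o (fun e => a * xi e) v = a * net o xi v.
Proof. by rewrite /net mulr_sumr; apply: eq_bigr => h _; rewrite mulrCA. Qed.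

Lemma odd_unit_source H v : eulerian H -> v \in vset H -> odd (num_negative H) ->
  exists xi : edge G -> int, (forall w, net (@std_orientation G) xi w = (v == w)%:R *+ 2) /\
    (forall e, `|xi e| = (e \in eset H)%:R).
Proof.
move=> eH vH oH; have E0 : eset H != set0.
  apply: contraTneq oH => E0; rewrite /num_negative eq_card0 // => e.
  by rewrite inE E0 in_set0.
have [p [wp sp pp]] := euler_trail eH vH E0.
case: p => [|h0 p'] in wp sp pp *; first by rewrite -sp in oH.
exists (trail_flow (h0 :: p') h0 (fun=> 1)); split.
- by move=> w; rewrite (net_unit h0 wp) sp oH mulN1r opprK mulr2n.
- move=> e; rewrite norm_unit; last by rewrite (perm_uniq pp) enum_uniq.
  by rewrite (perm_mem pp) mem_enum.
Qed.

Lemma decomposition_flow : odd_triple_decomposition G -> has_nz_kflow G 3.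
Proof.
move=> [H [eH oH dH cH [v vH]]].
have [x0 [n0 a0]] := odd_unit_source (eH 0) (vH 0) (oH 0).
have [x1 [n1 a1]] := odd_unit_source (eH 1) (vH 1) (oH 1).
have [x2 [n2 a2]] := odd_unit_source (eH 2%:R) (vH 2%:R) (oH 2%:R).
exists (@std_orientation G), (fun e => (x0 e + x1 e) + -2 * x2 e); split.
- exact: std_orientationP.
- by apply/is_flowP => w; rewrite !netD netZ n0 n1 n2; case: (v == w).
- move=> e; have := a0 e; have := a1 e; have := a2 e.
  have : [|| e \in eset (H 0), e \in eset (H 1) | e \in eset (H 2%:R)].
    have : e \in \bigcup_(i < 3) eset (H i) by rewrite cH.
    case/bigcupP => -[[|[|[|//]]] i3] _ ei; apply/or3P;
      [apply: Or31 | apply: Or32 | apply: Or33]; move: ei; congr (e \in eset (H _)); exact: val_inj.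
  have : ~~ ((e \in eset (H 0)) && (e \in eset (H 1))).
    by apply/negP => /andP[h0 h1]; rewrite (disjointFr (dH 0 1 isT) h0) in h1.
  have : ~~ ((e \in eset (H 0)) && (e \in eset (H 2%:R))).
    by apply/negP => /andP[h0 h1]; rewrite (disjointFr (dH 0 2%:R isT) h0) in h1.
  have : ~~ ((e \in eset (H 1)) && (e \in eset (H 2%:R))).
    by apply/negP => /andP[h0 h1]; rewrite (disjointFr (dH 1 2%:R isT) h0) in h1.
  case: (e \in eset (H 0)); case: (e \in eset (H 1)); case: (e \in eset (H 2%:R)) => //=;
    clear; lia.
Qed.
End SmallFlows.

Lemma not_uniq_map (T : eqType) (U : eqType) (f : T -> U) (p : seq T) : ~~ uniq (map f p) ->
  exists p1 h p2 k p3, p = p1 ++ h :: p2 ++ k :: p3 /\ f h = f k.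
Proof.
elim: p => //= h p IH; rewrite negb_and negbK; case/orP => [/mapP[k kp hk]|/IH].
  by case/splitPr: kp => p2 p3; exists [::], h, p2, k, p3.
by move=> [p1 [k [p2 [k' [p3 [-> e]]]]]]; exists (h :: p1), k, p2, k', p3.
Qed.

(** * Balance and switching *)
Section Harary.
Variable G : signed_graph.
Notation V := (vertex G).
Notation dart := ((edge G * bool)%type).
Implicit Types (h : dart) (e : edge G) (w x y v : V) (p : seq dart) (H C : subgraph G).

Lemma odd_tint (c : V -> bool) l : ev l -> odd (count (tint c) l) = par l.
Proof.
move=> el; have := even_cut [set v | c v] el; rewrite /cut /par.
have -> : odd (count (tint c) l) = odd (count snd l) (+) odd (count (cross [set v | c v]) l).
  elim: l {el} => //= e l IH; rewrite !oddD IH !oddb /tint /cross !inE.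
  by case: e.2; case: (c _); case: (c _); do 2!case: (odd _).
by move/negbTE ->; rewrite addbF.
Qed.

Lemma sign_num_negative H : sign H = ((-1) ^+ odd (num_negative H))%R.
Proof.
rewrite /sign prodrXr signr_odd; congr ((-1) ^+ _)%R.
rewrite /num_negative -sum1_card big_mkcond [RHS]big_mkcond; apply: eq_bigr => e _.
by rewrite inE; case: (_ \in _); case: (negative e).
Qed.

Lemma potential_balanced H (c : V -> bool) :
  (forall e, e \in eset H -> ~~ tint c (base e)) -> balanced H.
Proof.
move=> ce C /andP[_ /subsetP CH] [_ vC]; rewrite sign_num_negative -par_subgraph.
rewrite -(odd_tint c); last first.
  move=> v; rewrite deg_valency; have [vH|vH] := boolP (v \in vset C); first by rewrite vC.
  rewrite /valency eq_card0 // => h; rewrite !inE; apply/negbTE; apply: contra vH => /andP[hH /eqP<-].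
  exact: ends_in_vset.
suff -> : count (tint c) (map (@base G) (enum (eset C))) = 0 by [].
apply/eqP; rewrite -leqn0 leqNgt -has_count has_map; apply/hasPn => e.
by rewrite mem_enum => /CH/ce.
Qed.

Lemma walk_ends x p y : walk x p y ->
  rcons (map half_end p) y = x :: map (fun h => half_end (rv h)) p.
Proof. by elim: p x => [|h p IH] x /=; [move=> /eqP-> | move=> /andP[/eqP-> /IH->]]. Qed.

Lemma trail_circuit x p : walk x p x -> uniq (map half_end p) -> uniq (map fst p) -> psign p ->
  circuit (trail_subgraph x p).
Proof.
move=> w uv ue sp; have [cc _] := eulerian_trail w ue; split=> // v vp.
rewrite -deg_valency; have /(perm_map (@base G)) pe := enum_trail ue.
rewrite (perm_deg v pe) /deg !big_map.
under eq_bigr => h _ do rewrite hits_base.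
have pE : perm_eq (map half_end p) (map (fun h => half_end (rv h)) p).
  have := walk_ends w; move: (map _ p) (map _ p) => s t E.
  by rewrite -(perm_cons x) -E perm_sym perm_rcons.
have mem : v \in map half_end p.
  move: vp; rewrite !inE => /orP[/eqP->|/hasP[h hp /orP[/eqP<-|/eqP<-]]].
  - by case: (p) w sp => // h q /= /andP[/eqP<- _] _; rewrite mem_head.
  - exact: map_f.
  - by rewrite (perm_mem pE); apply/mapP; exists h.
have cE (f : dart -> V) : \sum_(h <- p) (f h == v) = count_mem v (map f p).
  by rewrite count_map -sum1_count [RHS]big_mkcond; apply: eq_bigr => h _; rewrite /=; case: (_ == _).
by rewrite big_split /= !cE -(permP pE) count_uniq_mem // mem.
Qed.

Lemma psign_closed_circuit H x p : walk x p x -> psign p -> {subset map fst p <= eset H} ->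
  vset H = setT -> ~ balanced H.
Proof.
move=> w sp pH VH; have [n] := ubnP (size p).
elim: n x p w sp pH => // n IH x p w sp pH /ltnSE sn balH.
have [uv|/not_uniq_map[p1 [h [p2 [k [p3 [pE hk]]]]]]] := boolP (uniq (map half_end p)); last first.
  move: w sp pH sn; rewrite pE walk_cat => /existsP[z /andP[w1 /= /andP[/eqP hz]]].
  rewrite walk_cat => /existsP[u /andP[w2 /= /andP[/eqP ku w3]]] sp pH sn.
  have wA : walk z (h :: p2) z by rewrite /= hz eqxx -hz hk ku.
  have wB : walk x (p1 ++ k :: p3) x.
    by apply: walk_trans w1 _; rewrite /= -hk hz eqxx.
  have : psign (h :: p2) || psign (p1 ++ k :: p3).
    move: sp; rewrite -cat_cons !psign_cat.
    by case: (psign p1); case: (psign (h :: p2)); case: (psign (k :: p3)).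
  case/orP => sq.
    apply: (IH _ _ wA sq _ _ balH).
      move=> e eq; apply: pH; move: eq; rewrite -cat_cons !map_cat !mem_cat => ->; by rewrite orbT.
    by move: sn; rewrite -cat_cons !size_cat /=; clear; lia.
  apply: (IH _ _ wB sq _ _ balH).
    move=> e eq; apply: pH; move: eq; rewrite -cat_cons !map_cat !mem_cat.
    by case/orP => ->; rewrite ?orbT.
  by move: sn; rewrite -cat_cons !size_cat /=; clear; lia.
have [ue|/not_uniq_map[p1 [h [p2 [k [p3 [pE hk]]]]]]] := boolP (uniq (map fst p)); last first.
  move: w sp pH sn uv; rewrite pE walk_cat => /existsP[z /andP[w1 /= /andP[/eqP hz]]].
  rewrite walk_cat => /existsP[u /andP[w2 /= /andP[/eqP ku w3]]] sp pH sn.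
  rewrite map_cat cat_uniq => /and3P[_ _] /= /andP[hn].
  have khr : k = rv h.
    have : k != h by apply: contraNneq hn => kh; rewrite map_cat mem_cat kh /= mem_head orbT.
    move: hk; case: (k) => e b; case: (h) => e' b' /= <-; rewrite xpair_eqE eqxx /= => bb.
    by rewrite /rv /=; congr (_, _); case: b b' bb => -[].
  case: p2 w2 sp pH sn {hn pE} => [|g p2] w2 sp pH sn; last first.
    move: w2 => /= /andP[/eqP gh _] /andP[/negP gn _]; apply: gn.
    by rewrite gh map_cat mem_cat /= khr mem_head orbT.
  move=> _; have hz' : half_end (rv k) = z by rewrite khr rvK.
  apply: (IH x (p1 ++ p3) _ _ _ _ balH).
  - by apply: walk_trans w1 _; rewrite -hz'.
  - move: sp; rewrite !psign_cat /= /psign /= khr /= !oddD.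
    by case: (negative _); case: (odd (count _ p1)); case: (odd (count _ p3)).
  - move=> e eq; apply: pH; move: eq; rewrite !map_cat !mem_cat /= !inE.
    by case/orP => ->; rewrite ?orbT.
  - by move: sn; rewrite !size_cat /=; clear; lia.
have : sign (trail_subgraph x p) = 1%R.
  apply: balH; last exact: trail_circuit.
  rewrite /sub_of VH subsetT /=; apply/subsetP => e; rewrite inE; exact: pH.
by rewrite sign_num_negative num_negative_trail // sp.
Qed.

Lemma connect_walk H x y : connect (adjacent H) x y ->
  exists p, walk x p y && all (mem (eset H)) (map fst p).
Proof.
move=> /connectP[s pth ->]; elim: s x pth => [|z s IH] x /=; first by exists [::]; rewrite /= eqxx.
move=> /andP[/existsP[e /andP[eH /existsP[b /andP[ex ez]]]] /IH[p /andP[w a]]].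
by exists ((e, b) :: p); rewrite /= ex /rv /= (eqP ez) w eH a.
Qed.

Lemma balanced_potential H : vset H = setT -> balanced H ->
  exists c : V -> bool, forall e, e \in eset H -> ~~ tint c (base e).
Proof.
move=> VH bH; have sy : connect_sym (adjacent H) := sym_connect_sym (@adjacent_sym _ H).
have exw w : exists p, walk (fingraph.root (adjacent H) w) p w && all (mem (eset H)) (map fst p).
  by apply: connect_walk; rewrite sy connect_root.
pose P w := xchoose (exw w); pose c w := psign (P w); exists c => e eH.
have [/andP[w1 /allP a1]] := (xchooseP (exw (half_end (e, false))), isT); rewrite -/(P _) in w1 a1.
have [/andP[w2 /allP a2]] := (xchooseP (exw (half_end (e, true))), isT); rewrite -/(P _) in w2 a2.
have rr : fingraph.root (adjacent H) (half_end (e, true)) = fingraph.root (adjacent H) (half_end (e, false)).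
  apply/eqP; rewrite root_connect //; apply: connect1; apply/existsP; exists e; rewrite eH.
  by apply/existsP; exists true; rewrite !eqxx.
set x := half_end (e, false) in w1 a1 rr *; set y := half_end (e, true) in w2 a2 rr *.
have [te|//] := boolP (tint c (base e)); exfalso.
have w : walk (fingraph.root (adjacent H) x) (P x ++ (e, false) :: prev (P y)) (fingraph.root (adjacent H) x).
  apply: walk_trans w1 _; rewrite /= eqxx /rv /= -[X in walk _ _ X]rr; exact: walk_prev.
apply: (psign_closed_circuit w _ _ VH bH).
  move: te; rewrite -cat1s !psign_cat psign_prev /tint /base /= -/x -/y /c /psign /= addn0.
  by rewrite oddb addbCA addbA.
move=> f; rewrite map_cat mem_cat /= inE (perm_mem (fst_prev _)) => /or3P[/a1|/eqP->|/a2] //.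
Qed.
End Harary.

Section FlowNumber.
Local Open Scope ring_scope.
Variable G : signed_graph.
Hypothesis eG : eulerian (whole G).
Notation V := (vertex G).
Notation dart := ((edge G * bool)%type).
Implicit Types (h : dart) (e : edge G) (w x y v : V) (p : seq dart) (H : subgraph G).

Lemma three_flow_decomposition : has_nz_kflow G 3 -> odd (num_negative (whole G)) ->
  odd_triple_decomposition G.
Proof.
move=> [o [xi [oo /is_flowP fl nz]]] on; apply: triple_decomposition => //.
pose d h := ~~ o h (+) ((xi h.1 == 2) || (xi h.1 == -1)).
pose F := [seq ((half_end (e, false), d (e, false)), (half_end (e, true), d (e, true)))
  | e <- enum (edge G)].
have dE h : out_in (d h) = ((-1) ^+ o h * xi h.1)%:~R.
  have : [|| xi h.1 == 1, xi h.1 == 2, xi h.1 == -1 | xi h.1 == -2] by have := nz h.1; clear; lia.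
  rewrite /d; case/or4P => /eqP ->; case: (o h) => /=; exact/eqP.
have eF : map (@edge_of V) F = map (@base G) (enum (edge G)).
  rewrite /F -map_comp; apply: eq_map => e; rewrite /edge_of /base /= /d; congr (_, _, _).
  rewrite -(oo e); by case: (o _); case: (o _); case: (_ || _).
have EG : enum (edge G) = enum (eset (whole G)) by apply/esym/eq_enum => e; rewrite inE.
have ET : [set: V] = vset (whole G) by [].
rewrite -eF; apply: (@flow_triple _ setT); split; rewrite ?eF ?EG ?ET.
- exact: supp_subgraph.
- exact: ev_subgraph.
- exact: conn_subgraph.
- by rewrite par_subgraph.
move=> v; rewrite /F big_map big_enum /=.
transitivity ((net o xi v)%:~R : 'F_3); last by rewrite fl.
rewrite /net rmorph_sum /= [RHS]big_mkcond /=.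
rewrite (eq_bigr (fun h => dart_at v (half_end (h.1, h.2), d (h.1, h.2)))); last first.
  by move=> [e b] _; rewrite /dart_at /= dE; case: eqP.
rewrite -(pair_bigA _ (fun e b => dart_at v (half_end (e, b), d (e, b)))) /=.
by apply: eq_bigr => e _; rewrite big_bool /= addrC.
Qed.

Lemma odd_decomposition : odd_triple_decomposition G -> odd (num_negative (whole G)).
Proof.
move=> [H [_ oH dH cH _]].
have -> : num_negative (whole G) = (\sum_(i < 3) num_negative (H i))%N.
  rewrite /num_negative -sum1_card; under [RHS]eq_bigr => i _ do rewrite -sum1_card big_mkcond.
  rewrite [RHS]exchange_big [LHS]big_mkcond; apply: eq_bigr => e _ /=.
  have : e \in \bigcup_(i < 3) eset (H i) by rewrite cH.
  move=> /bigcupP[i _ ei]; rewrite (bigD1 i) //= big1 ?addn0 => [|j ji]; first by rewrite !inE ei.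
  by rewrite inE (disjointFl (dH j i ji) ei).
by rewrite !big_ord_recl big_ord0 !oddD !oH.
Qed.

Lemma kflow_nz_flow k : has_nz_kflow G k -> has_nz_flow G int.
Proof.
move=> [o [xi [oo fl nz]]]; exists o, xi; split=> // e; have := nz e; case/andP.
by rewrite normr_gt0.
Qed.

Lemma kflow_le j k : (j <= k)%N -> has_nz_kflow G j -> has_nz_kflow G k.
Proof.
move=> jk [o [xi [oo fl nz]]]; exists o, xi; split=> // e; have := nz e; clear -jk; lia.
Qed.

Lemma odd_four_flow_or_potential : odd (num_negative (whole G)) -> has_nz_kflow G 4 \/
  exists (c : V -> bool) (e0 : edge G), forall e, tint c (base e) = (e == e0).
Proof.
move=> on; have E0 : eset (whole G) != set0.
  apply: contraTneq on => E0; rewrite /num_negative eq_card0 // => e.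
  by rewrite inE E0 in_set0.
have [v _] := set0Pn _ eG.1.1; have [p [wp sp pp]] := euler_trail eG (in_setT v) E0.
rewrite on in sp; case: p => // h0 p' in wp sp pp *.
apply: (four_flow_or_potential h0 wp sp).
- by rewrite (perm_uniq pp) enum_uniq.
- by move=> e; rewrite (perm_mem pp) mem_enum inE.
Qed.

Lemma whole_unbalanced : odd (num_negative (whole G)) -> ~ balanced (whole G).
Proof.
move=> on bG; have [c cE] := balanced_potential (H := whole G) erefl bG.
have := odd_tint c (ev_subgraph eG); rewrite par_subgraph on.
suff -> : count (tint c) (map (@base G) (enum (eset (whole G)))) = 0%N by [].
apply/eqP; rewrite -leqn0 leqNgt -has_count has_map; apply/hasPn => e _; apply: cE.
by rewrite inE.
Qed.
End FlowNumber.

Theorem mainTheorem1 (G : signed_graph) (hG : eulerian (whole G)) :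
  (~ has_nz_flow G int <->
     ~ balanced (whole G) /\ exists e : edge G, balanced (del_edge e))
  /\ (flow_number G 2 <-> ~~ odd (num_negative (whole G)))
  /\ (flow_number G 3 <-> odd_triple_decomposition G)
  /\ (has_nz_flow G int -> odd (num_negative (whole G)) ->
      ~ odd_triple_decomposition G -> flow_number G 4).
Proof.
have odd_no2 : odd (num_negative (whole G)) -> ~ has_nz_kflow G 2.
  by move=> on /two_flow_even; rewrite on.
have even2 := even_two_flow hG.
split; [split|split; [split|split; [split|]]].
- move=> nf; have on : odd (num_negative (whole G)).
    by apply/negPn/negP => /even2/kflow_nz_flow.
  split; first exact: whole_unbalanced.
  have [/kflow_nz_flow//|[c [e0 ce]]] := odd_four_flow_or_potential hG on.
  exists e0; apply: (potential_balanced (c := c)) => e; rewrite !inE => ee.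
  by rewrite ce.
- move=> [nb [e0 be0]]; have [c ce] := balanced_potential (H := del_edge e0) erefl be0.
  have ce' e : e != e0 -> tint c (base e) = false.
    by move=> ee; apply/negbTE/ce; rewrite !inE.
  apply: (@tight_no_flow G c e0) => e; have [->|/ce'//] := eqVneq e e0.
  apply/negPn/negP => te; apply: nb; apply: (potential_balanced (c := c)) => f _.
  by have [->//|/ce' ->] := eqVneq f e0.
- by move=> [_ f2 _]; exact: two_flow_even.
- by move=> en; split=> //; exact: even2.
- move=> [_ f3 mn]; apply: three_flow_decomposition => //.
  by apply/negPn/negP => /even2/(mn 2 isT).
- move=> D; have f3 := decomposition_flow D; split=> // j j2 fj.
  rewrite ltn_neqAle j2 andbT; apply/eqP => j2'; rewrite -j2' in fj.
  exact: odd_no2 (odd_decomposition D) fj.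
- move=> nf on nD; split=> //.
    have [//|[c [e0 /tight_no_flow nf']]] := odd_four_flow_or_potential hG on.
    by case: nf'.
  move=> j j2 fj; rewrite leqNgt; apply/negP => j4.
  apply: nD; apply: three_flow_decomposition => //; exact: kflow_le fj.
Qed.
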